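(* For every real number $k \geq 0$ there is a constant $c_k>0$ (depending only on $k$) such that for all sufficiently large primes $q$, $$\sum_{\substack{\chi \bmod q\\ \chi \text{ primitive}}} |L(\tfrac12,\chi)|^{2k} \geq c_k\, \phi^*(q) (\log q)^{k^2}.$$
   Context: $L(s,\chi)$ denotes the Dirichlet $L$-function of the Dirichlet character $\chi$. The sum runs over primitive Dirichlet characters modulo $q$, and $\phi^*(q)$ denotes the number of primitive Dirichlet characters modulo $q$ (for prime $q$, $\phi^*(q)=q-2$). *)

(* Defs.v *)
From mathcomp Require Import all_boot all_order all_algebra.
From mathcomp Require Import all_classical all_reals all_analysis.
From mathcomp Require Import complex finmap.

Set Implicit Arguments.
Unset Strict Implicit.
Unset Printing Implicit Defensive.

Import Order.TTheory GRing.Theory Num.Theory numFieldNormedType.Exports.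

Local Open Scope classical_set_scope.
Local Open Scope ring_scope.
Local Open Scope complex_scope.

Definition dirichlet_character (R : realType) (q : nat) (chi : int -> R[i]) : Prop :=
  [/\ forall n : int, chi (n + q%:Z) = chi n,
      forall m n : int, chi (m * n) = chi m * chi n
    & forall n : int, chi n != 0 <-> coprimez n q%:Z].

Definition induced_from (R : realType) (q d : nat) (chi : int -> R[i]) : Prop :=
  exists psi : int -> R[i], dirichlet_character d psi /\
    forall n : int, coprimez n q%:Z -> chi n = psi n.

Definition primitive_character (R : realType) (q : nat) (chi : int -> R[i]) : Prop :=
  dirichlet_character q chi /\
  forall d : nat, (d %| q)%N -> (d < q)%N -> ~ induced_from q d chi.

Definition primitive_characters (R : realType) (q : nat) : set (int -> R[i]) :=
  [set chi | primitive_character q chi].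

Arguments primitive_characters R q : clear implicits.

(* The number of primitive characters modulo q; [fset_set] is the honest
   finite set here because there are finitely many characters for q > 0. *)
Definition phi_star (R : realType) (q : nat) : nat :=
  #|` fset_set (primitive_characters R q)|.

Definition cexp (R : realType) (z : R[i]) : R[i] :=
  (expR (complex.Re z))%:C *
    (cos (complex.Im z) +i* sin (complex.Im z)).

(* n^s = exp(s log n), with the real logarithm of n; meant for n > 0. *)
Definition natpowc (R : realType) (n : nat) (s : R[i]) : R[i] :=
  cexp (s * (ln (n%:R : R))%:C).

Definition converges_to (R : realType) (u : nat -> R[i]) (l : R[i]) : Prop :=
  series (u : nat -> R[i]^o) @ \oo --> (l : R[i]^o).

Definition analytic_at (R : realType) (f : R[i] -> R[i]) (s0 : R[i]) : Prop :=
  exists (a : nat -> R[i]) (r : R), 0 < r /\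
    forall s : R[i], Normc.normc (s - s0) < r ->
      converges_to (fun n => a n * (s - s0) ^+ n) (f s).

(* F is the Dirichlet series of chi on Re s > 1, continued analytically to
   the half-plane Re s > 0, except possibly at s = 1 (where L(s, chi) has a
   pole when chi is principal). *)
Definition is_dirichlet_L (R : realType) (chi : int -> R[i])
    (F : R[i] -> R[i]) : Prop :=
  (forall s : R[i], 1 < complex.Re s ->
     converges_to (fun n => chi n.+1%:Z * natpowc n.+1 (- s)) (F s)) /\
  (forall s : R[i], 0 < complex.Re s -> s != 1 -> analytic_at F s).

(* L(s, chi) for Re s > 0 and s != 1: there the continuation exists and, the
   domain being connected, all F satisfying [is_dirichlet_L chi F] agree.
   Nothing is claimed about the value at other s. *)
Definition dirichlet_L (R : realType) (chi : int -> R[i]) : R[i] -> R[i] :=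
  xget (fun=> 0) [set F | is_dirichlet_L chi F].

(* Main.v *)
Require Import Defs.
From mathcomp Require Import all_boot all_order all_algebra.
From mathcomp Require Import all_classical all_reals all_analysis.
From mathcomp Require Import complex finmap.
From mathcomp Require Import ring lra zify.
Import Order.TTheory GRing.Theory Num.Theory numFieldNormedType.Exports.
Local Open Scope classical_set_scope.
Local Open Scope ring_scope.
From mathcomp Require cyclic separable cyclotomic finfield.

(** Write q^(1/2) L(1/2, chi) = sum_a chi(a) f(a/q) with f = zeta(1/2, .) the Hurwitz zeta
   function. Orthogonality then turns the twisted first and second moments of L(1/2, chi) over all
   characters modulo q into values of f and into the averages q^-1 sum_t f(ht/q) f(kt/q). The latter
   are computed exactly for the modulus hkq, by the distribution relation of f, and compared with
   the modulus q through a bound for the total variation.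

   Split the primes up to a small power of q into groups g, and put P_g = sum_(p in g) chi(p) p^(-1/2)
   and sigma_g^2 = sum_(p in g) 1/p. Let B = prod_g (1 + k P_g), a short model of L^k, and let
   A = prod_g (1 + (k-1) P_g - ((k-1)/2) P_g^2), a model of L^(k-1) with |A|^k <= C |B|^(k-1) as long
   as all P_g are small and sum_g |P_g|^3 is bounded. With W = prod_g (1 + k^2 sigma_g^2), which has
   the order (log q)^(k^2), the mean of L A conj(B) is about W, the mean of |B|^2 is W and the mean
   of |L A|^2 is O(W). The characters with some large P_g contribute little to the mean of |B|^2, by
   a twelfth moment of P_g. Hence the characters with |L A| >= |B|/8 and all P_g small carry a
   positive proportion of the mean W of |B|^2, and for them |L|^(2k) >= c |B|^2. *)

(** Expanding logarithms shows where the coefficients come from: 1 + k P is exp(k P - k^2 P^2/2) up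
    to cubes, and with b = k - 1 the factor 1 + b P - (b/2) P^2 is exp(b P - (b k/2) P^2) up to
    cubes, so k log|A| and (k-1) log|B| agree to second order. The comparison is pointwise: no
    Hoelder inequality, with its restriction on k, intervenes, and all k > 0 are treated alike. The
    quadratic truncation demands small P_g, hence many groups. Their lengths are a compromise: a
    finer division reduces sum_g sigma_g^3 but raises the product of the largest primes of the
    groups, which must stay below a small power of q for the off-diagonal errors to be negligible.
    The mean of |L A|^2 is about log q prod_g (1 + (k^2-1) sigma_g^2), which is of order W only
    because sum_g sigma_g^2 is log log q + O(1); this needs the lower Mertens bound with its exact
    leading coefficient. The smallest primes, for which P_g is not small, are dropped at the cost of
    a constant depending on k alone. *)

Lemma sum_ord_mul (V : nmodType) (h N : nat) (F : nat -> V) :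
  \sum_(m < h * N) F m = \sum_(j < h) \sum_(n < N) F (n * h + j)%N.
Proof.
rewrite exchange_big /=; elim: N => [|N IH]; first by rewrite muln0 !big_ord0.
rewrite big_ord_recr /= -IH mulnSr big_split_ord /=; congr (_ + _).
by apply: eq_bigr => j _; rewrite [(N * h)%N]mulnC.
Qed.

(** * The Hurwitz zeta function at 1/2 *)

Section HalfPowers.
Variable R : realType.
Implicit Types (x y : R) (n N h : nat).

(** Comparison of t^(-1/2) at the ends of [x, x+1] with its integral; it drives both the
    monotonicity and the bounds of the Hurwitz sequence. *)
Lemma sqrt_step x : 0 < x ->
  (Num.sqrt (x + 1))^-1 <= 2 * (Num.sqrt (x + 1) - Num.sqrt x)
    <= (Num.sqrt x)^-1.
Proof.
move=> x0.
have s0 : 0 < Num.sqrt x by rewrite sqrtr_gt0.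
have t0 : 0 < Num.sqrt (x + 1) by rewrite sqrtr_gt0 addr_gt0.
have s2 : Num.sqrt x ^+ 2 = x by rewrite sqr_sqrtr // ltW.
have t2 : Num.sqrt (x + 1) ^+ 2 = x + 1 by rewrite sqr_sqrtr // ltW // addr_gt0.
move: s0 t0 s2 t2; set s := Num.sqrt x; set t := Num.sqrt _ => s0 t0 s2 t2.
have hh : 0 <= (t - s) ^+ 2 by apply: sqr_ge0.
by apply/andP; split; [rewrite -[t^-1]div1r ler_pdivrMr // | rewrite -[s^-1]div1r ler_pdivlMr //]; nra.
Qed.

Let natSD x N : N.+1%:R + x = N%:R + x + 1.
Proof. by rewrite -[N.+1]addn1 natrD addrAC. Qed.

Definition hz_part x N : R := \sum_(n < N) (Num.sqrt (n%:R + x))^-1.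

(* The Hurwitz zeta value zeta(1/2, x). *)
Definition hz x : R := limn (fun N => hz_part x N - 2 * Num.sqrt (N%:R + x)).

Lemma hz_partS x N : hz_part x N.+1 = hz_part x N + (Num.sqrt (N%:R + x))^-1.
Proof. by rewrite /hz_part big_ord_recr. Qed.

(** Subtracting [2 * Num.sqrt (N%:R + x)] rather than [2 * Num.sqrt N%:R] makes the sequence
    monotone by [sqrt_step], so that the limit exists as soon as it is bounded. *)
Lemma hz_seq_nd x : 0 < x ->
  nondecreasing_seq (fun N => hz_part x N - 2 * Num.sqrt (N%:R + x)).
Proof.
move=> x0; apply/nondecreasing_seqP => N.
have Nx0 : 0 < N%:R + x by rewrite ltr_wpDl.
have /andP[_] := sqrt_step _ Nx0.
rewrite hz_partS natSD => ?; lra.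
Qed.

Lemma hz_seq_ub x N : 0 < x ->
  hz_part x N - 2 * Num.sqrt (N%:R + x) <= (Num.sqrt x)^-1.
Proof.
move=> x0; have i0 : 0 <= (Num.sqrt x)^-1 by rewrite invr_ge0 sqrtr_ge0.
case: N => [|N].
  by rewrite /hz_part big_ord0 sub0r (le_trans _ i0) // oppr_le0 mulr_ge0 ?sqrtr_ge0.
have H : hz_part x N.+1 <= (Num.sqrt x)^-1 + 2 * Num.sqrt (N%:R + x) - 2 * Num.sqrt x.
  elim: N => [|N IH]; first by rewrite hz_partS /hz_part big_ord0 !add0r addrK.
  rewrite hz_partS.
  have Nx0 : 0 < N%:R + x by rewrite ltr_wpDl.
  have /andP[h _] := sqrt_step _ Nx0; move: h.
  rewrite natSD => h; lra.
have h2 : Num.sqrt (N%:R + x) <= Num.sqrt (N.+1%:R + x).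
  by rewrite ler_sqrt ?lerD2r ?ler_nat // addr_ge0 // ltW.
have := sqrtr_ge0 x; lra.
Qed.

Lemma hz_cvg0 x : 0 < x ->
  (fun N => hz_part x N - 2 * Num.sqrt (N%:R + x)) @ \oo --> hz x.
Proof.
move=> x0; apply: nondecreasing_is_cvgn; first exact: hz_seq_nd.
by exists (Num.sqrt x)^-1 => _ [N _ <-]; apply: hz_seq_ub.
Qed.

Lemma hz_ub x : 0 < x -> hz x <= (Num.sqrt x)^-1.
Proof.
move=> x0; apply: limr_le; first by apply/cvg_ex; exists (hz x); apply: hz_cvg0.
by apply: nearW => N; apply: hz_seq_ub.
Qed.

Lemma hz_lb x : 0 < x -> - (2 * Num.sqrt x) <= hz x.
Proof.
move=> x0.
have := nondecreasing_cvgn_le (hz_seq_nd _ x0) (cvgP _ (hz_cvg0 _ x0)) 0%N.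
by rewrite {1}/hz_part big_ord0 sub0r add0r.
Qed.

Lemma cvg_invsqrt0 : (fun N : nat => (Num.sqrt (N.+1%:R : R))^-1) @ \oo --> (0 : R).
Proof.
have := @cvg_comp _ _ _ _ _ _ _ _ (@cvg_harmonic R) (@sqrt_continuous R 0).
rewrite sqrtr0; apply: cvg_trans; apply: near_eq_cvg; apply: nearW => N /=.
by rewrite sqrtrV.
Qed.

Lemma cvg_sqrt_diff x : 0 <= x ->
  (fun N : nat => Num.sqrt (N%:R + x) - Num.sqrt N%:R) @ \oo --> (0 : R).
Proof.
move=> x0; rewrite -cvg_shiftS.
have cv : (fun N : nat => x * (Num.sqrt (N.+1%:R : R))^-1) @ \oo --> (0 : R).
  by rewrite -[X in _ --> X](mulr0 x); apply: cvgMr; exact: cvg_invsqrt0.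
apply: (@squeeze_cvgr _ _ _ _ (fun=> 0)) cv; last exact: cvg_cst.
apply: nearW => N /=.
have s0 : 0 < Num.sqrt (N.+1%:R : R) by rewrite sqrtr_gt0.
have t0 : Num.sqrt (N.+1%:R : R) <= Num.sqrt (N.+1%:R + x).
  by rewrite ler_sqrt ?lerDl // addr_ge0.
have s2 : Num.sqrt (N.+1%:R : R) ^+ 2 = N.+1%:R by rewrite sqr_sqrtr.
have t2 : Num.sqrt (N.+1%:R + x) ^+ 2 = N.+1%:R + x by rewrite sqr_sqrtr // addr_ge0.
rewrite subr_ge0 t0 /= ler_pdivlMr //.
move: s0 t0 s2 t2; set s := Num.sqrt _; set t := Num.sqrt _ => *; nra.
Qed.

(** The subtracted term no longer depends on [x]; it can therefore cancel between two arguments, in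
    the distribution relation, or against a sum of character values. *)
Lemma hz_cvg x : 0 < x ->
  (fun N => hz_part x N - 2 * Num.sqrt N%:R) @ \oo --> hz x.
Proof.
move=> x0; rewrite -[hz x]addr0 -(mulr0 2).
have -> : (fun N => hz_part x N - 2 * Num.sqrt N%:R) =
  (fun N => (hz_part x N - 2 * Num.sqrt (N%:R + x)) +
            2 * (Num.sqrt (N%:R + x) - Num.sqrt N%:R)) :> (nat -> R).
  by apply/funext => N; ring.
apply: cvgD; first exact: hz_cvg0.
by apply: cvgMr; apply: cvg_sqrt_diff; exact: ltW.
Qed.

Lemma hz_ni x y : 0 < x -> x <= y -> hz y <= hz x.
Proof.
move=> x0 xy; have y0 := lt_le_trans x0 xy.
apply: (ler_cvg_to (hz_cvg _ y0) (hz_cvg _ x0)); apply: nearW => N.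
rewrite lerD2r; apply: ler_sum => i _.
have ix : 0 < i%:R + x by rewrite ltr_wpDl.
have iy : 0 < i%:R + y by rewrite ltr_wpDl.
by rewrite lef_pV2 ?posrE ?sqrtr_gt0 // ler_sqrt ?lerD2l // ltW.
Qed.

Lemma hz_shift x : 0 < x -> hz x = (Num.sqrt x)^-1 + hz (x + 1).
Proof.
move=> x0; have x10 : 0 < x + 1 by rewrite addr_gt0.
have c1 : (fun N => hz_part x N.+1 - 2 * Num.sqrt (N.+1%:R + x)) @ \oo --> hz x.
  by have := hz_cvg0 _ x0; rewrite -cvg_shiftS.
have c2 : (fun N => (Num.sqrt x)^-1 + (hz_part (x+1) N - 2 * Num.sqrt (N%:R + (x+1)))) @ \oo
   --> (Num.sqrt x)^-1 + hz (x+1).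
  by apply: cvgD; [exact: cvg_cst | exact: hz_cvg0].
apply: (cvg_unique (@Rhausdorff R) c1).
apply: (cvg_trans _ c2); apply: near_eq_cvg; apply: nearW => N /=.
rewrite natSD [hz_part x _]/hz_part big_ord_recl /= add0r !addrA; congr (_ + _ - _).
by apply: eq_bigr => i _; rewrite /bump /= add1n natSD addrA.
Qed.

(** The distribution relation: ((x + j)/h + n)^(-1/2) is h^(1/2) (n h + j + x)^(-1/2), so the h
    partial sums interleave into one of length h N, and h sqrt(N) = sqrt(h) sqrt(h N) matches the
    subtracted terms. *)
Lemma hz_distr x h : (0 < h)%N -> 0 < x ->
  \sum_(j < h) hz ((x + j%:R) / h%:R) = Num.sqrt h%:R * hz x.
Proof.
move=> h0 x0; have hR : 0 < h%:R :> R by rewrite ltr0n.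
have c1 : (fun N => \sum_(j < h) (hz_part ((x + j%:R) / h%:R) N - 2 * Num.sqrt N%:R)) @ \oo
    --> \sum_(j < h) hz ((x + j%:R) / h%:R).
  apply: cvg_big; first by move=> z; apply: add_continuous.
  by move=> j _; apply: hz_cvg; rewrite divr_gt0 // ltr_wpDr.
have c2 : (fun N => Num.sqrt h%:R * (hz_part x (h * N)%N - 2 * Num.sqrt (h * N)%:R)) @ \oo
    --> Num.sqrt h%:R * hz x.
  apply: cvgMr; have := hz_cvg _ x0; apply: cvg_comp.
  apply/cvgnyPge => A; near=> N; apply: (@leq_trans N); last by rewrite leq_pmull.
  by near: N; exact: nbhs_infty_ge.
apply: (cvg_unique (@Rhausdorff R) c1).
apply: (cvg_trans _ c2); apply: near_eq_cvg; apply: nearW => N /=.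
rewrite big_split /= sumr_const card_ord mulrBr; congr (_ + _).
  rewrite /hz_part (sum_ord_mul _ _ _ (fun m => (Num.sqrt (m%:R + x))^-1)) mulr_sumr.
  apply: eq_bigr => j _; rewrite mulr_sumr; apply: eq_bigr => n _.
  have -> : (n * h + j)%:R + x = h%:R * (n%:R + (x + j%:R) / h%:R) :> R.
    by rewrite natrD natrM; field; rewrite lt0r_neq0.
  rewrite sqrtrM ?ler0n // invfM mulrA divff ?mul1r // lt0r_neq0 // sqrtr_gt0 //.
rewrite natrM sqrtrM ?ler0n // -[RHS]mulr_natr.
transitivity (- (2 * Num.sqrt N%:R) * (Num.sqrt (h%:R : R)) ^+ 2); first by ring.
by rewrite sqr_sqrtr // ler0n.
Unshelve. all: by end_near. Qed.

End HalfPowers.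

(** Representatives are taken in 1, ..., M, since the Hurwitz function is singular at 0 and the zero
    class has to be sent to the argument 1. *)
Definition rep (M a : nat) : nat := ((a + M.-1) %% M).+1.

Lemma rep_le M a : (0 < M)%N -> (rep M a <= M)%N.
Proof. by move=> M0; rewrite /rep ltn_mod. Qed.

Lemma rep_mod M a : (0 < M)%N -> rep M a = a %[mod M].
Proof.
move=> M0; rewrite /rep -addn1 modnDml -addnA addn1 prednK // -modnDmr modnn addn0 //.
Qed.

Lemma rep_small M a : (0 < a)%N -> (a <= M)%N -> rep M a = a.
Proof.
case: a => // a _ aM; have M0 : (0 < M)%N by apply: leq_trans aM.
by rewrite /rep addSnnS prednK // modnDr modn_small.
Qed.

Lemma rep_eq M a b : a = b %[mod M] -> rep M a = rep M b.
Proof. by move=> e; rewrite /rep -modnDml e modnDml. Qed.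

Lemma rep_unique M a r : (0 < r)%N -> (r <= M)%N -> r = a %[mod M] -> rep M a = r.
Proof. by move=> r0 rM /rep_eq <-; rewrite rep_small. Qed.

Lemma rep_scale c M a : (0 < c)%N -> (0 < M)%N -> rep (c * M) (c * a) = (c * rep M a)%N.
Proof.
move=> c0 M0; apply: rep_unique; first by rewrite muln_gt0 c0.
  by rewrite leq_pmul2l // rep_le.
by rewrite -!muln_modr rep_mod.
Qed.

Lemma rep_succ M a : (0 < M)%N -> ~~ (M %| a)%N -> rep M a.+1 = (rep M a).+1.
Proof.
move=> M0 nd; apply: rep_unique => //.
  rewrite ltn_neqAle rep_le // andbT; apply: contra nd => /eqP e.
  by rewrite /dvdn -(rep_mod M a M0) e modnn.
by rewrite -addn1 -modnDml rep_mod // modnDml addn1.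
Qed.

(** * Periodic Hurwitz values and their twisted averages *)

Section TwistedSums.
Variable R : realType.
Implicit Types (x y : R) (h k q M N : nat).

Definition hF M a : R := hz R ((rep M a)%:R / M%:R).

(** For a prime modulus this is, up to the single term t = 0, the mean of |L(1/2,chi)|^2 chi(h)
    conj(chi(k)), see [mean_Lam2]. *)
Definition SS M h k : R := M%:R^-1 * \sum_(t < M) hF M (h * t) * hF M (k * t).

Lemma hF_eq M a b : a = b %[mod M] -> hF M a = hF M b.
Proof. by move=> e; rewrite /hF (rep_eq M a b e). Qed.

Lemma hF_scale c M a : (0 < c)%N -> (0 < M)%N -> hF (c * M) (c * a) = hF M a.
Proof.
move=> c0 M0; rewrite /hF rep_scale // !natrM; congr (hz _ _).
by rewrite -mulf_div divff ?mul1r // pnatr_eq0 -lt0n.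
Qed.

Lemma repV_itv M a : (0 < M)%N -> 0 < ((rep M a)%:R / M%:R : R) <= 1.
Proof.
move=> M0; rewrite divr_gt0 ?ltr0n //= ler_pdivrMr ?ltr0n // mul1r ler_nat.
exact: rep_le.
Qed.

Lemma hF_ge M a : (0 < M)%N -> -2 <= hF M a.
Proof.
move=> M0; have /andP[r0 r1] := repV_itv M a M0.
apply: le_trans (hz_lb R _ r0); rewrite lerNl opprK -[leRHS]mulr1 ler_pM2l //.
by rewrite -[leRHS]sqrtr1 ler_sqrt.
Qed.

Lemma hF_le M a : (0 < M)%N -> hF M a <= Num.sqrt (M%:R / (rep M a)%:R).
Proof.
move=> M0; have /andP[r0 r1] := repV_itv M a M0.
by apply: le_trans (hz_ub R _ r0) _; rewrite -sqrtrV ?invf_div // ltW.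
Qed.

Lemma hF_sqr_le M a : (0 < M)%N -> hF M a ^+ 2 <= M%:R / (rep M a)%:R + 4.
Proof.
move=> M0; have h1 := hF_ge M a M0; have h2 := hF_le M a M0.
have p : 0 <= M%:R / (rep M a)%:R :> R by rewrite divr_ge0 ?ler0n.
have h3 := sqrtr_ge0 (M%:R / (rep M a)%:R : R); have h4 := sqr_sqrtr p.
move: h1 h2 h3 h4; set s := Num.sqrt _; set f := hF M a => h1 h2 h3 <-.
case: (leP 0 f) => f0; nra.
Qed.

Lemma hF_distr h k M t : (0 < h)%N -> (0 < M)%N -> coprime k h ->
  \sum_(j < h) hF (h * M) (k * (j * M + t)) = Num.sqrt h%:R * hF M (k * t).
Proof.
move=> h0 M0 kh; have /andP[r0 _] := repV_itv M (k * t) M0.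
have hM0 : (0 < h * M)%N by rewrite muln_gt0 h0.
rewrite -[hF M _]/(hz R _) -hz_distr //.
pose x j := (k * (j * M + t) + (h * M).-1)%N.
have ilt (j : 'I_h) : (x j %% (h * M) %/ M < h)%N by rewrite ltn_divLR // ltn_mod.
pose f (j : 'I_h) := Ordinal (ilt j).
have xM j : (x j %% (h * M) %% M)%N = (rep M (k * t)).-1.
  rewrite modn_dvdm ?dvdn_mull // /x /rep /= mulnDr.
  have -> : ((h * M).-1 = h.-1 * M + M.-1)%N.
    by case: (h) h0 => // h' _; rewrite mulSn; case: (M) M0 => // M' _; rewrite addnC addnS.
  rewrite addnACA -modnDml mulnA -mulnDl modnMl add0n //.
have finj : injective f.
  move=> i j /(congr1 val) /= e; apply/val_inj => /=.
  have e2 : x i = x j %[mod h * M].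
    by rewrite (divn_eq (x i %% (h * M)) M) e xM -(xM j) -divn_eq.
  move: e2; rewrite /x => /eqP; rewrite eqn_modDr !mulnDr eqn_modDr !mulnA !(mulnC _ M).
  rewrite ![in X in _ == X %[mod _]]mulnA -!mulnA.
  rewrite [(M * h)%N]lock -lock -!muln_modr eqn_pmul2l // => /eqP e3.
  have : (val i == val j %[mod h]).
    case: (leqP (val i) (val j)) => ij.
      rewrite eq_sym eqn_mod_dvd // -(@Gauss_dvdr _ k) 1?coprime_sym //.
      by rewrite mulnBr -eqn_mod_dvd ?leq_mul // eq_sym e3.
    rewrite eqn_mod_dvd ?(ltnW ij) // -(@Gauss_dvdr _ k) 1?coprime_sym //.
    by rewrite mulnBr -eqn_mod_dvd ?leq_mul ?(ltnW ij) // e3.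
  by rewrite !modn_small ?ltn_ord // => /eqP.
rewrite [RHS](reindex_inj finj) /=; apply: eq_bigr => j _.
have -> : hF (h * M) (k * (j * M + t)) = hz R ((x j %% (h * M) %/ M * M + rep M (k * t))%:R / (h * M)%:R).
  by rewrite /hF {1}/rep -/(x j) {1}(divn_eq (x j %% (h * M)) M) xM -addnS prednK.
have hn : h%:R != 0 :> R by rewrite pnatr_eq0 -lt0n.
have Mn : M%:R != 0 :> R by rewrite pnatr_eq0 -lt0n.
by congr (hz _ _); rewrite natrD !natrM /=; field; rewrite hn Mn.
Qed.

Lemma SS_sym M h k : SS M h k = SS M k h.
Proof. by rewrite /SS; congr (_ * _); apply: eq_bigr => t _; rewrite mulrC. Qed.

Lemma sum_ord_mulC h M (F : nat -> R) :
  \sum_(m < h * M) F m = \sum_(j < M) \sum_(n < h) F (n * M + j)%N.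
Proof. by rewrite mulnC; exact: sum_ord_mul. Qed.

(** For t = n M + j the first factor depends on j alone, and the distribution relation sums the
    second over n: a factor sqrt h against the normalisation h. *)
Lemma SS_mull h k M : (0 < h)%N -> (0 < M)%N -> coprime k h ->
  SS (h * M) h k = (Num.sqrt h%:R)^-1 * SS M 1 k.
Proof.
move=> h0 M0 kh.
rewrite /SS (sum_ord_mulC h M (fun t => hF (h * M) (h * t) * hF (h * M) (k * t))).
have -> : \sum_(j < M) \sum_(n < h)
    hF (h * M) (h * (n * M + j)) * hF (h * M) (k * (n * M + j)) =
    Num.sqrt h%:R * \sum_(j < M) hF M (1 * j) * hF M (k * j).
  rewrite mulr_sumr; apply: eq_bigr => j _.
  rewrite mulrCA -hF_distr // mulr_sumr; apply: eq_bigr => n _.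
  congr (_ * _); rewrite (hF_scale h M) // mul1n.
  by apply: hF_eq; rewrite modnMDl.
have s0 : Num.sqrt h%:R != 0 :> R by rewrite sqrtr_eq0 -ltNge ltr0n.
have e : h%:R = Num.sqrt h%:R * Num.sqrt h%:R :> R by rewrite -expr2 sqr_sqrtr.
rewrite natrM {1}e !invfM -!mulrA; congr (_ * _).
by rewrite [M%:R^-1 * (_ * _)]mulrCA mulKf.
Qed.

(** Each twist is removed by one use of [SS_mull]; at this larger modulus there is no error term. *)
Lemma SS_exact h k M : (0 < h)%N -> (0 < k)%N -> (0 < M)%N -> coprime h k ->
  SS (h * k * M) h k = (Num.sqrt (h * k)%:R)^-1 * SS M 1 1.
Proof.
move=> h0 k0 M0 hk; rewrite -mulnA SS_mull ?muln_gt0 ?k0 // 1?coprime_sym //.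
rewrite SS_sym SS_mull // ?coprime1n // mulrA natrM sqrtrM ?ler0n // invfM //.
Qed.

(** Within each block of N consecutive points, every value differs from the sampled last one by at
    most the bound [d] for the increments, summed over the block. *)
Lemma sample_variation (w d : nat -> R) N q :
  (forall u, (u.+1 < N * q)%N -> `|w u.+2 - w u.+1| <= d u) ->
  (forall u, 0 <= d u) ->
  `|N%:R * (\sum_(t < q) w (N * t.+1)%N) - \sum_(u < N * q) w u.+1|
    <= N%:R * \sum_(u < N * q) d u.
Proof.
move=> wd d0.
have sumE (F : nat -> R) : \sum_(u < N * q) F u = \sum_(t < q) \sum_(i < N) F (N * t + i)%N.
  elim: q {wd} => [|p IH]; first by rewrite muln0 !big_ord0.
  by rewrite mulnSr big_split_ord /= IH big_ord_recr.
rewrite (sumE (fun u => w u.+1)) (sumE d) !mulr_sumr -sumrB.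
apply: le_trans (ler_norm_sum _ _ _) _; apply: ler_sum => t _.
have -> : N%:R * w (N * t.+1)%N - \sum_(i < N) w (N * t + i).+1 =
    \sum_(i < N) (w (N * t.+1)%N - w (N * t + i).+1).
  by rewrite big_split /= sumrN sumr_const card_ord mulr_natl.
apply: le_trans (ler_norm_sum _ _ _) _.
rewrite mulr_natl -[X in _ *+ X]card_ord -sumr_const; apply: ler_sum => i _.
have key m : (i + m < N)%N ->
    `|w (N * t + i + m).+1 - w (N * t + i).+1| <= \sum_(j < m) d (N * t + (i + j))%N.
  elim: m => [|m IH] im; first by rewrite addn0 subrr normr0 big_ord0.
  have im' : (i + m < N)%N by apply: ltnW; rewrite -addnS.
  rewrite big_ord_recr /= [leRHS]addrC.
  rewrite -[X in `|X|](subrKA (w (N * t + i + m).+1)) addrC.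
  apply: le_trans (ler_normD _ _) _; rewrite [leRHS]addrC lerD ?IH //.
  rewrite addnS addnA; apply: wd.
  apply: (@leq_trans (N * t.+1)%N); last by rewrite leq_mul2l ltn_ord orbT.
  by rewrite mulnSr -addnA -addnS ltn_add2l -addnS.
have e : (i + (N - i.+1)).+1 = N by rewrite -addSn subnKC.
have := key (N - i.+1)%N; rewrite {1}e leqnn => /(_ isT).
rewrite -[(N * t + i + _)%N]addnA -[X in w X - _]addnS e -mulnSr.
move=> h; apply: le_trans h _.
rewrite -(big_mkord xpredT (fun j => d (N * t + (i + j))%N)) -(big_mkord xpredT (fun j => d (N * t + j)%N)).
rewrite (@big_cat_nat _ _ _ i 0%N N) //=; last exact: ltnW.
rewrite -[X in _ + \sum_(X <= _ < _) _]add0n big_addn.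
apply: ler_wpDl; first by apply: sumr_ge0.
rewrite (@big_cat_nat _ _ _ (N - i.+1)%N 0%N (N - i)%N) //=; last by rewrite leq_sub2l.
apply: ler_wpDr; first by apply: sumr_ge0.
by rewrite le_eqVlt; apply/orP; left; apply/eqP; apply: eq_bigr => j _; rewrite [(j + i)%N]addnC.
Qed.

Lemma count_dvdn_succ n d : (0 < d)%N ->
  \sum_(u < n * d) (d %| u.+1)%N%:R = n%:R :> R.
Proof.
move=> d0; elim: n => [|n IH]; first by rewrite mul0n big_ord0.
rewrite mulSnr big_split_ord /= IH -[n.+1]addn1 natrD; congr (_ + _).
case: d d0 {IH} => // d _; rewrite big_ord_recr /= big1 => [|i _].
  by rewrite -addnS dvdn_addr ?dvdn_mull // dvdnn add0r.
by rewrite -[(n * _ + i).+1]addnS dvdn_addr ?dvdn_mull // gtnNdvd // ltnS ltn_ord.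
Qed.

Definition Hn N : R := \sum_(t < N) t.+1%:R^-1.

Lemma ln_succ_bounds N : (0 < N)%N ->
  (N.+1%:R : R)^-1 <= ln (N.+1%:R : R) - ln (N%:R : R) <= N%:R^-1.
Proof.
move=> N0; have p : 0 < N%:R :> R by rewrite ltr0n.
have p1 : 0 < N.+1%:R :> R by rewrite ltr0n.
have e1 : ln (N.+1%:R : R) - ln (N%:R : R) = ln (N.+1%:R / N%:R : R).
  by rewrite ln_div ?posrE.
have e2 : ln (N.+1%:R : R) - ln (N%:R : R) = - ln (N%:R / N.+1%:R : R).
  by rewrite ln_div ?posrE // opprB.
apply/andP; split.
  rewrite e2 lerNr.
  have -> : N%:R / N.+1%:R = 1 + (- N.+1%:R^-1) :> R.
    by rewrite -natr1; field; rewrite natr1 lt0r_neq0.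
  by apply: le_ln1Dx; rewrite ltrN2 invf_lt1 // ltr1n ltnS.
rewrite e1; have -> : N.+1%:R / N%:R = 1 + N%:R^-1 :> R.
  by rewrite -natr1; field; rewrite lt0r_neq0.
by apply: le_ln1Dx; rewrite (lt_trans _ (_ : 0 < _)) ?invr_gt0 // ltrN10.
Qed.

Lemma Hn_diff q m : (0 < q)%N ->
  ln (q + m).+1%:R - ln q.+1%:R <= Hn (q + m) - Hn q <= ln ((q + m)%:R : R) - ln q%:R.
Proof.
move=> q0; elim: m => [|m /andP[IH1 IH2]]; first by rewrite addn0 !subrr lexx.
rewrite addnS; have e : Hn (q + m).+1 = Hn (q + m) + (q + m).+1%:R^-1.
  by rewrite /Hn big_ord_recr.
have /andP[_ b1] := ln_succ_bounds (q + m).+1 isT.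
have /andP[b2 _] := ln_succ_bounds (q + m)%N (ltn_addr _ q0).
move: IH1 IH2 b1 b2; rewrite e.
move: (ln _) (ln _) (ln _) (ln _) (Hn _) (Hn _) (_^-1) => a b c d f g i *.
by apply/andP; split; lra.
Qed.

(** Harmonic sums against logarithms; this difference is the origin of the term ln (h k) in
    [SS_twist]. *)
Lemma Hn_mul N q : (0 < N)%N -> (0 < q)%N ->
  `|Hn (N * q) - Hn q - ln (N%:R : R)| <= q%:R^-1.
Proof.
move=> N0 q0; have := Hn_diff q (N * q - q)%N q0.
rewrite subnKC ?leq_pmull // => /andP[h1 h2].
have pq : 0 < q%:R :> R by rewrite ltr0n.
have pN : 0 < N%:R :> R by rewrite ltr0n.
have e : ln ((N * q)%:R : R) = ln N%:R + ln q%:R by rewrite natrM lnM ?posrE.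
have /andP[_ b1] := ln_succ_bounds q q0.
have b2 : ln ((N * q)%:R : R) <= ln (N * q).+1%:R.
  by rewrite ler_ln ?posrE ?ltr0n ?muln_gt0 ?N0 // ler_nat.
have q1 : 0 <= (q%:R : R)^-1 by rewrite invr_ge0 ler0n.
by rewrite ler_norml; apply/andP; split; lra.
Qed.

Lemma Hn_le q : (0 < q)%N -> Hn q <= 1 + ln (q%:R : R).
Proof.
move=> q0; have := Hn_diff 1 q.-1 isT; rewrite add1n prednK // ln1 subr0 => /andP[_].
by rewrite {2}/Hn big_ord_recr big_ord0 /= add0r invr1 => h; lra.
Qed.

Lemma sum_succ_per (V : nmodType) M (G : nat -> V) : G M = G 0%N ->
  \sum_(t < M) G t.+1 = \sum_(t < M) G t.
Proof.
case: M => [|M] e; first by rewrite !big_ord0.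
by rewrite big_ord_recr [RHS]big_ord_recl /= e addrC.
Qed.

Lemma SS11_le q : (0 < q)%N -> SS q 1 1 <= ln (q%:R : R) + 5.
Proof.
move=> q0; have pq : 0 < q%:R :> R by rewrite ltr0n.
have e0 : hF q (1 * q) * hF q (1 * q) = hF q (1 * 0) * hF q (1 * 0).
  by rewrite (hF_eq q (1 * q) (1 * 0)) // mul1n modnn muln0 mod0n.
rewrite /SS -(sum_succ_per R q (fun t => hF q (1 * t) * hF q (1 * t)) e0).
apply: (@le_trans _ _ (q%:R^-1 * \sum_(t < q) (q%:R / t.+1%:R + 4))).
  rewrite ler_pM2l ?invr_gt0 //; apply: ler_sum => t _.
  by rewrite mul1n -expr2; have := hF_sqr_le q t.+1 q0; rewrite rep_small.
rewrite big_split /= sumr_const card_ord -mulr_sumr mulrDr mulKf ?lt0r_neq0 //.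
rewrite -[4 *+ q]mulr_natl mulKf ?lt0r_neq0 //.
by have := Hn_le q q0; rewrite /Hn => h; lra.
Qed.

End TwistedSums.

(** * Twisted sums of Hurwitz zeta values *)

Section TwistedEstimate.
Variable R : realType.
Implicit Types (x y : R) (h k q M N u v : nat).

Local Notation F := (hF R).

Lemma hF3_ge1 M u : (0 < M)%N -> 1 <= F M u + 3.
Proof. by move=> M0; have := hF_ge R M u M0 => ?; lra. Qed.

Lemma hF_step M u : (0 < M)%N -> ~~ (M %| u)%N -> F M u.+1 <= F M u.
Proof.
move=> M0 nd; have /andP[r0 _] := repV_itv R M u M0.
apply: hz_ni => //; rewrite rep_succ // ler_pM2r ?invr_gt0 ?ltr0n //.
by rewrite ler_nat.
Qed.

Lemma hF_le_sqrt M u : (0 < M)%N -> F M u <= Num.sqrt M%:R.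
Proof.
move=> M0; apply: le_trans (hF_le R M u M0) _.
rewrite ler_sqrt // ler_pdivrMr ?ltr0n // ler_peMr ?ler0n //.
by rewrite ler1n.
Qed.

Lemma hz1_bounds x : 0 <= x <= 1 -> -3 <= hz R (x + 1) <= 1.
Proof.
move=> /andP[x0 x1]; have p : 0 < x + 1 by rewrite ltr_wpDl.
apply/andP; split.
  apply: le_trans (hz_lb R _ p); rewrite lerNl opprK.
  have h1 := sqrtr_ge0 (x + 1); have h2 := sqr_sqrtr (ltW p).
  move: h1 h2; set s := Num.sqrt _ => *; nra.
apply: le_trans (hz_ub R _ p) _.
rewrite invf_le1 ?sqrtr_gt0 // -[leLHS]sqrtr1 ler_sqrt //; lra.
Qed.

Lemma hF_first M u : (0 < u)%N -> (u <= M)%N ->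
  F M u = Num.sqrt M%:R * (Num.sqrt u%:R)^-1 + hz R (u%:R / M%:R + 1).
Proof.
move=> u0 uM; have M0 : (0 < M)%N by apply: leq_trans uM.
rewrite /hF rep_small // hz_shift; last by rewrite divr_gt0 ?ltr0n.
by rewrite -sqrtrV ?divr_ge0 // invf_div sqrtrM // sqrtrV.
Qed.

Lemma sqrt_mul_split h k q :
  Num.sqrt (h * k)%:R * q%:R = Num.sqrt (k * q)%:R * Num.sqrt (h * q)%:R :> R.
Proof.
rewrite !natrM !sqrtrM ?ler0n // mulrACA -expr2 sqr_sqrtr //.
by rewrite [Num.sqrt k%:R * _]mulrC.
Qed.

(** The shift by 3 makes both factors positive, so that their product decreases wherever both do.
    Near u = 0 the product behaves like sqrt(h k) q / u; without the removal of this term the total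
    variation would be of order q instead of sqrt q. *)
Definition w1 h k q u : R :=
  (F (k * q) u + 3) * (F (h * q) u + 3) - Num.sqrt (h * k)%:R * q%:R / u%:R.

(** Before the first jump, [hF_first] splits each factor into a singular and a regular part. The
    product of the singular parts is the term removed in [w1], and the rest is a sum of products of
    nonnegative decreasing functions. *)
Lemma w1_first h k q v : (0 < v)%N -> (v < k * q)%N -> (v < h * q)%N ->
  w1 h k q v.+1 <= w1 h k q v.
Proof.
move=> v0 vk vh.
have e u : (0 < u)%N -> (u <= k * q)%N -> (u <= h * q)%N -> w1 h k q u =
   Num.sqrt (k * q)%:R * (Num.sqrt u%:R)^-1 * (hz R (u%:R / (h * q)%:R + 1) + 3) +
   Num.sqrt (h * q)%:R * (Num.sqrt u%:R)^-1 * (hz R (u%:R / (k * q)%:R + 1) + 3) +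
   (hz R (u%:R / (h * q)%:R + 1) + 3) * (hz R (u%:R / (k * q)%:R + 1) + 3).
  move=> u0 uk uh; rewrite /w1 !hF_first //.
  have su : Num.sqrt u%:R != 0 :> R by rewrite sqrtr_eq0 -ltNge ltr0n.
  have eu : u%:R^-1 = (Num.sqrt u%:R)^-1 ^+ 2 :> R by rewrite exprVn sqr_sqrtr.
  by rewrite sqrt_mul_split eu; ring.
rewrite !e //; try by apply: ltnW.
have M1 : (0 < k * q)%N by apply: leq_trans vk.
have M2 : (0 < h * q)%N by apply: leq_trans vh.
have G M u : (0 < u <= M)%N -> 0 <= hz R (u%:R / M%:R + 1) + 3.
  move=> /andP[u0 uM]; have M0 : (0 < M)%N by apply: leq_trans uM.
  have /hz1_bounds/andP[b _] : 0 <= (u%:R / M%:R : R) <= 1.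
    by rewrite divr_ge0 //= ler_pdivrMr ?ltr0n // mul1r ler_nat.
  by rewrite -lerBlDr sub0r.
have D M : (0 < M)%N -> hz R (v.+1%:R / M%:R + 1) + 3 <= hz R (v%:R / M%:R + 1) + 3.
  move=> M0; rewrite lerD2r; apply: hz_ni; first by rewrite ltr_wpDl // divr_ge0.
  by rewrite lerD2r ler_pM2r ?invr_gt0 ?ltr0n // ler_nat.
have P : (Num.sqrt v.+1%:R)^-1 <= (Num.sqrt v%:R)^-1 :> R.
  by rewrite lef_pV2 ?posrE ?sqrtr_gt0 ?ltr0n // ler_sqrt // ler_nat.
have vk' : (0 < v.+1 <= k * q)%N by [].
have vh' : (0 < v.+1 <= h * q)%N by [].
have P0 : 0 <= (Num.sqrt v.+1%:R)^-1 :> R by rewrite invr_ge0 sqrtr_ge0.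
rewrite !lerD ?ler_pM ?D ?G ?mulr_ge0 ?sqrtr_ge0 //.
Qed.

(** Coprimality of h and k keeps a multiple v of k q below h k q from being a multiple of h q. So
    only the first factor jumps to its singularity, of size sqrt(k q), while the second does not
    exceed its value at v, bounded in terms of sqrt h. *)
Lemma jump_bound h k q v : (0 < h)%N -> (0 < k)%N -> (0 < q)%N -> coprime h k ->
  (0 < v)%N -> (k * q %| v)%N -> (v < h * k * q)%N ->
  (F (k * q) v.+1 + 3) * (F (h * q) v.+1 + 3)
   <= 16 * Num.sqrt (h * k)%:R * Num.sqrt q%:R.
Proof.
move=> h0 k0 q0 hk v0 /dvdnP[i vi] vQ.
have i0 : (0 < i)%N by case: i vi => // vi; rewrite vi mul0n in v0.
have ih : (i < h)%N.
  by move: vQ; rewrite vi -mulnA ltn_pmul2r // muln_gt0 k0.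
have nd : ~~ (h * q %| v)%N.
  apply/negP; rewrite vi [(k * q)%N]mulnC mulnA [(i * q)%N]mulnC -mulnA [(h * q)%N]mulnC dvdn_pmul2l //.
  by rewrite mulnC Gauss_dvdr // gtnNdvd.
have h1 : F (h * q) v.+1 <= Num.sqrt h%:R.
  apply: le_trans (hF_step _ _ _ nd) _; first by rewrite muln_gt0 h0.
  rewrite vi [(k * q)%N]mulnC mulnCA [(h * q)%N]mulnC hF_scale //.
  exact: hF_le_sqrt.
have h2 : F (k * q) v.+1 <= Num.sqrt (k * q)%:R by apply: hF_le_sqrt; rewrite muln_gt0 k0.
have g1 := hF3_ge1 (k * q) v.+1; rewrite muln_gt0 k0 q0 in g1; have {}g1 := g1 isT.
have g2 := hF3_ge1 (h * q) v.+1; rewrite muln_gt0 h0 q0 in g2; have {}g2 := g2 isT.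
have s1 n : (0 < n)%N -> 1 <= Num.sqrt n%:R :> R.
  by move=> n0; rewrite -[leLHS]sqrtr1 ler_sqrt ?ler1n.
have sh := s1 h h0; have sk := s1 (k * q)%N; rewrite muln_gt0 k0 q0 in sk; have {}sk := sk isT.
have -> : 16 * Num.sqrt (h * k)%:R * Num.sqrt q%:R =
   (4 * Num.sqrt (k * q)%:R) * (4 * Num.sqrt h%:R) :> R.
  by rewrite !natrM !sqrtrM ?ler0n //; ring.
apply: ler_pM; lra.
Qed.

Lemma sqrt_nat_le M : Num.sqrt M%:R <= M%:R :> R.
Proof.
case: M => [|M]; first by rewrite sqrtr0.
rewrite -[leRHS]ger0_norm // -sqrtr_sqr ler_sqrt ?exprn_ge0 //.
by rewrite expr2 ler_peMr // ler1n.
Qed.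

(** The variation is w(1) - w(Q) plus twice the increases. Increases occur after multiples of k q
    and h q, at most h + k in number and of size O(sqrt(h k q)), and through the removed singular
    term, by at most sqrt(h k)/q each. *)
Lemma w1_variation h k q : (0 < h)%N -> (0 < k)%N -> (0 < q)%N -> coprime h k ->
  exists d : nat -> R, [/\ forall u, 0 <= d u,
   forall u, (u.+1 < h * k * q)%N -> `|w1 h k q u.+2 - w1 h k q u.+1| <= d u &
   \sum_(u < h * k * q) d u <= 100 * (h * k)%:R ^+ 2 * Num.sqrt q%:R].
Proof.
move=> h0 k0 q0 hk; set Q := (h * k * q)%N; set w := w1 h k q.
have Q0 : (0 < Q)%N by rewrite !muln_gt0 h0 k0.
have hq0 : (0 < h * q)%N by rewrite muln_gt0 h0.
have kq0 : (0 < k * q)%N by rewrite muln_gt0 k0.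
exists (fun u => if (u.+1 < Q)%N then `|w u.+2 - w u.+1| else 0).
split=> [u|u ->|]; rewrite ?lexx //; first by case: ifP.
pose E1 : R := 16 * Num.sqrt (h * k)%:R * Num.sqrt q%:R.
pose T : R := Num.sqrt (h * k)%:R / q%:R.
(* [e] bounds the upward increments: a full jump at a multiple of either modulus, and [T] for the
   drift of the removed term once u >= q. *)
pose e u : R := E1 * ((k * q %| u.+1)%N%:R + (h * q %| u.+1)%N%:R) + T.
have T0 : 0 <= T by rewrite divr_ge0 ?sqrtr_ge0.
have E0 : 0 <= E1 by rewrite !mulr_ge0 ?sqrtr_ge0.
have qR : 0 < q%:R :> R by rewrite ltr0n.
have sing v : (q <= v)%N -> Num.sqrt (h * k)%:R * q%:R / v%:R -
    Num.sqrt (h * k)%:R * q%:R / v.+1%:R <= T.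
  move=> qv; have vR : 0 < v%:R :> R by rewrite ltr0n; apply: leq_trans qv.
  rewrite /T -mulrBr -mulrA ler_wpM2l ?sqrtr_ge0 //.
  have -> : v%:R^-1 - v.+1%:R^-1 = (v%:R * v.+1%:R)^-1 :> R.
    rewrite -natr1; field; rewrite natr1 pnatr_eq0 /= lt0r_neq0 //.
  have v1R : 0 < v.+1%:R :> R by rewrite ltr0n.
  rewrite -[q%:R^-1]div1r ler_pdivrMr ?(mulr_gt0 vR v1R) // mulrAC ler_pdivlMr // mul1r.
  by rewrite ler_pM // ler_nat // ltnW // ltnS.
have Tsing v : (q <= v)%N -> w v.+1 <= (F (k * q) v.+1 + 3) * (F (h * q) v.+1 + 3) -
    Num.sqrt (h * k)%:R * q%:R / v%:R + T.
  have aux (a b c t : R) : c - b <= t -> a - b <= a - c + t by move=> ?; lra.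
  by move=> qv; apply: aux; apply: sing.
have De v : (v.+1 < Q)%N -> w v.+2 - w v.+1 <= e v.
  move=> vQ; rewrite /e.
  have [/orP dv|/norP[d1 d2]] := boolP ((k * q %| v.+1) || (h * q %| v.+1))%N.
    have qv : (q <= v.+1)%N.
      by case: dv => /dvdn_leq-/(_ isT); apply: leq_trans; rewrite leq_pmull.
    have g1 := hF3_ge1 _ v.+1 kq0; have g2 := hF3_ge1 _ v.+1 hq0.
    have J : (F (k * q) v.+2 + 3) * (F (h * q) v.+2 + 3) <= E1.
      case: dv => dv; first by apply: jump_bound.
      have kh : coprime k h by rewrite coprime_sym.
      have := jump_bound k h q v.+1 k0 h0 q0 kh isT dv.
      by rewrite [(k * h)%N]mulnC => /(_ vQ); rewrite [_ * (F (k * q) _ + _)]mulrC.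
    have E2 : E1 <= E1 * ((k * q %| v.+1)%N%:R + (h * q %| v.+1)%N%:R).
      rewrite -[leLHS]mulr1 ler_wpM2l //.
      by case: dv => ->; rewrite ?lerDl ?lerDr.
    have Y : 0 <= (F (k * q) v.+1 + 3) * (F (h * q) v.+1 + 3) by apply: mulr_ge0; lra.
    have aux (a x y s t c d : R) : a <= x - s + t -> x <= c -> c <= d -> 0 <= y ->
      a - (y - s) <= d + t by move=> *; lra.
    exact: (aux _ _ _ _ _ _ _ (Tsing _ qv) J E2 Y).
  rewrite (negbTE d1) (negbTE d2) addr0 mulr0 add0r.
  have [vk|vk] := ltnP v.+1 (k * q); last first.
    have qv : (q <= v.+1)%N by apply: leq_trans vk; rewrite leq_pmull.
    have g1 := hF3_ge1 _ v.+2 kq0; have g2 := hF3_ge1 _ v.+2 hq0.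
    have Y : (F (k * q) v.+2 + 3) * (F (h * q) v.+2 + 3) <= (F (k * q) v.+1 + 3) * (F (h * q) v.+1 + 3).
      by rewrite ler_pM ?lerD2r ?hF_step //; lra.
    have aux (a x y s t : R) : a <= x - s + t -> x <= y -> a - (y - s) <= t by move=> *; lra.
    exact: (aux _ _ _ _ _ (Tsing _ qv) Y).
  have [vh|vh] := ltnP v.+1 (h * q); last first.
    have qv : (q <= v.+1)%N by apply: leq_trans vh; rewrite leq_pmull.
    have g1 := hF3_ge1 _ v.+2 kq0; have g2 := hF3_ge1 _ v.+2 hq0.
    have Y : (F (k * q) v.+2 + 3) * (F (h * q) v.+2 + 3) <= (F (k * q) v.+1 + 3) * (F (h * q) v.+1 + 3).
      by rewrite ler_pM ?lerD2r ?hF_step //; lra.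
    have aux (a x y s t : R) : a <= x - s + t -> x <= y -> a - (y - s) <= t by move=> *; lra.
    exact: (aux _ _ _ _ _ (Tsing _ qv) Y).
  by apply: le_trans T0; rewrite subr_le0; apply: w1_first.
have e0 v : 0 <= e v.
  by rewrite addr_ge0 // mulr_ge0 // addr_ge0 // ler0n.
(* An increment x with x <= e and 0 <= e satisfies |x| <= 2 e - x, and the terms - x telescope. *)
have S1 : \sum_(u < Q) (if (u.+1 < Q)%N then `|w u.+2 - w u.+1| else 0) <=
    w 1%N - w Q + 2 * \sum_(u < Q) e u.
  clear -De e0 Q0; move: De; case: Q Q0 => // Q _ De.
  rewrite !big_ord_recr /= ltnn addr0.
  have <- : \sum_(u < Q) (w u.+1 - w u.+2) = w 1%N - w Q.+1.
    rewrite -(big_mkord xpredT (fun u => w u.+1 - w u.+2)).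
    under eq_bigr do rewrite -opprB.
    by rewrite sumrN (telescope_sumr (fun u => w u.+1) (leq0n Q)) opprB.
  rewrite mulrDr addrA; apply: ler_wpDr; first by rewrite mulr_ge0.
  rewrite mulr_sumr -big_split /=; apply: ler_sum => u _.
  rewrite ltnS ltn_ord ler_norml.
  have := De u; rewrite ltnS ltn_ord => /(_ isT) => h1; have := e0 u => h2.
  by apply/andP; split; lra.
apply: le_trans S1 _.
have Se : \sum_(u < Q) e u = E1 * (h%:R + k%:R) + (h * k)%:R * Num.sqrt (h * k)%:R.
  rewrite /e big_split /= -mulr_sumr big_split /=.
  rewrite [X in E1 * (X + _)](_ : _ = h%:R); last first.
    by rewrite /Q -mulnA count_dvdn_succ.
  rewrite [X in E1 * (_ + X)](_ : _ = k%:R); last first.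
    by rewrite /Q [(h * k)%N]mulnC -mulnA count_dvdn_succ.
  congr (_ + _); rewrite sumr_const card_ord -[LHS]mulr_natl /T /Q [(h * k * q)%:R]natrM.
  by rewrite -mulrA; congr (_ * _); rewrite mulrCA mulfV ?mulr1 // lt0r_neq0.
rewrite Se.
have b1 : 1 <= (h * k)%:R :> R by rewrite ler1n muln_gt0 h0.
have b2 : 1 <= Num.sqrt q%:R :> R by rewrite -[leLHS]sqrtr1 ler_sqrt ?ler1n.
have b3 := sqrt_nat_le (h * k).
have b4 := sqrtr_ge0 ((h * k)%:R : R).
have b5 : h%:R <= (h * k)%:R :> R by rewrite ler_nat leq_pmulr.
have b6 : k%:R <= (h * k)%:R :> R by rewrite ler_nat leq_pmull.
have b7 : - w Q <= 1.
  rewrite /w /w1 opprB lerBlDr.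
  have g1 := hF3_ge1 _ Q kq0; have g2 := hF3_ge1 _ Q hq0.
  apply: (@le_trans _ _ 1); last by rewrite lerDl mulr_ge0 //; lra.
  rewrite ler_pdivrMr ?ltr0n // mul1r /Q [X in _ <= X]natrM ler_wpM2r //.
have b8 : w 1%N <= 24 * (h * k)%:R * Num.sqrt q%:R.
  rewrite /w /w1 divr1 !hF_first //.
  rewrite sqrtr1 invr1 !mulr1.
  have i1 M : (0 < M)%N -> 0 <= hz R (1 / M%:R + 1) + 3 <= 4.
    move=> M0; have /hz1_bounds/andP[] : 0 <= (1 / M%:R : R) <= 1.
      by rewrite divr_ge0 //= ler_pdivrMr ?ltr0n // mul1r ler1n.
    by move=> *; apply/andP; split; lra.
  have /andP[i2 i3] := i1 _ kq0; have /andP[i4 i5] := i1 _ hq0.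
  rewrite sqrt_mul_split.
  have s1 M : (M <= h * k)%N -> Num.sqrt (M * q)%:R <= (h * k)%:R * Num.sqrt q%:R :> R.
    move=> Mh; rewrite natrM sqrtrM // ler_wpM2r ?sqrtr_ge0 //.
    by apply: le_trans (sqrt_nat_le _) _; rewrite ler_nat.
  have j1 := s1 k (leq_pmull _ h0); have j2 := s1 h (leq_pmulr _ k0).
  have j3 := sqrtr_ge0 ((k * q)%:R : R); have j4 := sqrtr_ge0 ((h * q)%:R : R).
  have j5 : 1 <= (h * k)%:R * Num.sqrt q%:R :> R by nra.
  have aux (x y a b z : R) : 0 <= a + 3 -> a + 3 <= 4 -> 0 <= b + 3 -> b + 3 <= 4 ->
      x <= z -> y <= z -> 0 <= x -> 0 <= y -> 1 <= z ->
      (x + a + 3) * (y + b + 3) - x * y <= 24 * z.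
    move=> a1 a2 b1' b2' xz yz x0 y0 z1.
    have -> : (x + a + 3) * (y + b + 3) - x * y = x * (b + 3) + y * (a + 3) + (a + 3) * (b + 3) by ring.
    have l1 : x * (b + 3) <= z * 4 by apply: ler_pM.
    have l2 : y * (a + 3) <= z * 4 by apply: ler_pM.
    have l3 : (a + 3) * (b + 3) <= 4 * 4 by apply: ler_pM.
    lra.
  by rewrite -[24 * _ * _]mulrA; exact: aux.
have E1b : E1 <= 16 * (h * k)%:R * Num.sqrt q%:R.
  by rewrite /E1 ler_wpM2r ?sqrtr_ge0 // ler_wpM2l.
have b9 : E1 * (h%:R + k%:R) <= 32 * (h * k)%:R ^+ 2 * Num.sqrt q%:R.
  apply: (@le_trans _ _ (16 * (h * k)%:R * Num.sqrt q%:R * (2 * (h * k)%:R))).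
    by apply: ler_pM => //; lra.
  by rewrite le_eqVlt; apply/orP; left; apply/eqP; ring.
have b10 : (h * k)%:R <= (h * k)%:R ^+ 2 :> R by rewrite expr2; nra.
have b11 : (h * k)%:R * Num.sqrt q%:R <= (h * k)%:R ^+ 2 * Num.sqrt q%:R :> R.
  by rewrite ler_wpM2r // (le_trans ler01).
have b12 : (h * k)%:R * Num.sqrt (h * k)%:R <= (h * k)%:R ^+ 2 * Num.sqrt q%:R :> R.
  rewrite expr2 -mulrA ler_wpM2l //; nra.
have b13 : 1 <= (h * k)%:R ^+ 2 * Num.sqrt q%:R :> R by nra.
have b8' : w 1%N <= 24 * ((h * k)%:R ^+ 2 * Num.sqrt q%:R).
  by apply: le_trans b8 _; rewrite -mulrA ler_wpM2l.
rewrite -mulrA in b9; rewrite -[100 * _ * _]mulrA.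
have aux (a b c d u : R) : a <= 24 * u -> - b <= 1 -> c <= 32 * u -> d <= u -> 1 <= u ->
  a - b + 2 * (c + d) <= 100 * u by move=> *; lra.
exact: aux.
Qed.


Lemma sum_coprime_mul q g (G : nat -> R) : coprime g q ->
  (forall a b, a = b %[mod q] -> G a = G b) ->
  \sum_(t < q) G (g * t)%N = \sum_(t < q) G t.
Proof.
move=> gq Gper; case: q gq Gper => [|q] gq Gper; first by rewrite !big_ord0.
pose f (t : 'I_q.+1) := Ordinal (ltn_pmod (g * t) (ltn0Sn q)).
have finj : injective f.
  move=> i j /(congr1 val) /= /eqP e; apply/val_inj => /=.
  wlog ij : i j e / (i <= j)%N.
    by move=> W; case: (leqP i j) => [/W->//|/ltnW /W -> //]; rewrite eq_sym.
  move: e; rewrite eq_sym eqn_mod_dvd ?leq_mul // -mulnBr Gauss_dvdr 1?coprime_sym //.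
  rewrite -eqn_mod_dvd // !modn_small ?ltn_ord // => /eqP -> //.
rewrite [RHS](reindex_inj finj); apply: eq_bigr => t _ /=.
by apply: Gper; rewrite modn_mod.
Qed.

Lemma hF_sum M : (0 < M)%N -> \sum_(t < M) F M t = Num.sqrt M%:R * hz R 1.
Proof.
move=> M0; rewrite -(sum_succ_per R M (F M)); last by apply: hF_eq; rewrite modnn mod0n.
rewrite -hz_distr //; apply: eq_bigr => t _.
by rewrite /hF rep_small // -[t.+1]addn1 natrD addrC.
Qed.

Lemma hz1_1 : -2 <= hz R 1 <= 1.
Proof.
have h1 := hz_lb R 1 ltr01; have h2 := hz_ub R 1 ltr01.
by move: h1 h2; rewrite sqrtr1 invr1 mulr1 => -> ->.
Qed.

Lemma sum_shift3 (n : nat) (a b : nat -> R) :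
  \sum_(t < n) (a t + 3) * (b t + 3) =
  \sum_(t < n) a t * b t + 3 * \sum_(t < n) a t + 3 * \sum_(t < n) b t + 9 * n%:R.
Proof.
have -> : 9 * n%:R = \sum_(t < n) (9 : R) by rewrite sumr_const card_ord mulr_natr.
rewrite !mulr_sumr -!big_split /=; apply: eq_bigr => t _; ring.
Qed.

(** Sampling the modulus h k q at multiples of h k gives the average at modulus q, while the full
    sum is exact by [SS_exact]. The singular terms removed in [w1] give harmonic sums to q and to h
    k q, and their difference is ln (h k). *)
Lemma SS_twist h k q : (0 < h)%N -> (0 < k)%N -> (0 < q)%N ->
  coprime h k -> coprime h q -> coprime k q ->
  `|SS R q h k - (Num.sqrt (h * k)%:R)^-1 * (SS R q 1 1 - ln (h * k)%:R)|
    <= 125 * (h * k)%:R ^+ 2 / Num.sqrt q%:R.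
Proof.
move=> h0 k0 q0 hk hq kq.
have [d [d0 dw dS]] := w1_variation h k q h0 k0 q0 hk.
have := sample_variation R (w1 h k q) d (h * k) q dw d0.
have hk0 : (0 < h * k)%N by rewrite muln_gt0 h0.
have NR : 1 <= (h * k)%:R :> R by rewrite ler1n.
have qR : 0 < q%:R :> R by rewrite ltr0n.
have sq0 : 0 < Num.sqrt q%:R :> R by rewrite sqrtr_gt0.
have sq2 : Num.sqrt q%:R ^+ 2 = q%:R :> R by rewrite sqr_sqrtr // ltW.
have sN0 : 0 < Num.sqrt (h * k)%:R :> R by rewrite sqrtr_gt0 ltr0n.
have sN1 : 1 <= Num.sqrt (h * k)%:R :> R by rewrite -[leLHS]sqrtr1 ler_sqrt // (le_trans ler01).
have sN2 : Num.sqrt (h * k)%:R ^+ 2 = (h * k)%:R :> R by rewrite sqr_sqrtr // ltW.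
have E1 : \sum_(t < q) w1 h k q (h * k * t.+1)%N =
   q%:R * SS R q h k + 6 * (Num.sqrt q%:R * hz R 1) + 9 * q%:R
   - Num.sqrt (h * k)%:R * q%:R / (h * k)%:R * Hn R q.
  rewrite /w1 big_split /= sumrN; congr (_ - _); last first.
    rewrite /Hn mulr_sumr; apply: eq_bigr => t _.
    by rewrite [(h * k * t.+1)%:R]natrM invfM mulrA.
  rewrite (eq_bigr (fun t : 'I_q => (F q (h * t.+1) + 3) * (F q (k * t.+1) + 3))); last first.
    by move=> t _; rewrite [X in F (k * q) X]mulnAC [X in F (k * q) X]mulnC -[(h * k * t.+1)%N]mulnA !hF_scale.
  rewrite (sum_shift3 q (fun t => F q (h * t.+1)) (fun t => F q (k * t.+1))).
  have per c : F q (c * q) = F q (c * 0) by apply: hF_eq; rewrite muln0 modnMl mod0n.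
  have sF c : coprime c q -> \sum_(t < q) F q (c * t.+1) = Num.sqrt q%:R * hz R 1.
    move=> cq; rewrite (sum_succ_per R q (fun t => F q (c * t))) // -hF_sum //.
    by rewrite (sum_coprime_mul q c (F q)) // => a b; apply: hF_eq.
  rewrite !sF // (sum_succ_per R q (fun t => F q (h * t) * F q (k * t))); last by rewrite !per.
  rewrite /SS mulVKf ?lt0r_neq0 //.
  by move: (Num.sqrt _ * _) => z; ring.
have E2 : \sum_(u < h * k * q) w1 h k q u.+1 =
   (h * k)%:R * q%:R * ((Num.sqrt (h * k)%:R)^-1 * SS R q 1 1) +
   3 * (h%:R * (Num.sqrt (k * q)%:R * hz R 1)) + 3 * (k%:R * (Num.sqrt (h * q)%:R * hz R 1)) +
   9 * ((h * k)%:R * q%:R) - Num.sqrt (h * k)%:R * q%:R * Hn R (h * k * q).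
  rewrite /w1 big_split /= sumrN; congr (_ - _); last first.
    by rewrite /Hn mulr_sumr.
  rewrite (sum_shift3 (h * k * q) (fun u => F (k * q) u.+1) (fun u => F (h * q) u.+1)).
  have QR : (h * k * q)%:R != 0 :> R by rewrite pnatr_eq0 -lt0n !muln_gt0 h0 k0.
  have sF c M : (0 < M)%N -> \sum_(u < c * M) F M u.+1 = c%:R * (Num.sqrt M%:R * hz R 1).
    move=> M0; rewrite (sum_succ_per R (c * M) (F M)); last by apply: hF_eq; rewrite modnMl mod0n.
    rewrite (sum_ord_mulC R c M (F M)) -hF_sum // mulr_sumr; apply: eq_bigr => j _.
    rewrite (eq_bigr (fun=> F M j)) ?sumr_const ?card_ord ?mulr_natl // => n _.
    by apply: hF_eq; rewrite modnMDl.
  rewrite -[in X in _ + X + _ + _]mulnA sF ?muln_gt0 ?k0 //.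
  rewrite [in X in _ + X + _](_ : (h * k * q = k * (h * q))%N); last by rewrite mulnA [(k * h)%N]mulnC.
  rewrite sF ?muln_gt0 ?h0 // [(h * k * q)%:R]natrM; congr (_ + _ + _ + _).
  rewrite -SS_exact // /SS -[(h * k)%:R * q%:R]natrM mulrA mulfV // mul1r.
  rewrite (sum_succ_per R _ (fun u => F (k * q) u * F (h * q) u)); last first.
    have z1 : h * k * q = 0 %[mod k * q] by rewrite -mulnA modnMl mod0n.
    have z2 : h * k * q = 0 %[mod h * q] by rewrite [(h * k)%N]mulnC -mulnA modnMl mod0n.
    by rewrite (hF_eq R _ _ 0 z1) (hF_eq R _ _ 0 z2).
  apply: eq_bigr => -[u /= _] _; congr (_ * _).
    by rewrite -mulnA hF_scale // muln_gt0 k0.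
  by rewrite [(h * k)%N]mulnC -mulnA hF_scale // muln_gt0 h0.
rewrite E1 E2 => H.
have H2 : `|(h * k)%:R * (q%:R * SS R q h k + 6 * (Num.sqrt q%:R * hz R 1) + 9 * q%:R -
     Num.sqrt (h * k)%:R * q%:R / (h * k)%:R * Hn R q) -
     ((h * k)%:R * q%:R * ((Num.sqrt (h * k)%:R)^-1 * SS R q 1 1) +
      3 * (h%:R * (Num.sqrt (k * q)%:R * hz R 1)) +
      3 * (k%:R * (Num.sqrt (h * q)%:R * hz R 1)) + 9 * ((h * k)%:R * q%:R) -
      Num.sqrt (h * k)%:R * q%:R * Hn R (h * k * q))| <=
   (h * k)%:R * (100 * (h * k)%:R ^+ 2 * Num.sqrt q%:R).
  by apply: le_trans H _; rewrite ler_wpM2l.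
clear H E1 E2 dS dw.
have /andP[z1 z2] := hz1_1.
have Hd := Hn_mul R (h * k) q hk0 q0.
have j1 : `|(6 * (h * k)%:R * Num.sqrt q%:R - 3 * h%:R * Num.sqrt (k * q)%:R
     - 3 * k%:R * Num.sqrt (h * q)%:R) * hz R 1| <= 24 * (h * k)%:R * Num.sqrt q%:R.
  have s1 b : Num.sqrt (b * q)%:R <= b%:R * Num.sqrt q%:R :> R.
    by rewrite natrM sqrtrM // ler_wpM2r ?sqrt_nat_le // ltW.
  have a1 : h%:R * Num.sqrt (k * q)%:R <= (h * k)%:R * Num.sqrt q%:R :> R.
    by rewrite [(h * k)%:R]natrM -mulrA ler_wpM2l.
  have a2 : k%:R * Num.sqrt (h * q)%:R <= (h * k)%:R * Num.sqrt q%:R :> R.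
    by rewrite [(h * k)%N]mulnC [(k * h)%:R]natrM -mulrA ler_wpM2l.
  have a3 : 0 <= h%:R * Num.sqrt (k * q)%:R :> R by rewrite mulr_ge0 ?sqrtr_ge0.
  have a4 : 0 <= k%:R * Num.sqrt (h * q)%:R :> R by rewrite mulr_ge0 ?sqrtr_ge0.
  have a5 : `|hz R 1| <= 2 by rewrite ler_norml; apply/andP; split; lra.
  have -> : 24 * (h * k)%:R * Num.sqrt q%:R = (12 * ((h * k)%:R * Num.sqrt q%:R)) * 2 :> R by ring.
  rewrite normrM ler_pM // ler_norml -!mulrA.
  by move: a1 a2 a3 a4; move: (_ * _) (_ * _) (_ * _) => x y z *; apply/andP; split; lra.
set N : R := (h * k)%:R in NR sN0 sN1 sN2 H2 Hd j1 *.
set Z := hz R 1 in H2 j1 z1 z2.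
set s := Num.sqrt q%:R in sq0 sq2 H2 j1 *.
set sN := Num.sqrt N in sN0 sN1 sN2 H2 *.
set L := ln N in Hd *.
have e : SS R q h k - sN^-1 * (SS R q 1 1 - L) =
   (N * q%:R)^-1 * ((N * (q%:R * SS R q h k + 6 * (s * Z) + 9 * q%:R - sN * q%:R / N * Hn R q) -
     (N * q%:R * (sN^-1 * SS R q 1 1) + 3 * (h%:R * (Num.sqrt (k * q)%:R * Z)) +
      3 * (k%:R * (Num.sqrt (h * q)%:R * Z)) + 9 * (N * q%:R) - sN * q%:R * Hn R (h * k * q)))
    - (6 * N * s - 3 * h%:R * Num.sqrt (k * q)%:R - 3 * k%:R * Num.sqrt (h * q)%:R) * Z)
   - sN^-1 * (Hn R (h * k * q) - Hn R q - L).
  rewrite -sN2; move: (Num.sqrt (k * q)%:R) (Num.sqrt (h * q)%:R) => x y.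
  by field; rewrite !lt0r_neq0.
rewrite e; apply: le_trans (ler_normB _ _) _.
have t1 : `|sN^-1 * (Hn R (h * k * q) - Hn R q - L)| <= s^-1.
  have iN0 : 0 <= sN^-1 by rewrite invr_ge0 ltW.
  rewrite normrM (ger0_norm iN0) -[leRHS]mul1r ler_pM //.
    by rewrite invf_le1.
  apply: le_trans Hd _; rewrite lef_pV2 ?posrE // -sq2 expr2 ler_peMr ?(ltW sq0) //.
  by rewrite /s -[leLHS]sqrtr1 ler_sqrt // ler1n.
have N0 : 0 < N by apply: lt_le_trans NR.
(* 125 = 100 + 24 + 1: the variation, the linear terms left by the shift by 3, and the harmonic
   sums. *)
have t2 : 125 * N ^+ 2 / s = (N * q%:R)^-1 * (N * (100 * N ^+ 2 * s) + 24 * N ^+ 2 * N * s) + N ^+ 2 / s.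
  have sn := lt0r_neq0 sq0; have Nn := lt0r_neq0 N0.
  have gen (a b : R) : a != 0 -> b != 0 -> 125 * a ^+ 2 / b =
      (a * b ^+ 2)^-1 * (a * (100 * a ^+ 2 * b) + 24 * a ^+ 2 * a * b) + a ^+ 2 / b.
    by move=> an bn; field; rewrite an bn.
  by rewrite -sq2; apply: gen.
rewrite t2 lerD //; last first.
  by apply: le_trans t1 _; rewrite ler_peMl ?invr_ge0 ?(ltW sq0) // exprn_ege1.
rewrite normrM ger0_norm; last by rewrite invr_ge0 mulr_ge0 // ltW.
rewrite ler_wpM2l ?invr_ge0 ?mulr_ge0 ?(ltW N0) ?(ltW qR) //.
apply: le_trans (ler_normB _ _) _; rewrite lerD //.
apply: le_trans j1 _; rewrite ler_wpM2r ?(ltW sq0) // ler_wpM2r ?(ltW N0) //.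
by rewrite ler_peMr // exprn_ege1.
Qed.

(** With m = g h, n = g k and g = gcd(m, n), [lgk] and [gk] are ln(h k) and 1/sqrt(h k), the data of
    the main term of the second moment after the common factor has been divided out by
    [SS_dilate]. *)
Definition lgk (m n : nat) : R := ln (m %/ gcdn m n * (n %/ gcdn m n))%:R.
Definition gk (m n : nat) : R := (gcdn m n)%:R / Num.sqrt (m * n)%:R.

Lemma SS_dilate g h k q : coprime g q -> SS R q (g * h) (g * k) = SS R q h k.
Proof.
move=> gq.
have per a b : a = b %[mod q] -> F q (h * a) * F q (k * a) = F q (h * b) * F q (k * b).
  by move=> e; rewrite (hF_eq R q (h * a) (h * b)) ?(hF_eq R q (k * a) (k * b)) // -modnMmr e modnMmr.
rewrite /SS -(sum_coprime_mul q g (fun t => F q (h * t) * F q (k * t)) gq per); congr (_ * _).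
by apply: eq_bigr => t _; rewrite !mulnA ![(g * _)%N]mulnC.
Qed.

Lemma sqr_nat_mono (c : R) (x y z : nat) : 0 <= c -> (x <= y)%N ->
  c * x%:R ^+ 2 / Num.sqrt z%:R <= c * y%:R ^+ 2 / Num.sqrt z%:R.
Proof.
move=> c0 xy; rewrite ler_wpM2r ?invr_ge0 ?sqrtr_ge0 // ler_wpM2l //.
by rewrite lerXn2r ?nnegrE // ler_nat.
Qed.

Lemma SS_second m n q : (0 < m)%N -> (0 < n)%N -> (0 < q)%N ->
  coprime m q -> coprime n q ->
  `|SS R q m n - gk m n * (SS R q 1 1 - lgk m n)| <= 125 * (m * n)%:R ^+ 2 / Num.sqrt q%:R.
Proof.
move=> m0 n0 q0 mq nq; set g := gcdn m n.
have g0 : (0 < g)%N by rewrite gcdn_gt0 m0.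
pose h := (m %/ g)%N; pose k := (n %/ g)%N.
have mh : m = (g * h)%N by rewrite mulnC divnK // dvdn_gcdl.
have nk : n = (g * k)%N by rewrite mulnC divnK // dvdn_gcdr.
have h0 : (0 < h)%N by move: m0; rewrite mh muln_gt0 g0.
have k0 : (0 < k)%N by move: n0; rewrite nk muln_gt0 g0.
have gq : coprime g q by move: mq; rewrite mh coprimeMl => /andP[].
have hq : coprime h q by move: mq; rewrite mh coprimeMl => /andP[].
have kq : coprime k q by move: nq; rewrite nk coprimeMl => /andP[].
have hk : coprime h k.
  rewrite /coprime -(eqn_pmul2l g0) muln1 muln_gcdr -mh -nk //.
have gR : 0 < g%:R :> R by rewrite ltr0n.
have hkmn : (h * k <= m * n)%N := leq_mul (leq_div m g) (leq_div n g).
have e1 : SS R q m n = SS R q h k by rewrite {1}mh {1}nk SS_dilate.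
have e2 : gk m n = (Num.sqrt (h * k)%:R)^-1.
  rewrite /gk -/g {1}mh {1}nk mulnACA natrM sqrtrM // natrM -expr2 sqrtr_sqr ger0_norm ?ltW //.
  by rewrite invfM mulrA mulfV ?mul1r // lt0r_neq0.
rewrite e1 e2 /lgk -/g -/h -/k; apply: le_trans (SS_twist h k q h0 k0 q0 hk hq kq) _.
exact: (sqr_nat_mono _ _ _ _ (ler0n R 125) hkmn).
Qed.

(** Main term of the twisted first moment: the equation a m = n has the solution a = n/m, whose
    coefficient in L(1/2, chi) is (n/m)^(-1/2). *)
Definition dk (m n : nat) : R := (m %| n)%N%:R * (Num.sqrt m%:R / Num.sqrt n%:R).

(** If m divides n, then a is congruent to the small number n/m and the singular part of f gives the
    main term. If not, the representative of a is at least q/m, for otherwise its product with m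
    would be n itself; hence f(a/q) is at most sqrt m. *)
Lemma first_moment_term m n a q : (0 < m)%N -> (0 < n)%N -> (n < q)%N -> coprime m q ->
  a * m = n %[mod q] ->
  `|(Num.sqrt q%:R)^-1 * F q a - dk m n| <= 4 * m%:R / Num.sqrt q%:R.
Proof.
move=> m0 n0 nq mq amn; have q0 : (0 < q)%N by apply: leq_trans nq.
have sq0 : 0 < Num.sqrt q%:R :> R by rewrite sqrtr_gt0 ltr0n.
have m1 : 1 <= m%:R :> R by rewrite ler1n.
have i0 : 0 <= (Num.sqrt q%:R)^-1 :> R by rewrite invr_ge0 ltW.
rewrite /dk; have [mn|mn] := boolP (m %| n)%N.
  have [b nb] := dvdnP mn.
  have b0 : (0 < b)%N by move: n0; rewrite nb muln_gt0 => /andP[].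
  have ab : a = b %[mod q].
    move: amn; rewrite nb => /eqP e; apply/eqP; move: e.
    case: (leqP a b) => [ab|/ltnW ab]; [rewrite eq_sym [in X in _ -> X]eq_sym|];
    by rewrite !eqn_mod_dvd ?leq_mul // -mulnBl Gauss_dvdl // coprime_sym.
  have bq : (b <= q)%N by apply: leq_trans (ltnW nq); rewrite nb leq_pmulr.
  rewrite (hF_eq R q a b ab) hF_first // mul1r.
  have /hz1_bounds/andP[z1 z2] : 0 <= (b%:R / q%:R : R) <= 1.
    by rewrite divr_ge0 //= ler_pdivrMr ?ltr0n // mul1r ler_nat.
  have -> : Num.sqrt m%:R / Num.sqrt n%:R = (Num.sqrt b%:R)^-1 :> R.
    rewrite nb natrM sqrtrM // invfM mulrCA mulfV ?mulr1 //.
    by rewrite sqrtr_eq0 -ltNge ltr0n.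
  rewrite mulrDr mulKf ?lt0r_neq0 // addrAC subrr add0r normrM ger0_norm // mulrC.
  by rewrite ler_wpM2r // ler_norml; apply/andP; split; lra.
rewrite mul0r subr0 normrM ger0_norm // mulrC ler_wpM2r //.
have r1 : (q <= rep q a * m)%N.
  rewrite leqNgt; apply/negP => lt; move/negP: mn; apply.
  have : rep q a * m = n %[mod q] by rewrite -modnMml rep_mod // modnMml.
  by rewrite !modn_small // => <-; rewrite dvdn_mull.
have h1 := hF_ge R q a q0.
have h2 : F q a <= Num.sqrt m%:R.
  apply: le_trans (hF_le R q a q0) _; rewrite ler_sqrt // ler_pdivrMr ?ltr0n //.
  by rewrite -natrM ler_nat mulnC.
have h3 := sqrt_nat_le m.
by rewrite ler_norml; apply/andP; split; lra.
Qed.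

End TwistedEstimate.

Set Implicit Arguments.
Unset Strict Implicit.
Unset Printing Implicit Defensive.
Local Open Scope complex_scope.

(** * Characters modulo a prime and their moments *)

Section ComplexNorm.
Variable R : realType.
Implicit Types z : R[i].
Local Notation normc := (@Normc.normc R).

Lemma mul_conjc z : z * conjc z = (normc z ^+ 2)%:C.
Proof.
case: z => a b /=; rewrite sqr_sqrtr ?addr_ge0 ?sqr_ge0 //.
by apply/eqP; rewrite eq_complex /= !expr2; apply/andP; split; apply/eqP; ring.
Qed.

Lemma conjcM z1 z2 : conjc (z1 * z2) = conjc z1 * conjc z2.
Proof.
case: z1 z2 => a b [c d]; apply/eqP; rewrite eq_complex /=.
by apply/andP; split; apply/eqP; ring.
Qed.

Lemma normc_ge0 z : 0 <= normc z.
Proof. by case: z => a b /=; rewrite sqrtr_ge0. Qed.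

Lemma normc_real (x : R) : normc x%:C = `|x|.
Proof. by rewrite /= expr0n addr0 sqrtr_sqr. Qed.

Lemma normcX z n : normc (z ^+ n) = normc z ^+ n.
Proof.
by elim: n => [|n IH]; rewrite ?expr0 ?Normc.normc1 // !exprS Normc.normcM IH.
Qed.

Lemma normc_conj z : normc (conjc z) = normc z.
Proof. by case: z => a b /=; rewrite sqrrN. Qed.

Lemma normc_eq0 z : (normc z == 0) = (z == 0).
Proof. by apply/eqP/eqP => [/Normc.eq0_normc //|->]; rewrite Normc.normc0. Qed.

Lemma ler_normc_sum (I : Type) (r : seq I) (P : pred I) (F : I -> R[i]) :
  normc (\sum_(i <- r | P i) F i) <= \sum_(i <- r | P i) normc (F i).
Proof.
elim/big_rec2: _ => [|i y x _ h]; first by rewrite Normc.normc0.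
by apply: le_trans (le_normcD _ _) _; rewrite lerD2l.
Qed.

Lemma Re_le_normc z : `|complex.Re z| <= normc z.
Proof.
case: z => a b /=; rewrite -sqrtr_sqr ler_sqrt ?addr_ge0 ?sqr_ge0 //.
by rewrite lerDl sqr_ge0.
Qed.

Lemma Im_le_normc z : `|complex.Im z| <= normc z.
Proof.
case: z => a b /=; rewrite -sqrtr_sqr ler_sqrt ?addr_ge0 ?sqr_ge0 //.
by rewrite lerDr sqr_ge0.
Qed.

Lemma C_prim_root n : (0 < n)%N -> exists z : R[i], n.-primitive_root z.
Proof.
move=> n_gt0; pose p : {poly R[i]} := 'X^n - 1; have [r Dp] := closed_field_poly_normal p.
rewrite (monicP _) ?monicXnsubC // scale1r in Dp.
have rn1 : all n.-unity_root r by apply/allP=> z; rewrite -root_prod_XsubC -Dp.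
have sz_r : (n < (size r).+1)%N.
  by rewrite -(size_prod_XsubC r id) -Dp size_XnsubC.
have [|z] := hasP (cyclic.has_prim_root n_gt0 rn1 _ sz_r); last by exists z.
by rewrite -separable.separable_prod_XsubC -Dp cyclotomic.separable_Xn_sub_1 // pnatr_eq0 -lt0n.
Qed.

End ComplexNorm.

Lemma Fp_expq q (x : 'F_q) : prime q -> x ^+ q = x.
Proof. by move=> pq; have := finfield.expf_card x; rewrite (card_Fp pq). Qed.

Lemma Fp_prim_root q : prime q -> exists g : 'F_q, q.-1.-primitive_root g.
Proof.
move=> pq; have q1 := prime_gt1 pq.
have n0 : (0 < q.-1)%N by rewrite -ltnS prednK // ltnW.
pose rs : seq 'F_q := [seq x <- enum 'F_q | x != 0].
have Urs : uniq rs by rewrite filter_uniq // enum_uniq.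
have sz : size rs = q.-1.
  have <- : #|'F_q|.-1 = q.-1 by rewrite card_Fp.
  rewrite size_filter; have := count_predC (pred1 (0 : 'F_q)) (enum 'F_q).
  by rewrite -cardE (count_uniq_mem _ (enum_uniq _)) mem_enum add1n => <-.
have un : all q.-1.-unity_root rs.
  apply/allP => x; rewrite mem_filter => /andP[x0 _]; apply/unity_rootP.
  apply: (mulIf x0); rewrite mul1r -exprSr prednK; last exact: ltnW.
  exact: Fp_expq.
have /hasP[g _ gp] := cyclic.has_prim_root n0 un Urs (eq_leq (esym sz)).
by exists g.
Qed.

Section Characters.
Variables (R : realType) (q : nat).
Hypothesis pq : prime q.
Local Notation n := q.-1.
Local Notation C := R[i].
Local Notation normc := (@Normc.normc R).

(** [croot] generates the roots of unity of order dividing [q.-1], and [groot] the multiplicative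
    group of the field; all characters are built from this pair of choices. *)
Definition croot : C := xget 1 [set z : C | n.-primitive_root z].
Definition groot : 'F_q := xget 1 [set g : 'F_q | n.-primitive_root g].

Let q1 : (1 < q)%N := prime_gt1 pq.
Let q0 : (0 < q)%N := ltnW q1.
Lemma pred_gt0 : (0 < n)%N. Proof. by rewrite -ltnS prednK. Qed.

Lemma crootP : n.-primitive_root croot.
Proof.
have [z zp] := C_prim_root R pred_gt0.
by rewrite /croot; case: xgetP => [x -> //|/(_ z)]; rewrite /= zp.
Qed.

Lemma grootP : n.-primitive_root groot.
Proof.
have [z zp] := Fp_prim_root pq.
by rewrite /groot; case: xgetP => [x -> //|/(_ z)]; rewrite /= zp.
Qed.

(** Determined only modulo [q.-1], which is all that an exponent of [croot] sees. The default 0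
    concerns x = 0, where [chi] vanishes by a separate test. *)
Definition dlog (x : 'F_q) : nat := xget 0%N [set i | groot ^+ i = x].

Lemma dlogK x : x != 0 -> groot ^+ dlog x = x.
Proof.
move=> x0; have [i xi] : exists i : 'I_n, x = groot ^+ i.
  suff xn : x ^+ n = 1 by have [i xi] := prim_rootP grootP xn; exists i.
  apply: (mulIf x0).
  by rewrite mul1r -exprSr prednK // Fp_expq.
by rewrite /dlog; case: xgetP => [//|/(_ i)]; rewrite /= -xi.
Qed.

Definition chi (j : nat) (m : int) : C :=
  if (m%:~R : 'F_q) == 0 then 0 else croot ^+ (j * dlog m%:~R).

Lemma groot_neq0 : groot != 0.
Proof.
apply/eqP => e; have := prim_expr_order grootP.
by rewrite e expr0n eqn0Ngt pred_gt0 => /eqP; rewrite eq_sym oner_eq0.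
Qed.

Lemma croot_neq0 : croot != 0.
Proof.
apply/eqP => e; have := prim_expr_order crootP.
by rewrite e expr0n eqn0Ngt pred_gt0 => /eqP; rewrite eq_sym oner_eq0.
Qed.

Lemma dlogM x y : x != 0 -> y != 0 -> dlog (x * y) = dlog x + dlog y %[mod n].
Proof.
move=> x0 y0; apply/eqP; rewrite -(eq_prim_root_expr grootP) exprD !dlogK //.
by rewrite mulf_neq0.
Qed.

Lemma croot_mul_congr j a b : a = b %[mod n] -> croot ^+ (j * a) = croot ^+ (j * b).
Proof.
move=> e; apply/eqP; rewrite (eq_prim_root_expr crootP); apply/eqP.
by rewrite -modnMmr e modnMmr.
Qed.

Lemma chiM j a b : chi j (a * b) = chi j a * chi j b.
Proof.
rewrite /chi intrM mulf_eq0; case: eqP => [_|/eqP a0] /=; first by rewrite mul0r.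
case: eqP => [_|/eqP b0] /=; first by rewrite mulr0.
by rewrite -exprD -mulnDr; apply: croot_mul_congr; apply: dlogM.
Qed.

Lemma Fp_int_eq0 (m : int) : ((m%:~R : 'F_q) == 0) = ~~ coprimez m q%:Z.
Proof.
rewrite -(dvdz_pcharf (pchar_Fp pq)) /coprimez gcdzC.
rewrite -[gcdz _ _ == 1]/(coprimez q%:Z m) /coprimez /gcdz /=.
by rewrite -[_ == _ :> int]/(coprime q `|m|) prime_coprime // negbK.
Qed.

Lemma Fp_nat_eq0 (a : nat) : (((a%:Z)%:~R : 'F_q) == 0) = (q %| a)%N.
Proof. by rewrite -(dvdz_pcharf (pchar_Fp pq)). Qed.

Lemma Fp_nat_eq (a b : nat) : (((a%:Z)%:~R : 'F_q) == (b%:Z)%:~R) = (a == b %[mod q]).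
Proof.
rewrite -!pmulrn; apply/eqP/eqP => [/(congr1 val)|e]; first by rewrite /= !val_Fp_nat.
by rewrite -(Fp_nat_mod pq a) e Fp_nat_mod.
Qed.

Lemma chi_dirichlet j : dirichlet_character q (chi j).
Proof.
split=> [m|a b|m]; last 1 first.
- rewrite /chi Fp_int_eq0; case: (coprimez m q%:Z) => /=; last by rewrite eqxx.
  by split=> // _; rewrite expf_neq0 // croot_neq0.
- have e0 : ((q%:Z)%:~R : 'F_q) = 0 by apply/eqP; rewrite Fp_nat_eq0.
  by rewrite /chi intrD e0 addr0.
- exact: chiM.
Qed.

(** A character is determined by its value at the generator, and that value is a root of unity of
    order dividing q - 1, hence a power of [croot]. *)
Lemma chi_classify (psi : int -> C) : dirichlet_character q psi ->
  exists2 j, (j < n)%N & psi = chi j.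
Proof.
move=> [per mul nz].
have p1 : psi 1 = 1.
  have h : psi 1 != 0 by apply/nz; rewrite /coprimez gcd1z.
  by apply: (mulfI h); rewrite -mul mulr1 mulr1.
have pn (k : nat) (a : int) : psi (a + (k * q)%:Z) = psi a.
  elim: k => [|k IH]; first by rewrite mul0n addr0.
  by rewrite mulSnr PoszD addrA per IH.
have perm (a b : int) : (a%:~R : 'F_q) = b%:~R -> psi a = psi b.
  move=> e; wlog ab : a b e / a <= b.
    by move=> W; case: (leP a b) => [/W->//|/ltW /W -> //].
  have : ((b - a)%:~R : 'F_q) == 0 by rewrite intrB e subrr.
  rewrite -(dvdz_pcharf (pchar_Fp pq)) => /dvdzP[c bc].
  have c0 : 0 <= c.
    have : 0 <= c * q%:Z by rewrite -bc subr_ge0.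
    by rewrite pmulr_lge0.
  have -> : b = a + (`|c| * q)%:Z by rewrite PoszM gez0_abs // -bc addrC subrK.
  by rewrite pn.
have pX (a : int) k : psi (a ^+ k) = psi a ^+ k.
  by elim: k => [|k IH]; rewrite ?expr0 // !exprS mul IH.
pose g : int := (nat_of_ord groot)%:Z.
have gF : (g%:~R : 'F_q) = groot by rewrite -pmulrn natr_Zp.
have gn : psi g ^+ n = 1.
  rewrite -pX -p1; apply: perm.
  by rewrite rmorphXn /= gF (prim_expr_order grootP) rmorph1.
have [[j jn] gj] := prim_rootP crootP gn.
exists j => //; apply/funext => a.
rewrite /chi Fp_int_eq0; have [ca|ca] := boolP (coprimez a q%:Z) => /=; last first.
  by apply/eqP; apply: contraNT ca => /nz.
have a0 : (a%:~R : 'F_q) != 0 by rewrite Fp_int_eq0 ca.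
rewrite exprM -[croot ^+ j]gj -pX; apply: perm.
by rewrite rmorphXn /= gF dlogK.
Qed.

Lemma chi_inj j j' : (j < n)%N -> (j' < n)%N -> chi j = chi j' -> j = j'.
Proof.
move=> jn jn' e.
have gF : (((nat_of_ord groot)%:Z)%:~R : 'F_q) = groot by rewrite -pmulrn natr_Zp.
have d1 : dlog groot = 1 %[mod n].
  by apply/eqP; rewrite -(eq_prim_root_expr grootP) dlogK ?groot_neq0 // expr1.
have := congr1 (fun f => f (nat_of_ord groot)%:Z) e.
rewrite /chi gF (negbTE groot_neq0) => /eqP; rewrite (eq_prim_root_expr crootP).
rewrite -!(modnMmr _ (dlog groot)) d1 !modnMmr !muln1 !modn_small // => /eqP.
exact.
Qed.

(** A prime has 1 as its only proper divisor, and a character modulo 1 is constantly 1. Being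
    induced thus means being the principal character, of index 0. *)
Lemma chi_primitive j : (j < n)%N -> primitive_character q (chi j) <-> j != 0%N.
Proof.
move=> jn; split.
  move=> [_ prim]; apply/eqP => j0; apply: (prim 1%N) => //.
  exists (fun=> 1); split.
    split=> [//|m m'|m]; first by rewrite mulr1.
    by split=> // _; rewrite ?oner_eq0 // /coprimez gcdz1.
  move=> m cm; rewrite /chi Fp_int_eq0 cm j0 mul0n expr0 //.
move=> j0; split; first exact: chi_dirichlet.
move=> d dq dlt; have d1 : d = 1%N.
  by have /primeP[_ /(_ d dq)/pred2P[//|e]] := pq; rewrite e ltnn in dlt.
move=> [psi [[per mul nz] e]]; subst d.
have p1 : psi 1 = 1.
  have h : psi 1 != 0 by apply/nz; rewrite /coprimez gcdz1.
  by apply: (mulfI h); rewrite -mul mulr1 mulr1.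
have pn (k : nat) : psi k%:Z = 1.
  elim: k => [|k IH]; last by rewrite -addn1 PoszD per.
  by rewrite -(per 0) add0r.
move/eqP: j0; apply; apply: chi_inj => //; first exact: pred_gt0.
apply/funext => a.
have ca0 : (fun a => chi j a = chi 0 a) a; last exact: ca0.
rewrite /=; have [ca|ca] := boolP (coprimez a q%:Z); last first.
  by rewrite /chi Fp_int_eq0 ca.
rewrite (e _ ca) /chi Fp_int_eq0 ca mul0n expr0 /=.
case: a ca => a ca; first exact: pn.
have pm : psi (-1) = 1 by rewrite -(per (-1)) addNr -(per 0) add0r.
by rewrite NegzE -mulN1r mul pm mul1r pn.
Qed.

Local Notation F := (hF R q).
Local Notation cn j m := (chi j (Posz m)).

Lemma conj_croot i : conjc (croot ^+ i) = (croot ^+ i)^-1.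
Proof.
have h : normc croot = 1.
  have : normc croot ^+ n = 1 by rewrite -normcX (prim_expr_order crootP) Normc.normc1.
  by move/eqP; rewrite pexpr_eq1 ?pred_gt0 ?normc_ge0 // => /eqP.
have nz : croot ^+ i != 0 by rewrite expf_neq0 // croot_neq0.
by apply: (mulfI nz); rewrite mul_conjc normcX h !expr1n mulfV.
Qed.

Lemma chi_congr j (a b : nat) : a = b %[mod q] -> cn j a = cn j b.
Proof.
by move=> e; rewrite /chi; have /eqP -> : ((a%:Z)%:~R : 'F_q) == (b%:Z)%:~R by rewrite Fp_nat_eq e.
Qed.

Lemma chi_dvd j (a : nat) : (q %| a)%N -> cn j a = 0.
Proof. by move=> d; rewrite /chi Fp_nat_eq0 d. Qed.

Lemma chi_nat1 j : cn j 1 = 1.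
Proof.
rewrite /chi Fp_nat_eq0 gtnNdvd //.
have -> : croot ^+ (j * dlog 1%:~R) = croot ^+ (j * 0).
  apply: croot_mul_congr; apply/eqP; rewrite -(eq_prim_root_expr grootP) dlogK ?oner_eq0 //.
by rewrite muln0.
Qed.

Lemma chi_natM j (a b : nat) : cn j (a * b) = cn j a * cn j b.
Proof. by rewrite PoszM chiM. Qed.

Lemma chi_orth (a b : nat) :
  \sum_(j < n) cn j a * conjc (cn j b) = ((~~ (q %| a) && (a == b %[mod q]))%N%:R * n%:R)%:C.
Proof.
have [da|da] := boolP (q %| a)%N.
  by rewrite mul0r big1 // => j _; rewrite chi_dvd // mul0r.
have [db|db] := boolP (q %| b)%N.
  rewrite /= (_ : (a == b %[mod q]) = false) ?mul0r; last first.
    by apply: contraNF da => /eqP e; rewrite /dvdn e.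
  by rewrite big1 // => j _; rewrite [cn j b]chi_dvd // conjc0 mulr0.
have a0 : ((a%:Z)%:~R : 'F_q) != 0 by rewrite Fp_nat_eq0.
have b0 : ((b%:Z)%:~R : 'F_q) != 0 by rewrite Fp_nat_eq0.
pose z := croot ^+ dlog (a%:Z)%:~R / croot ^+ dlog (b%:Z)%:~R.
have cz i : croot ^+ i != 0 by rewrite expf_neq0 // croot_neq0.
have zj (j : nat) : cn j a * conjc (cn j b) = z ^+ j.
  rewrite /chi (negbTE a0) (negbTE b0) conj_croot /z exprMn exprVn.
  by rewrite -!exprM ![(j * _)%N]mulnC.
under eq_bigr do rewrite zj.
have e : (z == 1) = (a == b %[mod q]).
  rewrite /z -(inj_eq (mulIf (cz (dlog (b%:Z)%:~R)))) divfK // mul1r.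
  rewrite (eq_prim_root_expr crootP) -(eq_prim_root_expr grootP) !dlogK //.
  exact: Fp_nat_eq.
rewrite -e; have [->|z1] := eqVneq z 1.
  under eq_bigr do rewrite expr1n.
  by rewrite sumr_const card_ord mul1r rmorph_nat.
rewrite mul0r; apply: (mulfI (_ : z - 1 != 0)); first by rewrite subr_eq0.
rewrite -subrX1 mulr0 /z exprMn exprVn -!exprM ![(_ * n)%N]mulnC !exprM.
by rewrite (prim_expr_order crootP) !expr1n invr1 mulr1 subrr.
Qed.

(* The value at 1/2 of the L-function of the [j]-th character, see [dirichlet_L_half]. *)
Definition Lam (j : nat) : C := \sum_(a < q) cn j a * ((Num.sqrt q%:R)^-1 * F a)%:C.

Lemma mean_Lam (m k b : nat) : coprime m q -> coprime k q -> b * m = k %[mod q] ->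
  \sum_(j < n) Lam j * (cn j m * conjc (cn j k)) =
  (n%:R * ((Num.sqrt q%:R)^-1 * F b))%:C.
Proof.
move=> mq kq bmk.
have ndv x : coprime x q -> ~~ (q %| x)%N by rewrite coprime_sym prime_coprime.
transitivity (\sum_(a < q) ((Num.sqrt q%:R)^-1 * F a)%:C *
     \sum_(j < n) cn j (a * m)%N * conjc (cn j k)).
  under eq_bigr do rewrite /Lam mulr_suml.
  rewrite exchange_big /=; apply: eq_bigr => a _; rewrite mulr_sumr.
  by apply: eq_bigr => j _; rewrite chi_natM; ring.
under eq_bigr do rewrite chi_orth.
have blt : (b %% q < q)%N by rewrite ltn_mod.
rewrite (bigD1 (Ordinal blt)) //= big1 ?addr0 => [|a ab].
  have e : (b %% q * m) = k %[mod q] by rewrite modnMml.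
  rewrite (_ : ~~ (q %| b %% q * m)%N) ?e ?eqxx /=; last by rewrite /dvdn e; exact: ndv.
  rewrite -rmorphM /= mul1r (hF_eq R q (b %% q) b) ?modn_mod //.
  by congr (_%:C); ring.
rewrite (_ : (a * m == k %[mod q]) = false) ?andbF ?mul0r ?mulr0 //.
apply: contraNF ab; rewrite -bmk => /eqP e; apply/eqP/val_inj => /=.
rewrite -[LHS](modn_small (ltn_ord a)).
move/eqP: e; case: (leqP a b) => [ab|/ltnW ab]; [rewrite eq_sym|];
  by rewrite eqn_mod_dvd ?leq_mul // -mulnBl Gauss_dvdl 1?coprime_sym //
    -eqn_mod_dvd // => /eqP.
Qed.

(** Orthogonality leaves the pairs with a m = b k modulo q and a m nonzero, parametrised by a = k t,
    b = m t with t nonzero. The correction takes the term t = 0 out of [SS]. *)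
Lemma mean_Lam2 (m k : nat) : coprime m q -> coprime k q ->
  \sum_(j < n) Lam j * conjc (Lam j) * (cn j m * conjc (cn j k)) =
  (n%:R * (SS R q m k - q%:R^-1 * F 0 ^+ 2))%:C.
Proof.
move=> mq kq.
have ndv x : coprime x q -> ~~ (q %| x)%N by rewrite coprime_sym prime_coprime.
have s2 : (Num.sqrt q%:R)^-1 * (Num.sqrt q%:R)^-1 = q%:R^-1 :> R.
  by rewrite -invfM -expr2 sqr_sqrtr.
pose G (a : nat) : R := F a * \sum_(b < q) F b *
   (~~ (q %| a * m) && (a * m == b * k %[mod q]))%N%:R.
transitivity ((n%:R * q%:R^-1 * \sum_(a < q) G a)%:C).
  transitivity (\sum_(a < q) \sum_(b < q) (q%:R^-1 * F a * F b)%:C *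
     \sum_(j < n) cn j (a * m)%N * conjc (cn j (b * k)%N)).
    transitivity (\sum_(j < n) \sum_(a < q) \sum_(b < q) (q%:R^-1 * F a * F b)%:C *
      (cn j (a * m)%N * conjc (cn j (b * k)%N))).
      apply: eq_bigr => j _; rewrite /Lam rmorph_sum /= -mulrA mulr_suml.
      apply: eq_bigr => a _; rewrite mulr_suml mulr_sumr; apply: eq_bigr => b _.
      rewrite !chi_natM !conjcM conjc_real -s2 !rmorphM /=.
      move: (_%:C) (_%:C) (_%:C) (cn _ _) (cn _ _) (conjc _) (conjc _) => *; ring.
    rewrite exchange_big /=; apply: eq_bigr => a _.
    rewrite exchange_big /=; apply: eq_bigr => b _.
    by rewrite mulr_sumr.
  rewrite mulr_sumr rmorph_sum /=; apply: eq_bigr => a _.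
  rewrite /G !mulr_sumr rmorph_sum /=; apply: eq_bigr => b _.
  rewrite chi_orth -rmorphM /=; congr (_%:C); ring.
congr (_%:C); rewrite -mulrA; congr (_ * _).
have Gper a b : a = b %[mod q] -> G a = G b.
  move=> e; rewrite /G (hF_eq R q a b e); congr (_ * _); apply: eq_bigr => c _.
  have e2 : a * m = b * m %[mod q] by rewrite -modnMml e modnMml.
  by rewrite /dvdn e2.
rewrite -(sum_coprime_mul R q k G kq Gper) /SS -mulrBr; congr (_ * _).
have -> : F 0 ^+ 2 = \sum_(t < q) (t == 0%N :> nat)%:R * (F 0 ^+ 2).
  rewrite -(big_mkord xpredT (fun t => (t == 0%N)%:R * _)) -(prednK q0) big_nat_recl //=.
  by rewrite mul1r big1 ?addr0 // => i _; rewrite mul0r.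
rewrite -sumrB; apply: eq_bigr => t _.
have [t0|t0] := eqVneq (nat_of_ord t) 0%N.
  rewrite t0 !muln0 mul1r expr2 subrr /G mul0n dvdn0 big1 ?mulr0 // => b _.
  by rewrite mulr0.
rewrite mul0r subr0 /G mulrC; congr (_ * _).
have tq : coprime t q.
  by rewrite coprime_sym prime_coprime // gtnNdvd // lt0n.
have blt : (m * t %% q < q)%N by rewrite ltn_mod.
rewrite (bigD1 (Ordinal blt)) //= big1 ?addr0 => [|b bt].
  rewrite ndv /=; last by rewrite !coprimeMl kq tq mq.
  rewrite (_ : (k * t * m == m * t %% q * k %[mod q])) ?mulr1; last first.
    by rewrite modnMml -mulnA mulnC [(t * m)%N]mulnC.
  by apply: hF_eq; rewrite modn_mod.
rewrite (_ : (k * t * m == b * k %[mod q]) = false) ?andbF ?mulr0 //.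
apply: contraNF bt => /eqP e; apply/eqP/val_inj => /=; rewrite -[LHS](modn_small (ltn_ord b)).
move: e; rewrite -mulnA [(t * m)%N]mulnC [(b * k)%N]mulnC.
move/eqP; case: (leqP (m * t) b) => [ab|/ltnW ab]; [rewrite eq_sym|];
  rewrite eqn_mod_dvd ?leq_mul // -mulnBr Gauss_dvdr 1?coprime_sym //
    -eqn_mod_dvd // => /eqP //.
Qed.

(** For the principal index the sum is that of all Hurwitz values, known from [hF_sum], less the
    class 0. The bound allows this character, which is not primitive, to be discarded at the end. *)
Lemma Lam0_bound : normc (Lam 0) <= 4.
Proof.
have -> : Lam 0 = (hz R 1 - (Num.sqrt q%:R)^-1 * F 0)%:C.
  rewrite /Lam.
  have -> : hz R 1 - (Num.sqrt q%:R)^-1 * F 0 =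
     \sum_(a < q) (a != 0%N :> nat)%:R * ((Num.sqrt q%:R)^-1 * F a).
    have -> : hz R 1 = (Num.sqrt q%:R)^-1 * \sum_(a < q) F a.
      by rewrite hF_sum // mulKf // sqrtr_eq0 -ltNge ltr0n.
    have recl (G : nat -> R) : \sum_(a < q) G a = G 0%N + \sum_(a < q.-1) G a.+1.
      by rewrite -(big_mkord xpredT) -(prednK q0) big_nat_recl //= big_mkord.
    rewrite (recl F) (recl (fun a => (a != 0%N)%:R * ((Num.sqrt q%:R)^-1 * F a))).
    rewrite mul0r add0r mulrDr addrAC subrr add0r mulr_sumr.
    by apply: eq_bigr => i _; rewrite mul1r.
  rewrite rmorph_sum /=; apply: eq_bigr => a _.
  have [a0|a0] := eqVneq (nat_of_ord a) 0%N; first by rewrite a0 chi_dvd // !mul0r.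
  by rewrite /chi Fp_nat_eq0 gtnNdvd ?lt0n // mul0n expr0 !mul1r.
have -> : F 0 = hz R 1.
  rewrite /hF (rep_unique q 0 q) ?modnn ?mod0n // divff // pnatr_eq0 -lt0n //.
rewrite normc_real; have /andP[z1 z2] := hz1_1 R.
have s1 : 0 <= (Num.sqrt q%:R : R)^-1 <= 1.
  rewrite invr_ge0 sqrtr_ge0 /= invf_le1 ?sqrtr_gt0 ?ltr0n //.
  by rewrite -[leLHS]sqrtr1 ler_sqrt ?ler1n.
case/andP: s1; move: (_^-1) => s s0 s1; rewrite ler_norml; apply/andP; split; nra.
Qed.

Lemma primitive_charactersE :
  primitive_characters R q = [set` [seq chi i.+1 | i <- iota 0 n.-1]].
Proof.
apply/seteqP; split=> [psi [dpsi pr]|psi /=].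
  have [j jn e] := chi_classify dpsi; subst psi.
  have j0 : j != 0%N by apply/chi_primitive.
  apply/mapP; exists j.-1; last by rewrite prednK // lt0n.
  by rewrite mem_iota add0n /=; case: j jn j0 {dpsi pr} => // j; rewrite -(prednK pred_gt0).
case/mapP => i; rewrite mem_iota add0n /= => ilt ->.
by apply/chi_primitive => //; rewrite -(prednK pred_gt0).
Qed.

Lemma uniq_chis : uniq [seq chi i.+1 | i <- iota 0 n.-1].
Proof.
rewrite map_inj_in_uniq ?iota_uniq // => i j; rewrite !mem_iota !add0n /= => il jl e.
have lt k : (k < n.-1)%N -> (k.+1 < n)%N by rewrite -{2}(prednK pred_gt0).
by have [] := chi_inj (lt _ il) (lt _ jl) e.
Qed.

Lemma phi_starE : phi_star R q = n.-1.
Proof.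
rewrite /phi_star primitive_charactersE; set s := [seq _ | _ <- _].
have -> : [set` s] = [set` seq_fset tt s].
  apply/seteqP; split=> x h; first exact: (etrans (seq_fsetE tt s x) h).
  exact: (etrans (esym (seq_fsetE tt s x)) h).
by rewrite set_fsetK size_seq_fset undup_id ?uniq_chis // size_map size_iota.
Qed.

Lemma sum_primitiveE (G : (int -> C) -> R) :
  \sum_(psi \in primitive_characters R q) G psi = \sum_(1 <= j < n) G (chi j).
Proof.
rewrite primitive_charactersE -fsbig_seq ?uniq_chis // big_map.
by rewrite big_add1 /= /index_iota subn0.
Qed.

End Characters.

(** * The central value as a sum of Hurwitz zeta values *)

Section ComplexSequences.
Variable R : realType.
Local Notation C := R[i].
Local Notation normc := (@Normc.normc R).
Implicit Types (u v : nat -> C) (l m z w : C).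

(** Working form of convergence in [R[i]], with the real modulus in place of the complex-valued
    norm; [converges_toP] links it to [converges_to]. *)
Definition cvgC u l := forall e : R, 0 < e ->
  exists N, forall n, (N <= n)%N -> normc (u n - l) < e.

Definition ps u n : C := \sum_(k < n) u k.

Lemma psS u n : ps u n.+1 = ps u n + u n.
Proof. by rewrite /ps big_ord_recr. Qed.

Lemma normcE' z : `|z| = (normc z)%:C.
Proof. by rewrite normc_def; case: z. Qed.

Lemma converges_toP u l : converges_to u l <-> cvgC (ps u) l.
Proof.
have sE n : series (u : nat -> R[i]^o) n = ps u n by rewrite /series /= big_mkord.
rewrite /converges_to; split.
  move=> /cvgrPdist_lt h e e0; have eC : (0 : R[i]) < e%:C by rewrite ltcR.
  have [N _ hN] := h _ eC; exists N => n Nn; have := hN n Nn.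
  by rewrite /= sE normcE' ltcR -normcN opprB.
move=> h; apply/cvgrPdist_lt => e e0.
have er : e = (complex.Re e)%:C.
  by case: e e0 => a b; rewrite ltcE /= => /andP[/eqP -> _].
have e0' : 0 < complex.Re e by move: e0; rewrite {1}er ltcR.
have [N hN] := h _ e0'; exists N => // n Nn /=.
by rewrite sE er normcE' ltcR -normcN opprB; apply: hN.
Qed.

Lemma cvgC_unique u l m : cvgC u l -> cvgC u m -> l = m.
Proof.
move=> ul um; apply/eqP; rewrite -subr_eq0 -normc_eq0; apply/eqP/le_anti.
rewrite normc_ge0 andbT; apply/ler_addgt0Pr => e e0; rewrite add0r.
have e2 : 0 < e / 2 by rewrite divr_gt0.
have [N hN] := ul _ e2; have [M hM] := um _ e2.
have h1 := hN (maxn N M) (leq_maxl _ _); have h2 := hM (maxn N M) (leq_maxr _ _).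
rewrite (_ : l - m = (u (maxn N M) - m) - (u (maxn N M) - l)); last by ring.
apply: le_trans (le_normcD _ _) _; rewrite normcN; lra.
Qed.

Lemma eq_cvgC u v l : u =1 v -> cvgC u l -> cvgC v l.
Proof. by move=> uv h e /h[N hN]; exists N => n /hN; rewrite uv. Qed.

Lemma cvgC_cst l : cvgC (fun=> l) l.
Proof. by move=> e e0; exists 0%N => n _; rewrite subrr Normc.normc0. Qed.

Lemma cvgCD u v l m : cvgC u l -> cvgC v m -> cvgC (fun n => u n + v n) (l + m).
Proof.
move=> ul vm e e0; have e2 : 0 < e / 2 by rewrite divr_gt0.
have [N hN] := ul _ e2; have [M hM] := vm _ e2.
exists (maxn N M) => n; rewrite geq_max => /andP[/hN h1 /hM h2].
rewrite (_ : _ - _ = (u n - l) + (v n - m)); last by ring.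
apply: le_lt_trans (le_normcD _ _) _; lra.
Qed.

Lemma cvgCMl z u l : cvgC u l -> cvgC (fun n => z * u n) (z * l).
Proof.
move=> ul e e0; have z1 : 0 < normc z + 1 by rewrite ltr_wpDl ?normc_ge0.
have [N hN] := ul _ (divr_gt0 e0 z1); exists N => n /hN h.
rewrite -mulrBr Normc.normcM.
apply: (@le_lt_trans _ _ ((normc z + 1) * normc (u n - l))).
  by rewrite ler_wpM2r ?normc_ge0 // lerDl.
by rewrite mulrC -ltr_pdivlMr.
Qed.

Lemma cvgCN u l : cvgC u l -> cvgC (fun n => - u n) (- l).
Proof.
move=> h; rewrite -mulN1r; apply: eq_cvgC (cvgCMl (-1) h) => n; exact: mulN1r.
Qed.

Lemma cvgCB u v l m : cvgC u l -> cvgC v m -> cvgC (fun n => u n - v n) (l - m).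
Proof. by move=> h /cvgCN; exact: cvgCD. Qed.

Lemma cvgC_sum (I : Type) (r : seq I) (U : I -> nat -> C) (L : I -> C) :
  (forall i, cvgC (U i) (L i)) ->
  cvgC (fun n => \sum_(i <- r) U i n) (\sum_(i <- r) L i).
Proof.
move=> h; elim: r => [|i r IH].
  by rewrite big_nil; apply: eq_cvgC (cvgC_cst 0) => n; rewrite big_nil.
rewrite big_cons; apply: eq_cvgC (cvgCD (h i) IH) => n.
by rewrite big_cons.
Qed.

Lemma cvgC_sub u l (f : nat -> nat) : (forall n, (n <= f n)%N) ->
  cvgC u l -> cvgC (u \o f) l.
Proof.
by move=> fn h e /h[N hN]; exists N => n Nn; apply: hN; apply: leq_trans (fn n).
Qed.

Lemma cvgC_squeeze u (b : nat -> R) l : b @ \oo --> (0 : R) ->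
  (forall n, normc (u n - l) <= b n) -> cvgC u l.
Proof.
move=> /cvgrPdist_lt hb h e e0; have [N _ hN] := hb e e0.
exists N => n Nn; apply: le_lt_trans (h n) _.
have := hN n Nn; rewrite /= sub0r normrN; apply: le_lt_trans.
exact: ler_norm.
Qed.

Lemma cvgC_ReIm u (a b : R) : (fun n => complex.Re (u n)) @ \oo --> a ->
  (fun n => complex.Im (u n)) @ \oo --> b -> cvgC u (a +i* b).
Proof.
move=> /cvgrPdist_lt ha /cvgrPdist_lt hb e e0; have e2 : 0 < e / 2 by rewrite divr_gt0.
have [N _ hN] := ha _ e2; have [M _ hM] := hb _ e2.
exists (maxn N M) => n; rewrite geq_max => /andP[/hN h1 /hM h2].
have -> : u n - a +i* b = (complex.Re (u n) - a)%:C + (complex.Im (u n) - b)%:C * 'i.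
  case: (u n) => x y.
  by apply/eqP; rewrite eq_complex /=; apply/andP; split; apply/eqP; ring.
rewrite /= distrC in h1; rewrite /= distrC in h2.
apply: le_lt_trans (le_normcD _ _) _.
rewrite Normc.normcM !normc_real.
have -> : normc 'i = 1 by rewrite /= expr0n /= add0r expr1n sqrtr1.
lra.
Qed.

Lemma cvgC_real (x : nat -> R) (a : R) : x @ \oo --> a -> cvgC (fun n => (x n)%:C) a%:C.
Proof.
move=> /cvgrPdist_lt h e e0; have [N _ hN] := h e e0; exists N => n /hN h1.
by rewrite -rmorphB normc_real distrC.
Qed.

Lemma cvgC_norm_le u l (K : R) N : cvgC u l ->
  (forall n, (N <= n)%N -> normc (u n) <= K) -> normc l <= K.
Proof.
move=> h hK; apply/ler_addgt0Pr => e e0; have [M hM] := h e e0.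
have h1 := hM (maxn N M) (leq_maxr _ _); have h2 := hK (maxn N M) (leq_maxl _ _).
rewrite (_ : l = u (maxn N M) - (u (maxn N M) - l)); last by ring.
apply: le_trans (le_normcD _ _) _; rewrite normcN; lra.
Qed.

Lemma bounded_psums_cvg (b : nat -> R) (B : R) : (forall n, 0 <= b n) ->
  (forall N, \sum_(n < N) b n <= B) -> cvgn (series b).
Proof.
move=> b0 hB; apply: nondecreasing_is_cvgn.
  by apply/nondecreasing_seqP => n; rewrite seriesSr lerDl.
by exists B => _ [N _ <-]; rewrite /series /= big_mkord.
Qed.

Lemma abs_cvgC u (b : nat -> R) (B : R) : (forall n, normc (u n) <= b n) ->
  (forall N, \sum_(n < N) b n <= B) -> exists l, cvgC (ps u) l.
Proof.
move=> ub hB; have b0 n : 0 <= b n by apply: le_trans (normc_ge0 _) (ub n).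
have cb := bounded_psums_cvg b0 hB.
have cv (f : nat -> R) : (forall n, `|f n| <= b n) -> cvgn (series f).
  by move=> fb; apply: normed_cvg; apply: (series_le_cvg _ _ fb cb) => n.
have c1 := cv (fun n => complex.Re (u n)) (fun n => le_trans (Re_le_normc _) (ub n)).
have c2 := cv (fun n => complex.Im (u n)) (fun n => le_trans (Im_le_normc _) (ub n)).
exists (limn (series (fun n => complex.Re (u n))) +i* limn (series (fun n => complex.Im (u n)))).
have psE n : ps u n = (\sum_(k < n) complex.Re (u k)) +i* (\sum_(k < n) complex.Im (u k)).
  rewrite /ps; elim: n => [|n IH]; first by rewrite !big_ord0.
  by rewrite !big_ord_recr /= IH; case: (u n).
apply: cvgC_ReIm.
  apply: (cvg_trans _ c1); apply: near_eq_cvg; apply: nearW => n.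
  by rewrite psE /= /series /= big_mkord.
apply: (cvg_trans _ c2); apply: near_eq_cvg; apply: nearW => n.
by rewrite psE /= /series /= big_mkord.
Qed.

Lemma cauchy_tail (b : nat -> R) (B e : R) : (forall n, 0 <= b n) ->
  (forall N, \sum_(n < N) b n <= B) -> 0 < e ->
  exists N, forall k, \sum_(n < k) b (N + n)%N <= e.
Proof.
move=> b0 hB e0; have cb := bounded_psums_cvg b0 hB.
have /cvgrPdist_lt /(_ e e0)[N _ hN] := cb.
exists N => k; have /= h1 := hN N (leqnn N).
have nd : nondecreasing_seq (series b).
  by apply/nondecreasing_seqP => n; rewrite seriesSr lerDl.
have h2 := nondecreasing_cvgn_le nd cb (N + k)%N.
have e1 : series b (N + k)%N = series b N + \sum_(n < k) b (N + n)%N.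
  by rewrite /series /= !big_mkord big_split_ord.
by move: h1; rewrite ltr_norml => /andP[_]; move: h2; rewrite e1 /= => *; lra.
Qed.

(** Interchange of a double series under a summable bound for the rows: the first N rows are within
    d/(N+1) of their sums for large J, and the remaining rows contribute at most twice the tail of
    [b]. *)
Lemma sum_exchange (t : nat -> nat -> C) (v : nat -> C) (b : nat -> R) (B : R) :
  (forall n J, \sum_(j < J) normc (t n j) <= b n) ->
  (forall N, \sum_(n < N) b n <= B) ->
  (forall n, cvgC (ps (t n)) (v n)) ->
  exists (a : nat -> C) (F : C), [/\ forall j, cvgC (ps (fun n => t n j)) (a j),
     cvgC (ps v) F & cvgC (ps a) F].
Proof.
move=> tb bB tv.
have b0 n : 0 <= b n by have := tb n 0%N; rewrite big_ord0.
have tnj n j : normc (t n j) <= b n.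
  apply: le_trans (tb n j.+1); rewrite big_ord_recr /= lerDr.
  by apply: sumr_ge0 => *; exact: normc_ge0.
have psb n J : normc (ps (t n) J) <= b n.
  by apply: le_trans (ler_normc_sum _ _ _) (tb n J).
have vb n : normc (v n) <= b n by apply: (cvgC_norm_le (N := 0) (tv n)) => J _.
have /choice[a ha] : forall j, exists l, cvgC (ps (fun n => t n j)) l.
  by move=> j; apply: (abs_cvgC _ bB) => n.
have [F hF] := abs_cvgC vb bB.
exists a, F; split => // e e0.
pose d := e / 4; have d0 : 0 < d by rewrite divr_gt0.
have [N hN] := cauchy_tail b0 bB d0.
have /choice[J0 hJ0] : forall n, exists J, forall J', (J <= J')%N ->
    normc (ps (t n) J' - v n) < d / N.+1%:R.
  by move=> n; apply: tv; rewrite divr_gt0.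
exists (\max_(n < N) J0 n) => J hJ.
have lim : cvgC (fun M => ps (fun n => ps (t n) J - v n) M) (ps a J - F).
  have h1 : cvgC (fun M => \sum_(j < J) ps (fun n => t n j) M) (ps a J).
    exact: (cvgC_sum (index_enum _) (fun j : 'I_J => ha j)).
  apply: eq_cvgC (cvgCB h1 hF) => M.
  by rewrite /ps exchange_big /= -sumrB.
have bound M : (N <= M)%N -> normc (ps (fun n => ps (t n) J - v n) M) <= 3 * d.
  move=> NM; rewrite -(subnKC NM) /ps big_split_ord /=.
  apply: le_trans (le_normcD _ _) _.
  have h1 : normc (\sum_(i < N) (ps (t i) J - v i)) <= d.
    apply: le_trans (ler_normc_sum _ _ _) _.
    apply: (@le_trans _ _ (\sum_(i < N) d / N.+1%:R)).
      apply: ler_sum => i _; apply/ltW/hJ0; apply: leq_trans hJ.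
      exact: (leq_bigmax (F := fun i : 'I_N => J0 i)).
    rewrite sumr_const card_ord -[_ *+ N]mulr_natr -mulrA ler_piMr // ?(ltW d0) //.
    by rewrite mulrC ler_pdivrMr // mul1r ler_nat.
  have h2 : normc (\sum_(i < M - N) (ps (t (N + i)%N) J - v (N + i)%N)) <= 2 * d.
    apply: le_trans (ler_normc_sum _ _ _) _.
    apply: (@le_trans _ _ (\sum_(i < M - N) (b (N + i)%N + b (N + i)%N))).
      apply: ler_sum => i _; apply: le_trans (le_normcD _ _) _.
      by rewrite normcN lerD.
    by rewrite big_split /=; have := hN (M - N)%N => ?; lra.
  lra.
apply: le_lt_trans (cvgC_norm_le lim bound) _; rewrite /d; lra.
Qed.

End ComplexSequences.

(** * The power series of the complex exponential *)

Section ComplexExponential.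
Variable R : realType.
Local Notation C := R[i].
Local Notation normc := (@Normc.normc R).
Implicit Types (x y : R) (z w : C).

Lemma cexpD z w : cexp (z + w) = cexp z * cexp w.
Proof.
case: z w => a b [c d]; rewrite /cexp /= expRD cosD sinD.
by apply/eqP; rewrite eq_complex /=; apply/andP; split; apply/eqP; ring.
Qed.

Lemma cexp_real x : cexp x%:C = (expR x)%:C.
Proof.
by rewrite /cexp /= cos0 sin0; apply/eqP; rewrite eq_complex /=; apply/andP; split; apply/eqP; ring.
Qed.

Lemma normc_cexp z : normc (cexp z) = expR (complex.Re z).
Proof.
rewrite /cexp Normc.normcM normc_real ger0_norm ?expR_ge0 //.
by rewrite /= cos2Dsin2 sqrtr1 mulr1.
Qed.

Definition eterm (K : fieldType) (z : K) (j : nat) : K := z ^+ j / j`!%:R.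

Lemma triangle_sum (V : nmodType) (f : nat -> nat -> V) M :
  \sum_(m < M) \sum_(i < m.+1) f (m - i)%N i =
  \sum_(i < M) \sum_(j < M) (if (i + j < M)%N then f i j else 0).
Proof.
elim: M => [|M IH]; first by rewrite !big_ord0.
rewrite big_ord_recr /= IH.
have -> : \sum_(i < M.+1) \sum_(j < M.+1) (if (i + j < M.+1)%N then f i j else 0) =
   \sum_(i < M.+1) \sum_(j < M.+1) (if (i + j < M)%N then f i j else 0) +
   \sum_(i < M.+1) \sum_(j < M.+1) (if (i + j == M)%N then f i j else 0).
  rewrite -big_split /=; apply: eq_bigr => i _; rewrite -big_split /=.
  apply: eq_bigr => j _; rewrite ltnS leq_eqVlt; case: ltngtP => //=; rewrite ?addr0 ?add0r //.
congr (_ + _).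
  rewrite [RHS]big_ord_recr /= [X in _ = _ + X]big1 ?addr0; last first.
    by move=> j _; rewrite ltnNge leq_addr.
  apply: eq_bigr => i _; rewrite big_ord_recr /= [X in _ + X](_ : _ = 0) ?addr0 //.
  by rewrite ltnNge leq_addl.
rewrite exchange_big /=; apply: eq_bigr => j _.
have jM : (M - j < M.+1)%N by rewrite ltnS leq_subr.
rewrite (bigD1 (Ordinal jM)) //= subnK -1?ltnS // eqxx big1 ?addr0 // => i ij.
rewrite ifN //; apply: contraNN ij => /eqP e; apply/eqP/val_inj => /=.
exact: (canRL (addnK _) e).
Qed.

Lemma eterm_binomial (K : numFieldType) (a b : K) M :
  \sum_(m < M) eterm (a + b) m =
  \sum_(i < M) \sum_(j < M) (if (i + j < M)%N then eterm a i * eterm b j else 0).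
Proof.
rewrite -(triangle_sum (fun i j => eterm a i * eterm b j)); apply: eq_bigr => m _.
rewrite /eterm exprDn mulr_suml; apply: eq_bigr => i _.
have im : (i <= m)%N by rewrite -ltnS.
have := bin_fact im; rewrite mulnC [(i`! * _)%N]mulnC => /(congr1 (fun n => n%:R : K)).
rewrite !natrM => <-; rewrite -mulr_natr.
have n1 : (m - i)`!%:R != 0 :> K by rewrite pnatr_eq0 -lt0n fact_gt0.
have n2 : i`!%:R != 0 :> K by rewrite pnatr_eq0 -lt0n fact_gt0.
have n3 : 'C(m, i)%:R != 0 :> K by rewrite pnatr_eq0 -lt0n bin_gt0.
by field; rewrite n1 n2 n3.
Qed.

Lemma cvg_eterm x : (fun J => \sum_(j < J) eterm x j) @ \oo --> expR x.
Proof.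
have h := @is_cvg_series_exp_coeff R x; rewrite /expR.
apply: (cvg_trans _ h); apply: near_eq_cvg; apply: nearW => J.
by rewrite /series /= big_mkord.
Qed.

Lemma eterm_ge0 x j : 0 <= x -> 0 <= eterm x j.
Proof. by move=> x0; rewrite divr_ge0 ?exprn_ge0. Qed.

Lemma eterm_sum_le x J : 0 <= x -> \sum_(j < J) eterm x j <= expR x.
Proof.
move=> x0; have h := @cvg_eterm x.
have nd : nondecreasing_seq (fun J => \sum_(j < J) eterm x j).
  by apply/nondecreasing_seqP => n; rewrite big_ord_recr /= lerDl eterm_ge0.
by rewrite -(cvg_lim (@Rhausdorff R) h); apply: nondecreasing_cvgn_le => //; apply/cvg_ex; exists (expR x).
Qed.

Lemma eterm_sum_sub_le x y J : 0 <= y -> y <= x ->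
  \sum_(j < J) (eterm x j - eterm y j) <= expR x - expR y.
Proof.
move=> y0 xy; have h : (fun J => \sum_(j < J) (eterm x j - eterm y j)) @ \oo --> expR x - expR y.
  apply: (cvg_trans _ (cvgB (@cvg_eterm x) (@cvg_eterm y))).
  by apply: near_eq_cvg; apply: nearW => n; rewrite /= sumrB.
have nd : nondecreasing_seq (fun J => \sum_(j < J) (eterm x j - eterm y j)).
  apply/nondecreasing_seqP => n; rewrite big_ord_recr /= lerDl subr_ge0 ler_pM2r ?invr_gt0 ?ltr0n ?fact_gt0 //.
  by rewrite lerXn2r ?nnegrE // (le_trans y0).
by rewrite -(cvg_lim (@Rhausdorff R) h); apply: nondecreasing_cvgn_le => //; apply/cvg_ex; exists (expR x - expR y).
Qed.

Lemma normc_eterm z j : normc (eterm z j) = eterm (normc z) j.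
Proof.
rewrite /eterm Normc.normcM normcX Normc.normcV; congr (_ / _).
by rewrite -(rmorph_nat (real_complex R)) normc_real ger0_norm.
Qed.

Lemma eterm_iy y j : eterm (y%:C * 'i) j = (cos_coeff y j) +i* (sin_coeff y j).
Proof.
have fE : (j`!%:R : C) = (j`!%:R : R)%:C by rewrite rmorph_nat.
have i2 : ('i : C) ^+ 2 = (-1)%:C.
  by apply/eqP; rewrite eq_complex /=; apply/andP; split; apply/eqP; ring.
have iE : ('i : C) ^+ j = ((~~ odd j)%:R * (-1) ^+ j./2) +i* ((odd j)%:R * (-1) ^+ j.-1./2).
  rewrite -{1}(odd_double_half j) exprD -mul2n exprM i2 -rmorphXn /=.
  case: (boolP (odd j)) => oj.
    have -> : (j.-1)./2 = j./2 by case: (j) oj => //= k ok; rewrite uphalf_half (negbTE ok).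
    by rewrite expr1; apply/eqP; rewrite eq_complex /=; apply/andP; split; apply/eqP; ring.
  by rewrite expr0; apply/eqP; rewrite eq_complex /=; apply/andP; split; apply/eqP; ring.
rewrite /eterm exprMn iE fE -rmorphXn -fmorphV /= /cos_coeff /sin_coeff /= -exprnP.
by apply/eqP; rewrite eq_complex /=; apply/andP; split; apply/eqP; ring.
Qed.

(** [cexp] is defined by its real and imaginary factors, so its series is a product of two series.
    The triangular partial sum differs from the square one by terms dominated by the same difference
    for |x| and |y|, which tends to e^|x| e^|y| - e^(|x|+|y|) = 0. *)
Lemma cvgC_eterm z : cvgC (ps (eterm z)) (cexp z).
Proof.
case: z => x y.
have zE : x +i* y = x%:C + y%:C * 'i.
  by apply/eqP; rewrite eq_complex /=; apply/andP; split; apply/eqP; ring.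
have c2 : cvgC (ps (eterm (y%:C * 'i))) (cos y +i* sin y).
  have psE n : ps (eterm (y%:C * 'i)) n = series (cos_coeff y) n +i* series (sin_coeff y) n.
    rewrite /ps /series /= !big_mkord; elim: n => [|n IH]; first by rewrite !big_ord0.
    by rewrite !big_ord_recr /= IH eterm_iy.
  rewrite cos.unlock sin.unlock; apply: cvgC_ReIm.
    apply: (cvg_trans _ (@is_cvg_series_cos_coeff R y)); apply: near_eq_cvg.
    by apply: nearW => n; rewrite psE.
  apply: (cvg_trans _ (@is_cvg_series_sin_coeff R y)); apply: near_eq_cvg.
  by apply: nearW => n; rewrite psE.
have c1 := @cvg_eterm x.
have n2 : normc (y%:C * 'i) = `|y|.
  by rewrite Normc.normcM normc_real /= expr0n /= add0r expr1n sqrtr1 mulr1.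
pose D M : R := (\sum_(i < M) eterm `|x| i) * (\sum_(j < M) eterm `|y| j) -
   \sum_(m < M) eterm (`|x| + `|y|) m.
have D0 : D @ \oo --> (0 : R).
  have -> : (0 : R) = expR `|x| * expR `|y| - expR (`|x| + `|y|) by rewrite expRD subrr.
  by apply: cvgB; [apply: cvgM; exact: cvg_eterm | exact: cvg_eterm].
have Dle M : normc (ps (eterm (x +i* y)) M -
     (\sum_(i < M) eterm x i)%:C * ps (eterm (y%:C * 'i)) M) <= D M.
  rewrite zE /ps eterm_binomial.
  have xE i : (eterm x i)%:C = eterm x%:C i.
    by rewrite /eterm rmorphM rmorphXn fmorphV rmorph_nat.
  rewrite rmorph_sum /= big_distrl /= -sumrB.
  have -> : D M = \sum_(i < M) \sum_(j < M) (if (i + j < M)%N then 0 else eterm `|x| i * eterm `|y| j).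
    rewrite /D eterm_binomial big_distrl /= -sumrB; apply: eq_bigr => i _.
    rewrite big_distrr /= -sumrB; apply: eq_bigr => j _.
    by case: ifP => _; rewrite ?subrr ?subr0.
  apply: le_trans (ler_normc_sum _ _ _) _; apply: ler_sum => i _.
  rewrite big_distrr /= -sumrB.
  apply: le_trans (ler_normc_sum _ _ _) _; apply: ler_sum => j _.
  rewrite xE; case: ifP => _; first by rewrite subrr Normc.normc0.
  by rewrite sub0r normcN Normc.normcM !normc_eterm n2 normc_real.
have c3 : cvgC (fun M => (\sum_(i < M) eterm x i)%:C * ps (eterm (y%:C * 'i)) M)
    ((expR x)%:C * (cos y +i* sin y)).
  have bx M : normc (\sum_(i < M) eterm x i)%:C <= expR `|x|.
    rewrite rmorph_sum /=; apply: le_trans (ler_normc_sum _ _ _) _.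
    apply: le_trans (eterm_sum_le M (normr_ge0 x)); apply: ler_sum => i _.
    rewrite normc_real /eterm normrM normrX normfV [X in _ / X]ger0_norm //.
  have h1 : cvgC (fun M => (\sum_(i < M) eterm x i)%:C * (ps (eterm (y%:C * 'i)) M - (cos y +i* sin y))) 0.
    move=> e e0; have [N hN] := c2 _ (divr_gt0 e0 (expR_gt0 `|x|)).
    exists N => n /hN h; rewrite subr0 Normc.normcM.
    apply: le_lt_trans (_ : expR `|x| * normc (ps (eterm (y%:C * 'i)) n - (cos y +i* sin y)) < e).
      by rewrite ler_wpM2r ?normc_ge0.
    by rewrite mulrC -ltr_pdivlMr ?expR_gt0.
  have h2 := cvgCMl (cos y +i* sin y) (cvgC_real c1).
  have h3 := cvgCD h1 h2; rewrite add0r [X in cvgC _ X]mulrC in h3.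
  by apply: eq_cvgC h3 => M /=; ring.
have c4 := cvgC_squeeze (l := 0) (u := fun M => ps (eterm (x +i* y)) M -
     (\sum_(i < M) eterm x i)%:C * ps (eterm (y%:C * 'i)) M) D0.
have h5 : cvgC (fun M => ps (eterm (x +i* y)) M -
     (\sum_(i < M) eterm x i)%:C * ps (eterm (y%:C * 'i)) M) 0.
  by apply: c4 => n; rewrite subr0.
have h6 := cvgCD h5 c3; rewrite add0r in h6.
by apply: eq_cvgC h6 => M /=; rewrite subrK.
Qed.

Lemma normc_cexp_sub1 z : normc (cexp z - 1) <= normc z * expR (normc z).
Proof.
have h : normc (cexp z - 1) <= expR (normc z) - 1.
  apply: (cvgC_norm_le (N := 1) (cvgCB (cvgC_eterm z) (cvgC_cst 1))) => -[//|n] _.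
  rewrite /ps big_ord_recl /= {1}/eterm expr0 fact0 divr1 addrAC subrr add0r.
  apply: le_trans (ler_normc_sum _ _ _) _.
  have := eterm_sum_le n.+1 (normc_ge0 z).
  rewrite big_ord_recl {1}/eterm expr0 fact0 divr1 -lerBrDl; apply: le_trans.
  by apply: ler_sum => i _; rewrite normc_eterm.
apply: le_trans h _; have := expR_ge1Dx (- normc z); rewrite expRN => h.
have e0 := expR_gt0 (normc z).
have : (1 - normc z) * expR (normc z) <= 1 by rewrite -ler_pdivlMr // div1r.
move=> *; lra.
Qed.

End ComplexExponential.

(** * Dirichlet series whose coefficients have bounded partial sums *)

Section DirichletSeries.
Variable R : realType.
Local Notation C := R[i].
Local Notation normc := (@Normc.normc R).
Variables (c : nat -> C) (B : R).
Hypothesis cB : forall N, normc (ps c N) <= B.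

Definition lgn (n : nat) : R := ln (n.+1%:R : R).
Definition pw (n : nat) (s : C) : C := natpowc n.+1 (- s).
(** The terms after summation by parts. Bounded partial sums of [c] make their series absolutely
    convergent for Re s > 0, where the original one need not be. *)
Definition abel (s : C) (n : nat) : C := ps c n.+1 * (pw n s - pw n.+1 s).

Lemma pwE n s : pw n s = cexp (- s * (lgn n)%:C). Proof. by []. Qed.

Lemma lgn_ge0 n : 0 <= lgn n.
Proof. by rewrite ln_ge0 // ler1n. Qed.

Lemma lgn_step n : 0 <= lgn n.+1 - lgn n <= 1.
Proof.
have /andP[h1 h2] := ln_succ_bounds R n.+1 isT.
apply/andP; split; first by apply: le_trans h1; rewrite invr_ge0.
by apply: le_trans h2 _; rewrite invf_le1 // ler1n.
Qed.

Lemma normc_pw n s : normc (pw n s) = expR (- complex.Re s * lgn n).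
Proof. by rewrite pwE normc_cexp; congr expR; case: s => a b /=; ring. Qed.

Lemma pw_shift n s z : pw n (s + z) = pw n s * cexp (- z * (lgn n)%:C).
Proof. by rewrite !pwE -cexpD; congr cexp; ring. Qed.

Lemma pw_succ n s : pw n.+1 s = pw n s * cexp (- s * (lgn n.+1 - lgn n)%:C).
Proof. by rewrite !pwE -cexpD rmorphB; congr cexp; ring. Qed.

Lemma pw_diff n s : normc (pw n s - pw n.+1 s) <=
  expR (- complex.Re s * lgn n) * ((lgn n.+1 - lgn n) * (normc s * expR (normc s))).
Proof.
have /andP[e0 e1] := lgn_step n.
rewrite pw_succ -{1}[pw n s]mulr1 -mulrBr Normc.normcM normc_pw ler_wpM2l ?expR_ge0 //.
rewrite -normcN opprB; apply: le_trans (normc_cexp_sub1 _) _.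
have -> : normc (- s * (lgn n.+1 - lgn n)%:C) = normc s * (lgn n.+1 - lgn n).
  by rewrite Normc.normcM normc_real normcN ger0_norm.
rewrite [leRHS]mulrA [(lgn n.+1 - lgn n) * normc s]mulrC.
by rewrite ler_wpM2l ?mulr_ge0 ?normc_ge0 // ler_expR ler_piMr ?normc_ge0.
Qed.

Definition Dt (t : R) n := expR (- t * lgn n) - expR (- t * lgn n.+1).

(** Turns the majorant (n+1)^(-t) times the step of the logarithm into a decrement of (n+1)^(-t),
    whose sum telescopes to at most 1. *)
Lemma Dt_lb (t : R) n : 0 < t ->
  expR (- t * lgn n) * (lgn n.+1 - lgn n) <= expR t / t * Dt t n.
Proof.
move=> t0; have /andP[e0 e1] := lgn_step n; set e := lgn n.+1 - lgn n in e0 e1 *.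
have -> : Dt t n = expR (- t * lgn n) * (1 - expR (- (t * e))).
  rewrite /Dt mulrBr mulr1 -expRD; congr (_ - expR _); rewrite /e; ring.
rewrite mulrCA ler_wpM2l ?expR_ge0 // mulrAC ler_pdivlMr //.
have te : t * e <= t by rewrite ler_piMr // ltW.
have h1 := expR_ge1Dx (t * e); have h2 := expR_gt0 (- (t * e)).
have h3 : expR (t * e) * expR (- (t * e)) = 1 by rewrite -expRD subrr expR0.
have h4 : expR (t * e) <= expR t by rewrite ler_expR.
have te0 : 0 <= t * e by rewrite mulr_ge0 // ltW.
have h5 : (t * e) * expR (- (t * e)) <= 1 - expR (- (t * e)) by nra.
have h6 : 1 <= expR t * expR (- (t * e)) by rewrite -h3 ler_wpM2r // ltW.
have h7 : t * e <= (t * e) * (expR t * expR (- (t * e))) by rewrite ler_peMr.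
rewrite mulrC; apply: le_trans h7 _; rewrite mulrCA ler_wpM2l ?expR_ge0 //.
Qed.

Lemma Dt_sum (t : R) N : \sum_(n < N) Dt t n <= 1.
Proof.
suff -> : \sum_(n < N) Dt t n = 1 - expR (- t * lgn N) by rewrite lerBlDr lerDl expR_ge0.
elim: N => [|N IH]; first by rewrite big_ord0 /lgn ln1 mulr0 expR0 subrr.
by rewrite big_ord_recr /= IH /Dt; ring.
Qed.

Lemma B_ge0 : 0 <= B. Proof. exact: le_trans (normc_ge0 _) (cB 0). Qed.

(** Expands (n+1)^(-(s0+z)) in powers of z and interchanges the sums. The rows are dominated by
    (n+1)^(-Re s0 + |z|) times the step of the logarithm; with |z| at most half of Re s0 this is
    summable by [Dt_lb]. *)
Lemma abel_exchange (s0 z : C) : 0 < complex.Re s0 -> normc z <= complex.Re s0 / 2 ->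
  exists (a : nat -> C) (F : C), [/\
     forall j, cvgC (ps (fun n => ps c n.+1 * (pw n s0 * eterm (- (lgn n)%:C) j -
         pw n.+1 s0 * eterm (- (lgn n.+1)%:C) j) * z ^+ j)) (a j),
     cvgC (ps (abel (s0 + z))) F & cvgC (ps a) F].
Proof.
set sg := complex.Re s0 => sg0 zr; set r := sg / 2 in zr.
have r0 : 0 < r by rewrite divr_gt0.
(* The first part of [K] accounts for the change of the exponential series from n to n+1, the second
   for the change of (n+1)^(-s0). *)
pose K := r * expR r + expR r * (normc s0 * expR (normc s0)).
have K0 : 0 <= K by rewrite addr_ge0 // !mulr_ge0 ?normc_ge0 ?expR_ge0 // ltW.
pose b n := B * (K * (expR r / r * Dt r n)).
have Es n j : ps c n.+1 * (pw n s0 * eterm (- (lgn n)%:C) j - pw n.+1 s0 * eterm (- (lgn n.+1)%:C) j) * z ^+ j =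
   ps c n.+1 * (pw n s0 * eterm (- z * (lgn n)%:C) j - pw n.+1 s0 * eterm (- z * (lgn n.+1)%:C) j).
  have e (x : R) : eterm (- z * x%:C) j = eterm (- x%:C) j * z ^+ j.
    rewrite /eterm [RHS]mulrC mulrA; congr (_ / _); rewrite -exprMn.
    by congr (_ ^+ _); ring.
  have gen (x p1 f1 p2 f2 y : C) : x * (p1 * f1 - p2 * f2) * y =
      x * (p1 * (f1 * y) - p2 * (f2 * y)) by ring.
  by rewrite (e (lgn n)) (e (lgn n.+1)); exact: gen.
apply: (sum_exchange (b := b) (B := B * (K * (expR r / r)))).
- move=> n J; under eq_bigr do rewrite Es.
  have /andP[e0 e1] := lgn_step n; set e := lgn n.+1 - lgn n in e0 e1 *.
  have ll : lgn n <= lgn n.+1 by rewrite -subr_ge0.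
  set p := normc z in zr.
  have p0 : 0 <= p by exact: normc_ge0.
  have T j : normc (ps c n.+1 * (pw n s0 * eterm (- z * (lgn n)%:C) j -
       pw n.+1 s0 * eterm (- z * (lgn n.+1)%:C) j)) <=
     B * (expR (- sg * lgn n) * (eterm (p * lgn n.+1) j - eterm (p * lgn n) j) +
          normc (pw n s0 - pw n.+1 s0) * eterm (p * lgn n.+1) j).
    rewrite Normc.normcM ler_pM ?normc_ge0 //.
    rewrite (_ : pw n s0 * _ - _ = pw n s0 * (eterm (- z * (lgn n)%:C) j - eterm (- z * (lgn n.+1)%:C) j)
        + (pw n s0 - pw n.+1 s0) * eterm (- z * (lgn n.+1)%:C) j); last by ring.
    apply: le_trans (le_normcD _ _) _.
    rewrite (Normc.normcM (pw n s0)) (Normc.normcM (pw n s0 - pw n.+1 s0)) normc_pw.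
    apply: lerD; last first.
      by rewrite normc_eterm Normc.normcM normc_real normcN ger0_norm ?lgn_ge0.
    rewrite ler_wpM2l ?expR_ge0 //.
    have -> : eterm (- z * (lgn n)%:C) j - eterm (- z * (lgn n.+1)%:C) j =
       eterm (- z) j * ((lgn n) ^+ j - (lgn n.+1) ^+ j)%:C.
      by rewrite /eterm !exprMn rmorphB !rmorphXn /=; ring.
    have -> : eterm (p * lgn n.+1) j - eterm (p * lgn n) j =
       eterm p j * (lgn n.+1 ^+ j - lgn n ^+ j) by rewrite /eterm !exprMn; ring.
    rewrite Normc.normcM normc_eterm normcN normc_real distrC ger0_norm //.
    by rewrite subr_ge0 lerXn2r ?nnegrE ?lgn_ge0.
  apply: (@le_trans _ _ (\sum_(j < J) B *
     (expR (- sg * lgn n) * (eterm (p * lgn n.+1) j - eterm (p * lgn n) j) +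
          normc (pw n s0 - pw n.+1 s0) * eterm (p * lgn n.+1) j))).
    by apply: ler_sum => j _; exact: T.
  rewrite -mulr_sumr /b ler_wpM2l ?B_ge0 // big_split /= -!mulr_sumr.
  have pl : 0 <= p * lgn n by rewrite mulr_ge0 ?lgn_ge0.
  have pl2 : p * lgn n <= p * lgn n.+1 by rewrite ler_wpM2l.
  apply: (@le_trans _ _ (expR (- sg * lgn n) * (expR (p * lgn n.+1) - expR (p * lgn n)) +
     normc (pw n s0 - pw n.+1 s0) * expR (p * lgn n.+1))).
    apply: lerD; rewrite ler_wpM2l ?expR_ge0 ?normc_ge0 //.
      exact: eterm_sum_sub_le.
    by apply: eterm_sum_le; apply: le_trans pl2.
  have E1 : expR (p * lgn n.+1) = expR (p * lgn n) * expR (p * e).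
    by rewrite -expRD; congr expR; rewrite /e; ring.
  have pe : p * e <= r by apply: le_trans zr; rewrite ler_piMr.
  have pe0 : 0 <= p * e by rewrite mulr_ge0.
  have E2 : expR (p * e) <= expR r by rewrite ler_expR.
  have E3 : expR (p * e) - 1 <= e * (r * expR r).
    have h := expR_ge1Dx (- (p * e)); rewrite expRN in h.
    have h0 := expR_gt0 (p * e).
    have h1 : (1 - p * e) * expR (p * e) <= 1 by rewrite -ler_pdivlMr // div1r.
    have h2 : p * e * expR (p * e) <= r * e * expR r.
      by apply: ler_pM; rewrite ?expR_ge0 // ler_wpM2r.
    lra.
  have E4 : expR (- sg * lgn n) * expR (p * lgn n) <= expR (- r * lgn n).
    rewrite -expRD ler_expR -mulrDl ler_wpM2r ?lgn_ge0 //.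
    have : sg = r + r by rewrite /r; lra.
    move=> ->; lra.
  have hd := pw_diff n s0; rewrite -/e -/sg in hd.
  apply: (@le_trans _ _ (expR (- r * lgn n) * e * K)); last first.
    rewrite [leRHS]mulrC ler_wpM2r //; exact: Dt_lb.
  have G0 := expR_ge0 (p * lgn n); have G1 := expR_ge0 (- sg * lgn n).
  apply: (@le_trans _ _ (expR (- sg * lgn n) * expR (p * lgn n) * (e * K))); last first.
    by rewrite -[leRHS]mulrA ler_wpM2r // mulr_ge0.
  rewrite E1 /K [e * (_ + _)]mulrDr [leRHS]mulrDr; apply: lerD.
    rewrite -mulrA ler_wpM2l // -{2}[expR (p * lgn n)]mulr1 -mulrBr ler_wpM2l //.
  apply: (@le_trans _ _ (expR (- sg * lgn n) * (e * (normc s0 * expR (normc s0))) *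
     (expR (p * lgn n) * expR r))).
    apply: ler_pM; rewrite ?normc_ge0 ?mulr_ge0 ?expR_ge0 //.
    by rewrite ler_wpM2l.
  by rewrite le_eqVlt; apply/orP; left; apply/eqP; ring.
- move=> N; rewrite /b -!mulr_sumr !mulrA -[leRHS]mulr1 ler_wpM2l ?Dt_sum //.
  by rewrite !mulr_ge0 ?B_ge0 ?expR_ge0 ?invr_ge0 // ltW.
- move=> n; apply: (eq_cvgC (u := fun J => ps c n.+1 * (pw n s0 * ps (eterm (- z * (lgn n)%:C)) J -
     pw n.+1 s0 * ps (eterm (- z * (lgn n.+1)%:C)) J))).
    move=> J; rewrite /ps; under [RHS]eq_bigr do rewrite Es.
    by rewrite -mulr_sumr sumrB !mulr_sumr.
  rewrite /abel !pw_shift; apply: cvgCMl; apply: cvgCB; apply: cvgCMl; exact: cvgC_eterm.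
Qed.

Definition Lser (s : C) : C := xget 0 [set F | cvgC (ps (abel s)) F].

Lemma LserP s : 0 < complex.Re s -> cvgC (ps (abel s)) (Lser s).
Proof.
move=> s0; have z0 : normc (0 : C) <= complex.Re s / 2.
  by rewrite Normc.normc0 divr_ge0 // ltW.
have [a [F [_ h _]]] := abel_exchange s0 z0; rewrite addr0 in h.
by rewrite /Lser; case: xgetP => [G -> //|/(_ F)].
Qed.

Lemma cvg_pw0 s : 0 < complex.Re s -> cvgC (pw^~ s) 0.
Proof.
move=> s0 e e0; pose A := expR ((1 - ln e) / complex.Re s).
have [N hN] : exists N : nat, A <= N%:R.
  by exists (Num.bound A); apply: ltW; apply: archi_boundP; exact: expR_ge0.
exists N => n Nn; rewrite subr0 normc_pw.
rewrite -[ltRHS]lnK ?posrE // ltr_expR.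
have h : (1 - ln e) / complex.Re s <= lgn n.
  rewrite -[leLHS]expRK /lgn ler_ln ?posrE ?expR_gt0 ?ltr0n //.
  by apply: le_trans hN _; rewrite ler_nat; apply: leq_trans Nn _.
have : 1 - ln e <= complex.Re s * lgn n by rewrite mulrC -ler_pdivrMr.
by rewrite mulNr => ?; lra.
Qed.

(** The boundary term of the summation by parts is a bounded sum times (N+1)^(-s), which tends to
    0. *)
Lemma Lser_series s : 0 < complex.Re s ->
  cvgC (ps (fun n => c n * pw n s)) (Lser s).
Proof.
move=> s0.
have E N : ps (fun n => c n * pw n s) N = ps (abel s) N + ps c N * pw N s.
  elim: N => [|N IH]; first by rewrite /ps !big_ord0 mul0r addr0.
  by rewrite psS IH !psS /abel psS; ring.
have h0 : cvgC (fun N => ps c N * pw N s) 0.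
  move=> e e0; have B1 : 0 < B + 1 by rewrite ltr_wpDl ?B_ge0.
  have [N hN] := cvg_pw0 s0 (divr_gt0 e0 B1); exists N => n Nn.
  have h := hN n Nn; rewrite subr0 ltr_pdivlMr // mulrC in h.
  rewrite subr0 Normc.normcM.
  apply: le_lt_trans h; rewrite ler_wpM2r ?normc_ge0 //.
  by apply: le_trans (cB n) _; rewrite lerDl.
rewrite -[Lser s]addr0; apply: eq_cvgC (cvgCD (LserP s0) h0) => N; exact/esym/E.
Qed.

(** The exchange at the fixed real point z = r yields the coefficients, after division by r^j; at a
    general z its terms are these coefficients times z^j, by uniqueness of limits. *)
Lemma Lser_analytic s0 : 0 < complex.Re s0 -> analytic_at Lser s0.
Proof.
move=> sg0; set sg := complex.Re s0 in sg0; pose r := sg / 2.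
have r0 : 0 < r by rewrite divr_gt0.
pose T n j := ps c n.+1 * (pw n s0 * eterm (- (lgn n)%:C) j -
         pw n.+1 s0 * eterm (- (lgn n.+1)%:C) j).
have rr : normc r%:C <= complex.Re s0 / 2 by rewrite normc_real ger0_norm // ltW.
have [a [_ [ha _ _]]] := abel_exchange sg0 rr.
have rn0 j : r%:C ^+ j != 0 :> C by rewrite expf_neq0 // -normc_eq0 normc_real normr_eq0 lt0r_neq0.
exists (fun j => a j / r%:C ^+ j), r; split => // s hs; apply/converges_toP.
have zr : normc (s - s0) <= complex.Re s0 / 2 by apply: ltW.
have [a' [F [ha' hF haF]]] := abel_exchange sg0 zr.
rewrite [s0 + _]addrC subrK in hF.
have Res : 0 < complex.Re s.
  have := Re_le_normc (s - s0); rewrite raddfB /= -/sg ler_norml => /andP[h _].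
  have : r = sg / 2 by []. 
  move: hs h; lra.
have -> : Lser s = F by exact: cvgC_unique (LserP Res) hF.
apply: eq_cvgC haF => N; apply: eq_bigr => j _.
apply: cvgC_unique (ha' j) _.
have := cvgCMl ((s - s0) ^+ j / r%:C ^+ j) (ha j).
rewrite mulrAC [(s - s0) ^+ j * a j]mulrC [X in cvgC _ X -> _]mulrAC => h.
apply: eq_cvgC h => M; rewrite /ps mulr_sumr; apply: eq_bigr => n _.
have gen (x1 x2 x3 w : C) : w != 0 -> x3 / w * (x1 * x2 * w) = x1 * x2 * x3.
  by move=> w0; field.
exact: gen.
Qed.

End DirichletSeries.

(** * The identity theorem along a path *)

Section IdentityTheorem.
Variable R : realType.
Local Notation C := R[i].
Local Notation normc := (@Normc.normc R).
Implicit Types (s z : C) (H F G : C -> C).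

Lemma analytic_atB F G s : analytic_at F s -> analytic_at G s ->
  analytic_at (fun z => F z - G z) s.
Proof.
move=> [a [r [r0 ha]]] [b [t [t0 hb]]].
exists (fun n => a n - b n), (Num.min r t); split; first by rewrite lt_min r0.
move=> z; rewrite lt_min => /andP[zr zt]; apply/converges_toP.
have := cvgCB (proj1 (converges_toP _ _) (ha z zr)) (proj1 (converges_toP _ _) (hb z zt)).
apply: eq_cvgC => N; rewrite /ps -sumrB; apply: eq_bigr => n _; ring.
Qed.

Lemma geom_tail (x : R) N : 0 <= x -> x <= 2^-1 -> \sum_(i < N) x ^+ i.+1 <= 2 * x.
Proof.
move=> x0 x1; suff : \sum_(i < N) x ^+ i.+1 <= 2 * x - 2 * x * x ^+ N.
  by move=> h; apply: le_trans h _; rewrite lerBlDr lerDl !mulr_ge0 ?exprn_ge0.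
elim: N => [|N IH]; first by rewrite big_ord0 expr0 mulr1 subrr.
rewrite big_ord_recr /= !exprS; have p0 : 0 <= x * x ^+ N by rewrite mulr_ge0 ?exprn_ge0.
have : (2^-1 - x) * (x * x ^+ N) >= 0 by rewrite mulr_ge0 ?subr_ge0.
move=> *; lra.
Qed.

(* A power series whose zeros accumulate at its centre vanishes: compare with
   the first nonzero coefficient. *)
Lemma zero_acc (a : nat -> C) (r : R) H s0 : 0 < r ->
  (forall z, normc (z - s0) < r -> cvgC (ps (fun n => a n * (z - s0) ^+ n)) (H z)) ->
  (forall e : R, 0 < e -> exists z, [/\ z != s0, normc (z - s0) < e & H z = 0]) ->
  forall n, a n = 0.
Proof.
move=> r0 ha acc; pose p := r / 2.
have p0 : 0 < p by rewrite divr_gt0.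
have [M [M0 hM]] : exists M : R, 0 < M /\ forall n, normc (a n) * p ^+ n <= M.
  have hz : normc ((s0 + p%:C) - s0) < r.
    by rewrite addrC addKr normc_real ger0_norm ?(ltW p0) // /p; lra.
  have e : s0 + p%:C - s0 = p%:C by rewrite addrC addKr.
  have hl := ha _ hz; rewrite e in hl; have [N hN] := hl 1 ltr01.
  have bd n : (N <= n)%N -> normc (a n) * p ^+ n <= 2.
    move=> Nn; have h1 := hN n Nn; have h2 := hN n.+1 (leqW Nn).
    have <- : normc (a n * p%:C ^+ n) = normc (a n) * p ^+ n.
      by rewrite Normc.normcM normcX normc_real ger0_norm // ltW.
    have -> : a n * p%:C ^+ n = (ps (fun n => a n * p%:C ^+ n) n.+1 - H (s0 + p%:C)) -
       (ps (fun n => a n * p%:C ^+ n) n - H (s0 + p%:C)) by rewrite psS; ring.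
    apply: le_trans (le_normcD _ _) _; rewrite normcN; lra.
  exists (2 + \sum_(i < N) normc (a i) * p ^+ i).
  have s0' : 0 <= \sum_(i < N) normc (a i) * p ^+ i.
    by apply: sumr_ge0 => i _; rewrite mulr_ge0 ?normc_ge0 ?exprn_ge0 // ltW.
  split=> [|n]; first by rewrite ltr_wpDr.
  case: (leqP N n) => [/bd h|nN]; first by apply: le_trans h _; rewrite lerDl.
  rewrite (bigD1 (Ordinal nN)) //= addrCA lerDl addr_ge0 //.
  by apply: sumr_ge0 => i _; rewrite mulr_ge0 ?normc_ge0 ?exprn_ge0 // ltW.
move=> n; have [m] := ubnP n; elim: m n => // m IH n; rewrite ltnS => nm.
have lt0 k : (k < n)%N -> a k = 0 by move=> kn; apply: IH; apply: leq_trans nm.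
apply/eqP; rewrite -normc_eq0; apply/eqP/le_anti; rewrite normc_ge0 andbT.
apply/ler_addgt0Pr => e e0; rewrite add0r.
(* Chosen so that the terms beyond the n-th sum to at most K |w|^(n+1) when |w| <= p/2. *)
pose K := 2 * M / p ^+ n.+1.
have K0 : 0 < K by rewrite divr_gt0 ?mulr_gt0 ?exprn_gt0.
have d0 : 0 < Num.min (p / 2) (e / K) by rewrite lt_min; apply/andP; split; exact: divr_gt0.
have [z [zs zd Hz]] := acc _ d0; move: zd; rewrite lt_min => /andP[zp ze].
pose w := z - s0; have w0 : 0 < normc w.
  by rewrite lt_def normc_ge0 andbT normc_eq0 subr_eq0.
have zr : normc (z - s0) < r by apply: lt_trans zp _; rewrite /p; lra.
have lim := ha z zr; rewrite Hz -/w in lim.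
have bound N : (n.+1 <= N)%N -> normc (a n) * normc w ^+ n - K * normc w * normc w ^+ n <=
     normc (ps (fun n => a n * w ^+ n) N).
  move=> nN; rewrite -(subnKC nN) /ps big_split_ord /= big_ord_recr /= big1 ?add0r; last first.
    by move=> i _; rewrite lt0 ?mul0r // ltn_ord.
  set T := \sum_(i < _) _.
  have hT : normc T <= K * normc w * normc w ^+ n.
    apply: le_trans (ler_normc_sum _ _ _) _.
    pose x := normc w / p.
    have x0 : 0 <= x by rewrite divr_ge0 ?normc_ge0 // ltW.
    have x2 : x <= 2^-1 by rewrite ler_pdivrMr // mulrC ltW.
    have gen (u t : R) i : u != 0 -> M / u ^+ (n + i.+1) * t ^+ (n + i.+1) =
        M / u ^+ n * t ^+ n * (t / u) ^+ i.+1.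
      move=> u0; rewrite exprMn exprVn !exprD.
      move: (expf_neq0 n u0) (expf_neq0 i.+1 u0).
      move: (u ^+ n) (u ^+ i.+1) (t ^+ n) (t ^+ i.+1) => x1 x3 x4 x5 h1 h3.
      by field; rewrite h1 h3.
    apply: (@le_trans _ _ (\sum_(i < N - n.+1) (M / p ^+ n * normc w ^+ n) * x ^+ i.+1)).
      apply: ler_sum => i _; rewrite Normc.normcM normcX.
      have h := hM (n.+1 + i)%N; rewrite -ler_pdivlMr ?exprn_gt0 // in h.
      apply: (@le_trans _ _ (M / p ^+ (n.+1 + i) * normc w ^+ (n.+1 + i))).
        by rewrite ler_wpM2r // exprn_ge0 // normc_ge0.
      rewrite le_eqVlt; apply/orP; left; apply/eqP.
      have -> : (n.+1 + i = n + i.+1)%N by rewrite addnS.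
      exact: gen (lt0r_neq0 p0).
    rewrite -mulr_sumr; apply: le_trans (ler_wpM2l _ (geom_tail _ x0 x2)) _.
      by rewrite !mulr_ge0 ?invr_ge0 ?exprn_ge0 ?normc_ge0 ?(ltW p0) ?(ltW M0).
    have gen2 (u t y v : R) : M / u * y * (2 * (t / v)) = 2 * M / (v * u) * t * y.
      by rewrite invfM; ring.
    by rewrite le_eqVlt /K exprS -gen2 eqxx.
  have : normc (a n * w ^+ n) <= normc (a n * w ^+ n + T) + normc T.
    rewrite -{1}(addrK T (a n * w ^+ n)); apply: le_trans (le_normcD _ _) _.
    by rewrite normcN.
  by rewrite {1}Normc.normcM normcX => *; lra.
have h0 : normc (a n) * normc w ^+ n - K * normc w * normc w ^+ n <= 0.
  apply/ler_addgt0Pr => e1 e10; rewrite add0r.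
  have [N hN] := lim e1 e10; have := hN (maxn N n.+1) (leq_maxl _ _).
  rewrite subr0 => /ltW; apply: le_trans; apply: bound; exact: leq_maxr.
have h1 : normc (a n) <= K * normc w.
  by rewrite -subr_le0 -(pmulr_lle0 _ (exprn_gt0 n w0)) mulrBl.
apply: le_trans h1 _; rewrite mulrC -ler_pdivlMr // ltW //.
Qed.

Definition null_near H s := exists2 r : R, 0 < r & forall z, normc (z - s) < r -> H z = 0.

Lemma null_acc H s0 : analytic_at H s0 ->
  (forall e : R, 0 < e -> exists z, [/\ z != s0, normc (z - s0) < e & H z = 0]) ->
  null_near H s0.
Proof.
move=> [a [r [r0 ha]]] acc.
have h z : normc (z - s0) < r -> cvgC (ps (fun n => a n * (z - s0) ^+ n)) (H z).
  by move=> zr; apply/converges_toP; exact: ha.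
have a0 := zero_acc r0 h acc; exists r => // z zr.
apply: cvgC_unique (h z zr) _; apply: eq_cvgC (cvgC_cst 0) => N.
by rewrite /ps big1 // => n _; rewrite a0 mul0r.
Qed.

(** Let T be the supremum of the t up to which H vanishes locally along the segment. For T > 0 zeros
    accumulate at T from the left, so [null_acc] gives vanishing near T, and hence past T unless the
    end is reached; for T = 0 the hypothesis at p serves. *)
Lemma null_segment H (p v : C) : v != 0 ->
  (forall t : R, 0 <= t <= 1 -> analytic_at H (p + t%:C * v)) ->
  null_near H p -> null_near H (p + v).
Proof.
move=> v0 an np; pose g (t : R) := p + t%:C * v.
have nv : 0 < normc v by rewrite lt_def normc_ge0 andbT normc_eq0.
have gd (t t' : R) : normc (g t - g t') = `|t - t'| * normc v.
  rewrite (_ : g t - g t' = (t - t')%:C * v); last by rewrite /g rmorphB; ring.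
  by rewrite Normc.normcM normc_real.
pose E := [set t : R | 0 <= t <= 1 /\ forall t', 0 <= t' <= t -> null_near H (g t')].
have g0 : g 0 = p by rewrite /g mul0r addr0.
have E0 : E 0.
  split; first by rewrite lexx ler01.
  by move=> t'; rewrite -eq_le => /eqP <-; rewrite g0.
have hs : has_sup E by split; [exists 0 | exists 1 => t [/andP[]]].
set T := sup E.
have T0 : 0 <= T by apply: sup_upper_bound.
have T1 : T <= 1 by apply: ge_sup; [exists 0 | move=> t [/andP[]]].
have below t : 0 <= t -> t < T -> null_near H (g t).
  move=> t0 tT; have e0 : 0 < T - t by rewrite subr_gt0.
  have [t1 [_ h] lt1] := sup_adherent e0 hs.
  by apply: h; rewrite t0 /=; move: lt1; rewrite -/T => ?; lra.
have nT : null_near H (g T).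
  move: T0; rewrite le_eqVlt => /predU1P[<-|T0]; first by rewrite g0.
  apply: null_acc; first by apply: an; rewrite (ltW T0).
  move=> e e0; pose d := Num.min (T / 2) (e / normc v / 2).
  have d0 : 0 < d by rewrite lt_min !divr_gt0.
  have dT : d <= T / 2 by rewrite ge_min lexx.
  have de : d <= e / normc v / 2 by rewrite ge_min lexx orbT.
  have [r r0 hr] : null_near H (g (T - d)) by apply: below; lra.
  exists (g (T - d)); split; last by apply: hr; rewrite subrr Normc.normc0.
    rewrite -subr_eq0 -normc_eq0 gd mulf_neq0 ?normr_eq0 ?(gt_eqF nv) //.
    by rewrite addrC addKr oppr_eq0 gt_eqF.
  rewrite gd addrC addKr normrN gtr0_norm // -ltr_pdivlMr //.
  apply: le_lt_trans de _; have : 0 < e / normc v by rewrite divr_gt0.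
  lra.
have [r r0 hr] := nT.
have near t : `|t - T| < r / 2 / normc v -> null_near H (g t).
  move=> ht; exists (r / 2); first by rewrite divr_gt0.
  move=> z hz; apply: hr.
  rewrite (_ : z - g T = (z - g t) + (g t - g T)); last by ring.
  apply: le_lt_trans (le_normcD _ _) _; rewrite gd.
  by move: ht; rewrite ltr_pdivlMr // => ?; lra.
have d0 : 0 < r / 2 / normc v by rewrite !divr_gt0.
have upto t : 0 <= t -> t < T + r / 2 / normc v -> null_near H (g t).
  move=> t0 tl; case: (ltP t T) => [/(below _ t0)//|Tt].
  by apply: near; rewrite ger0_norm; lra.
have g1 : p + v = g 1 by rewrite /g mul1r.
rewrite g1; case: (ltP 1 (T + r / 2 / normc v)) => h1; first exact: upto.
pose t := T + r / 2 / normc v / 2.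
have Et : E t.
  split; first by apply/andP; split; rewrite /t; lra.
  move=> t' /andP[a b]; apply: upto => //; rewrite /t in b; lra.
have := sup_upper_bound hs Et; rewrite -/T /t => ?; lra.
Qed.

(** The segments from 2 + i to 1/2 + i and from there to 1/2 avoid the point 1, where the functions
    need not be analytic. *)
Lemma identity_half F G :
  (forall s, 1 < complex.Re s -> F s = G s) ->
  (forall s, 0 < complex.Re s -> s != 1 -> analytic_at F s) ->
  (forall s, 0 < complex.Re s -> s != 1 -> analytic_at G s) ->
  F (2^-1)%:C = G (2^-1)%:C.
Proof.
move=> FG aF aG; pose H z := F z - G z.
have aH s : 0 < complex.Re s -> s != 1 -> analytic_at H s.
  by move=> s0 s1; apply: analytic_atB; [exact: aF | exact: aG].
have n1 : null_near H (2 +i* 1).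
  exists 1 => // z hz; apply/eqP; rewrite subr_eq0; apply/eqP/FG.
  have := Re_le_normc (z - 2 +i* 1); rewrite raddfB /= ler_norml => /andP[h _].
  by move: hz h; move: (normc _) => x; lra.
have n2 : null_near H (2^-1 +i* 1).
  have -> : 2^-1 +i* 1 = (2 +i* 1) + ((- (3 / 2))%:C) :> C.
    by apply/eqP; rewrite eq_complex /=; apply/andP; split; apply/eqP; [field|ring].
  apply: null_segment n1; first by rewrite -normc_eq0 normc_real normr_eq0 oppr_eq0 mulf_neq0 ?invr_eq0 ?pnatr_eq0.
  move=> t /andP[t0 t1]; apply: aH => /=; first by rewrite /=; lra.
  by rewrite eq_complex /= negb_and; apply/orP; right; apply/eqP; lra.
have [r r0 hr] : null_near H (2^-1)%:C.
  have -> : (2^-1)%:C = (2^-1 +i* 1) + (0 -i* 1) :> C.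
    by apply/eqP; rewrite eq_complex /=; apply/andP; split; apply/eqP; ring.
  apply: null_segment n2.
    by rewrite eq_complex /= negb_and oppr_eq0 oner_eq0 orbT.
  move=> t /andP[t0 t1]; apply: aH => /=; first by rewrite /=; lra.
  by rewrite eq_complex /= negb_and; apply/orP; left; apply/eqP; lra.
by apply/eqP; rewrite -subr_eq0; apply/eqP/hr; rewrite subrr Normc.normc0.
Qed.

End IdentityTheorem.

(** * The value at 1/2 of a non-principal L-function *)

Section CentralValue.
Variables (R : realType) (q : nat).
Hypothesis pq : prime q.
Local Notation C := R[i].
Local Notation normc := (@Normc.normc R).
Local Notation n := q.-1.
Let q0 : (0 < q)%N := prime_gt0 pq.

Variable j : nat.
Hypotheses (jn : (j < n)%N) (j0 : j != 0%N).
Local Notation c := (fun m : nat => chi R q j (m.+1%:Z)).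

Lemma normc_chi_le1 (m : int) : normc (@chi R q j m) <= 1.
Proof.
rewrite /chi; case: ifP => _; first by rewrite Normc.normc0.
rewrite normcX; suff -> : normc (croot R q) = 1 by rewrite expr1n.
have : normc (croot R q) ^+ n = 1.
  by rewrite -normcX (prim_expr_order (crootP R pq)) Normc.normc1.
by move/eqP; rewrite pexpr_eq1 ?pred_gt0 ?normc_ge0 // => /eqP.
Qed.

Lemma chi_sum0 : \sum_(a < q) @chi R q j (a.+1%:Z) = 0.
Proof.
pose g := nat_of_ord (groot q).
have cg : coprime g q.
  rewrite coprime_sym prime_coprime // -Fp_nat_eq0 // -pmulrn natr_Zp.
  exact: groot_neq0.
have per : forall a b : nat, a = b %[mod q] -> @chi R q j a%:Z = @chi R q j b%:Z.
  by move=> a b; apply: chi_congr.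
pose S := \sum_(a < q) @chi R q j (a : nat)%:Z.
have e1 : \sum_(a < q) @chi R q j (a.+1%:Z) = S.
  by apply: (sum_succ_per _ _ (fun a => chi R q j a%:Z)); apply: per; rewrite modnn mod0n.
rewrite e1; have e2 : @chi R q j g%:Z * S = S.
  rewrite /S mulr_sumr; pose f (t : 'I_q) := Ordinal (ltn_pmod (g * t) q0).
  have finj : injective f.
    move=> x y /(congr1 val) /= /eqP e; apply/val_inj => /=.
    wlog xy : x y e / (x <= y)%N.
      by move=> W; case: (leqP x y) => [/W->//|/ltnW /W -> //]; rewrite eq_sym.
    move: e; rewrite eq_sym eqn_mod_dvd ?leq_mul // -mulnBr Gauss_dvdr 1?coprime_sym //.
    by rewrite -eqn_mod_dvd // !modn_small ?ltn_ord // => /eqP ->.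
  rewrite [RHS](reindex_inj finj); apply: eq_bigr => t _ /=.
  by rewrite -chi_natM //; apply: per; rewrite modn_mod.
have c1 : @chi R q j g%:Z != 1.
  have gF : ((g%:Z)%:~R : 'F_q) = groot q by rewrite -pmulrn natr_Zp.
  rewrite /chi gF (negbTE (groot_neq0 pq)) -(expr0 (croot R q)) (eq_prim_root_expr (crootP R pq)).
  have d1 : dlog (groot q) = 1 %[mod n].
    by apply/eqP; rewrite -(eq_prim_root_expr (grootP pq)) dlogK ?groot_neq0 // expr1.
  by rewrite -modnMmr d1 modnMmr muln1 mod0n modn_small.
apply/eqP; move/eqP: e2; rewrite -{2}[S]mul1r -subr_eq0 -mulrBl mulf_eq0 subr_eq0.
by rewrite (negbTE c1).
Qed.

Lemma sum_chi_shift (K r : nat) :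
  ps c (K * q + r) = \sum_(a < r) @chi R q j (a.+1%:Z).
Proof.
elim: K => [|K IH]; first by rewrite mul0n add0n.
rewrite mulSn -addnA /ps big_split_ord /= chi_sum0 add0r -IH.
apply: eq_bigr => i _; apply: chi_congr => //.
by rewrite -addnS modnDl.
Qed.

Lemma chi_psums N : normc (ps c N) <= q%:R.
Proof.
rewrite (divn_eq N q) sum_chi_shift; apply: le_trans (ler_normc_sum _ _ _) _.
apply: (@le_trans _ _ (\sum_(a < N %% q) (1 : R))).
  by apply: ler_sum => a _; exact: normc_chi_le1.
by rewrite sumr_const card_ord ler_nat ltnW // ltn_mod.
Qed.

Lemma pw_half m : pw m ((2^-1)%:C : C) = ((Num.sqrt m.+1%:R)^-1)%:C.
Proof.
rewrite pwE (_ : - (2^-1)%:C * (lgn R m)%:C = (- (2^-1 * lgn R m))%:C); last first.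
  by rewrite rmorphN rmorphM mulNr.
rewrite cexp_real expRN; congr (_^-1%:C).
by rewrite -powR12_sqrt // /powR pnatr_eq0 /=.
Qed.

(** Partial sums up to multiples of q split by residue class into partial Hurwitz sums. Since the
    character values sum to 0 over a period, the divergent term 2 sqrt K, common to all classes, may
    be subtracted for free. *)
Lemma Lser_half : Lser c ((2^-1)%:C) = Lam R q j.
Proof.
have s0 : 0 < complex.Re ((2^-1)%:C : C) by rewrite /= invr_gt0.
have h := Lser_series chi_psums s0.
have hK := cvgC_sub (f := fun K => (K * q)%N) _ h.
have {}hK := hK (fun K => leq_pmulr K q0).
apply: cvgC_unique hK _.
have sqn : Num.sqrt q%:R != 0 :> R by rewrite sqrtr_eq0 -ltNge ltr0n.
have -> : Lam R q j = \sum_(a < q) @chi R q j (a.+1%:Z) * (((Num.sqrt q%:R)^-1)%:C * (hz R (a.+1%:R / q%:R))%:C).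
  rewrite /Lam; pose G (a : nat) := @chi R q j a%:Z * ((Num.sqrt q%:R)^-1 * hF R q a)%:C.
  rewrite (eq_bigr (fun a : 'I_q => G a)) //.
  have -> : \sum_(a < q) G a = \sum_(a < q) G a.+1.
    have Gq : G q = G 0%N.
      have eq0 : q = 0 %[mod q] by rewrite modnn mod0n.
      by rewrite /G (chi_congr R pq j eq0) (hF_eq R q q 0 eq0).
    exact: esym (sum_succ_per _ _ _ Gq).
  by apply: eq_bigr => a _; rewrite /G /hF rep_small // rmorphM.
have lim : cvgC (fun K => \sum_(a < q) @chi R q j (a.+1%:Z) *
     (((Num.sqrt q%:R)^-1)%:C * (hz_part R (a.+1%:R / q%:R) K - 2 * Num.sqrt K%:R)%:C))
   (\sum_(a < q) @chi R q j (a.+1%:Z) * (((Num.sqrt q%:R)^-1)%:C * (hz R (a.+1%:R / q%:R))%:C)).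
  apply: (cvgC_sum (index_enum _)) => a; do 2 apply: cvgCMl; apply: cvgC_real.
  by apply: hz_cvg; rewrite divr_gt0 ?ltr0n.
apply: eq_cvgC lim => K /=.
have -> : \sum_(a < q) @chi R q j (a.+1%:Z) *
     (((Num.sqrt q%:R)^-1)%:C * (hz_part R (a.+1%:R / q%:R) K - 2 * Num.sqrt K%:R)%:C) =
   \sum_(a < q) @chi R q j (a.+1%:Z) * (((Num.sqrt q%:R)^-1)%:C * (hz_part R (a.+1%:R / q%:R) K)%:C).
  apply/eqP; rewrite -subr_eq0 -sumrB; apply/eqP.
  transitivity (\sum_(a < q) @chi R q j (a.+1%:Z) * (- ((Num.sqrt q%:R)^-1 * (2 * Num.sqrt K%:R))%:C)).
    by apply: eq_bigr => a _; rewrite rmorphB !rmorphM /=; ring.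
  by rewrite -mulr_suml chi_sum0 mul0r.
rewrite /ps mulnC (sum_ord_mul _ q K (fun m => c m * pw m ((2^-1)%:C : C))).
apply: eq_bigr => a _; rewrite -rmorphM /= /hz_part mulr_sumr rmorph_sum /= mulr_sumr.
apply: eq_bigr => k _; rewrite pw_half; congr (_ * _).
  by apply: chi_congr => //; rewrite -addnS modnMDl.
congr (_%:C); rewrite -invfM -sqrtrM ?ler0n //; congr ((Num.sqrt _)^-1).
by rewrite -addnS natrD natrM; field; rewrite pnatr_eq0 -lt0n.
Qed.

(** [dirichlet_L] is chosen among all continuations: [Lser] shows that there is one, and
    [identity_half] that all have the same value at 1/2. *)
Lemma dirichlet_L_half : dirichlet_L (chi R q j) (2^-1) = Lam R q j.
Proof.
have half : (2^-1 : C) = (2^-1)%:C by rewrite fmorphV rmorph_nat.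
rewrite half -Lser_half.
have L1 : is_dirichlet_L (chi R q j) (Lser c).
  split=> s s0; last by move=> _; exact: (Lser_analytic chi_psums s0).
  by apply/converges_toP; apply: (Lser_series chi_psums); apply: lt_trans s0.
rewrite /dirichlet_L; case: xgetP => [G _ [G1 G2]|/(_ (Lser c)) //].
apply: (@identity_half _ G (Lser c)) => [s s1||s s0 _]; [|exact: G2|exact: (Lser_analytic chi_psums s0)].
have h1 := proj1 (converges_toP _ _) (G1 s s1).
by apply: cvgC_unique h1 _; apply: (Lser_series chi_psums); apply: lt_trans s1.
Qed.

End CentralValue.

(** * Groups of primes *)

Section Primes.
Variable R : realType.

Definition Psum (x : nat) : R := \sum_(p < x.+1 | prime p) (p%:R)^-1.

Lemma PsumS x : Psum x.+1 = Psum x + (prime x.+1)%:R * (x.+1%:R)^-1.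
Proof.
by rewrite /Psum big_mkcond big_ord_recr /= -big_mkcond; case: (prime _); rewrite ?mul1r ?mul0r.
Qed.

Lemma Psum_add x m : Psum (x + m) = Psum x + \sum_(i < m | prime (x + i.+1)) ((x + i.+1)%:R)^-1.
Proof.
elim: m => [|m IH]; first by rewrite addn0 big_ord0 addr0.
rewrite addnS PsumS IH [in RHS]big_mkcond big_ord_recr /= -big_mkcond addnS addrA; congr (_ + _).
by case: (prime _); rewrite ?mul1r ?mul0r.
Qed.

Lemma prime_ndvd_fact p m : prime p -> (m < p)%N -> ~~ (p %| m`!)%N.
Proof.
move=> pp; elim: m => [|m IH] mp; first by rewrite fact0 gtnNdvd ?prime_gt1.
by rewrite factS Euclid_dvdM // negb_or gtnNdvd //= IH // ltnW.
Qed.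

Lemma bin_le_exp2 a b : ('C(a, b) <= 2 ^ a)%N.
Proof.
case: (leqP b a) => [ba|ab]; last by rewrite bin_small.
have := expnDn 1 1 a; rewrite addn1 => ->.
have bl : (b < a.+1)%N by [].
by rewrite (bigD1 (Ordinal bl)) //= !exp1n !muln1 leq_addr.
Qed.

Lemma fact_addn m k : ((m + k)`! = m`! * \prod_(i < k) (m + i.+1))%N.
Proof.
elim: k => [|k IH]; first by rewrite addn0 big_ord0 muln1.
by rewrite addnS factS IH big_ord_recr /= -addnS [RHS]mulnA [RHS]mulnC.
Qed.

(** The primes in (m, 2m] divide (2m)! and are prime to m!. *)
Lemma prod_primes_dvd m : (\prod_(i < m | prime (m + i.+1)) (m + i.+1) %| 'C(m + m, m))%N.
Proof.
set P := (\prod_(_ < _ | _) _)%N.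
have cop : coprime P (m`! * m`!).
  rewrite /P; elim/big_ind: _ => [|x y|i pi]; first exact: coprime1n.
    by rewrite coprimeMl => -> ->.
  rewrite prime_coprime // Euclid_dvdM // orbb; apply: prime_ndvd_fact => //.
  by rewrite addnS ltnS leq_addr.
have dv : (P %| (m + m)`!)%N.
  rewrite fact_addn; apply: dvdn_mull; rewrite [X in (_ %| X)%N](bigID (fun i : 'I_m => prime (m + i.+1))) /=.
  exact: dvdn_mulr.
rewrite -(Gauss_dvdl _ cop); have := bin_fact (leq_addr m m); rewrite addnK => ->.
exact: dv.
Qed.

(** Chebyshev's argument: the N primes in (m, 2m] have a product between m^N and the central
    binomial coefficient, at most 2^(2m). For m = 2^j this gives N <= 2m/j, and each reciprocal is
    at most 1/m. *)
Lemma Psum_dyadic j : (0 < j)%N -> Psum (2 ^ j.+1) - Psum (2 ^ j) <= 2 / j%:R.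
Proof.
move=> j0; set m := (2 ^ j)%N.
have m0 : (0 < m)%N by rewrite expn_gt0.
rewrite expnS mul2n -addnn -/m Psum_add addrAC subrr add0r.
pose N := (\sum_(i < m | prime (m + i.+1)) 1)%N.
have le1 : (m ^ N <= \prod_(i < m | prime (m + i.+1)) (m + i.+1))%N.
  rewrite /N; elim/big_rec2: _ => [|i x y pi xy]; first by rewrite expn0.
  by rewrite expnD expn1 leq_mul // leq_addr.
have le2 : (2 ^ (j * N) <= 2 ^ (m + m))%N.
  rewrite expnM -/m; apply: leq_trans le1 _; apply: leq_trans (bin_le_exp2 (m + m) m).
  by apply: dvdn_leq (prod_primes_dvd m); rewrite bin_gt0 leq_addr.
rewrite leq_exp2l // in le2.
apply: (@le_trans _ _ (N%:R / m%:R)).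
  rewrite /N natr_sum mulr_suml; apply: ler_sum => i _.
  by rewrite mul1r lef_pV2 ?posrE ?ltr0n ?addnS // ler_nat leqW // leq_addr.
rewrite ler_pdivrMr ?ltr0n // mulrAC ler_pdivlMr ?ltr0n //.
by rewrite -!natrM ler_nat mulnC mul2n -addnn.
Qed.

Lemma Psum_blocks b c : (0 < b)%N ->
  Psum (2 ^ (b + c)) - Psum (2 ^ b) <= \sum_(j < c) 2 / (b + j)%:R.
Proof.
move=> b0; elim: c => [|c IH]; first by rewrite addn0 subrr big_ord0.
rewrite big_ord_recr /= addnS.
have := @Psum_dyadic (b + c) (ltn_addr _ b0) => h; lra.
Qed.

Lemma Psum_short b c : (0 < b)%N -> Psum (2 ^ (b + c)) - Psum (2 ^ b) <= 2 * c%:R / b%:R.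
Proof.
move=> b0; apply: le_trans (Psum_blocks _ b0) _.
have -> : 2 * c%:R / b%:R = \sum_(j < c) 2 / b%:R :> R.
  by rewrite sumr_const card_ord -[RHS]mulr_natr mulrAC.
apply: ler_sum => j _; rewrite ler_pM2l // lef_pV2 ?posrE ?ltr0n ?ltn_addr //.
by rewrite ler_nat leq_addr.
Qed.

(** An upper Mertens bound with leading coefficient 2 instead of 1, from the blocks 2/j. It is
    applied to the primes that precede the first group, where it affects only the constant. *)
Lemma expR_Psum_le J : (0 < J)%N -> expR (Psum (2 ^ J)) <= expR 3 * J%:R ^+ 2.
Proof.
move=> J0; have h : Psum (2 ^ J) <= 3 + ln (J%:R : R) * 2.
  have := @Psum_blocks 1 J.-1 isT; rewrite add1n prednK // expn1.
  have -> : Psum 2 = 2^-1.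
    rewrite /Psum big_mkcond !big_ord_recl big_ord0 /= /bump /=.
    by rewrite !add0r addr0.
  have -> : \sum_(j < J.-1) 2 / (1 + j)%:R = 2 * Hn R J.-1 :> R.
    by rewrite /Hn mulr_sumr; apply: eq_bigr => j _; rewrite add1n.
  have : Hn R J.-1 <= 1 + ln (J%:R : R).
    have h1 := Hn_le R J J0; apply: le_trans h1.
    have HS k : Hn R k.+1 = Hn R k + k.+1%:R^-1 by rewrite /Hn big_ord_recr.
    by rewrite -[in leRHS](prednK J0) HS lerDl invr_ge0.
  by move=> *; lra.
have JR : 0 < J%:R :> R by rewrite ltr0n.
apply: (@le_trans _ _ (expR (3 + ln (J%:R : R) * 2))); first by rewrite ler_expR.
by rewrite expRD expRM_natr lnK // posrE.
Qed.

Definition smooth (m k : nat) := all (fun p => p < m)%N (primes k).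

(** A truncated Euler product over the primes below m. *)
Definition Hs (m y : nat) : R := \sum_(k < y.+1) ((0 < k)%N && smooth m k)%:R * (k%:R)^-1.

Lemma smoothS m k : ~~ (m %| k)%N -> (0 < k)%N -> smooth m.+1 k -> smooth m k.
Proof.
move=> mk k0 /allP h; apply/allP => p pk; have := h p pk.
rewrite ltnS leq_eqVlt => /predU1P[e|//]; move: mk; rewrite -e.
by move: pk; rewrite mem_primes => /and3P[_ _ ->].
Qed.

(** One Euler factor: the multiples of m contribute at most 1/m times the whole sum, and what is
    prime to m has only prime factors below m. *)
Lemma Hs_prime m y : prime m -> (1 - (m%:R)^-1) * Hs m.+1 y <= Hs m y.
Proof.
move=> pm; have m0 := prime_gt0 pm; have mR : 0 < m%:R :> R by rewrite ltr0n.
(* [G] vanishes beyond y, so that the range can be extended to a whole number of periods modulo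
   m. *)
pose G r k : R := ((0 < k)%N && smooth r k && (k < y.+1)%N)%:R * (k%:R)^-1.
have G0 r k : 0 <= G r k by rewrite mulr_ge0 ?invr_ge0.
have GE r : Hs r y = \sum_(j < m) \sum_(k < y.+1) G r (k * m + j)%N.
  rewrite -(sum_ord_mul _ m y.+1 (G r)) -(subnKC (leq_pmull y.+1 m0)) big_split_ord /=.
  rewrite [X in _ + X]big1 ?addr0 => [|i _]; last first.
    by rewrite /G [(_ < y.+1)%N]ltnNge leq_addr andbF mul0r.
  by apply: eq_bigr => k _; rewrite /G ltn_ord andbT.
have E1 : Hs m.+1 y <= m%:R^-1 * Hs m.+1 y + Hs m y.
  rewrite {1}GE; rewrite (bigD1 (Ordinal m0)) //=; apply: lerD.
    rewrite /Hs mulr_sumr; apply: ler_sum => k _; rewrite addn0 /G.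
    have [k0|k0] := posnP k; first by rewrite k0 mul0n !mul0r mulr0.
    have aux (a b c d : R) : 0 <= c -> 0 <= d -> a <= b -> a * (c * d) <= d * (b * c).
      by move=> c0 d0 ab; rewrite [leRHS]mulrCA [d * c]mulrC ler_wpM2r // mulr_ge0.
    rewrite natrM invfM; apply: aux; rewrite ?invr_ge0 //.
    rewrite ler_nat muln_gt0 k0 m0 /=; case: (boolP (smooth m.+1 k)) => sk; first by rewrite leq_b1.
    rewrite leqn0 eqb0 negb_and; apply/orP; left; apply: contraNN sk => /allP h.
    apply/allP => p pk; apply: h; move: pk; rewrite !mem_primes => /and3P[-> _ d] /=.
    by rewrite muln_gt0 k0 m0 /= dvdn_mulr.
  rewrite GE [X in _ <= X](bigD1 (Ordinal m0)) //= ler_wpDl ?sumr_ge0 //.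
  apply: ler_sum => j jn; apply: ler_sum => k _; rewrite /G ler_wpM2r ?invr_ge0 //.
  rewrite ler_nat; set N := (k * m + j)%N.
  have nd : ~~ (m %| N)%N.
    rewrite /N dvdn_addr ?dvdn_mull // gtnNdvd // lt0n; apply: contraNneq jn => e.
    by apply/eqP/val_inj.
  case: (posnP N) => [//|N0] /=; case: (boolP (smooth m.+1 N)) => //= s.
  by rewrite (smoothS nd N0 s).
lra.
Qed.

Lemma Hs_nonprime m y : ~~ prime m -> Hs m.+1 y = Hs m y.
Proof.
move=> npm; apply: eq_bigr => k _; congr (_%:R * _).
case: (posnP k) => // k0 /=; congr nat_of_bool.
apply/allP/allP => h p pk; last by rewrite ltnS ltnW // h.
have := h p pk; rewrite ltnS leq_eqVlt => /predU1P[e|//].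
by move: pk npm; rewrite mem_primes e => /andP[->].
Qed.

Lemma Hs_2 y : Hs 2 y <= 1.
Proof.
rewrite /Hs; case: y => [|y]; first by rewrite big_ord_recl big_ord0 /= mul0r addr0 ler01.
rewrite !big_ord_recl /= mul0r add0r big1 ?addr0 ?mul1r ?invr1 // => i _.
rewrite /bump /= (_ : smooth 2 _ = false) ?mul0r //.
apply/negP => /allP h.
have pd : pdiv i.+2 \in primes i.+2 by rewrite mem_primes pdiv_prime //= pdiv_dvd.
by have := h _ pd; rewrite ltnNge prime_gt1 // pdiv_prime.
Qed.

(** Each factor is (1 - 1/p)^(-1) = 1 + 1/(p-1), at most exp(1/(p-1)). The excess of 1/(p-1) over
    1/p, summed over all integers instead of primes, telescopes to the 1 - 1/(m-1) in the
    exponent. *)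
Lemma Hs_ub m y : (2 <= m)%N -> Hs m y <= expR (Psum m.-1 + 1 - (m.-1%:R)^-1).
Proof.
elim: m => // m IH; rewrite leq_eqVlt => /predU1P[<-|]; last rewrite ltnS => m2.
  have -> : Psum 2.-1 = 0 by rewrite /Psum big_mkcond !big_ord_recl big_ord0 /= !addr0.
  by rewrite invr1 add0r subrr expR0; apply: Hs_2.
have {}IH := IH m2; have mR : 1 < m%:R :> R by rewrite ltr1n.
have m1R : 0 < m.-1%:R :> R by rewrite ltr0n -ltnS prednK // ltnW.
have m1 : m%:R = m.-1%:R + 1 :> R by rewrite natr1 prednK // ltnW.
have PE : Psum m = Psum m.-1 + (prime m)%:R * (m%:R)^-1.
  by rewrite -{1}(prednK (ltnW m2)) PsumS prednK // ltnW.
have mm : m%:R^-1 <= m.-1%:R^-1 :> R   by rewrite lef_pV2 ?posrE ?ler_nat ?leq_pred // (lt_trans ltr01).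
rewrite /= PE; have [pm|npm] := boolP (prime m); last first.
  rewrite Hs_nonprime // mul0r addr0; apply: le_trans IH _; rewrite ler_expR; lra.
rewrite mul1r; have h := Hs_prime y pm.
have e : 1 - m%:R^-1 = m.-1%:R / m%:R :> R.
  by rewrite m1; field; rewrite -m1 lt0r_neq0 // (lt_trans ltr01).
have h2 : Hs m.+1 y <= Hs m y * (1 + m.-1%:R^-1).
  have p1 : 0 < 1 - m%:R^-1 :> R by rewrite e divr_gt0 // (lt_trans ltr01).
  rewrite -(ler_pM2l p1); apply: le_trans h _; rewrite e mulrCA.
  have -> : m.-1%:R / m%:R * (1 + m.-1%:R^-1) = 1 :> R.
    rewrite m1; field; rewrite -m1 !lt0r_neq0 // (lt_trans ltr01) //.
  by rewrite mulr1.
apply: le_trans h2 _.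
have -> : Psum m.-1 + m%:R^-1 + 1 - m%:R^-1 = (Psum m.-1 + 1 - m.-1%:R^-1) + m.-1%:R^-1 by ring.
rewrite expRD; apply: ler_pM => //; last exact: expR_ge1Dx.
  by apply: sumr_ge0 => k _; rewrite mulr_ge0 ?invr_ge0.
Qed.

(** The lower Mertens bound with the exact leading coefficient: every positive integer up to x is
    counted by [Hs x.+1 x], so the full harmonic sum, at least ln x, obeys the Euler product bound
    [Hs_ub]. *)
Lemma Psum_lower x : (2 <= x)%N -> ln (x%:R : R) <= expR (Psum x + 1).
Proof.
move=> x2; have x0 : (0 < x)%N by apply: ltnW.
have h := @Hs_ub x.+1 x (leqW x2); rewrite /= in h.
have hH : Hs x.+1 x = Hn R x.
  rewrite /Hs /Hn big_ord_recl /= mul0r add0r; apply: eq_bigr => i _.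
  rewrite /bump /= add1n (_ : smooth _ _ = true) ?mul1r //.
  apply/allP => p; rewrite mem_primes => /and3P[_ _ /dvdn_leq h2].
  by rewrite ltnS; apply: leq_trans (h2 isT) _.
rewrite hH in h.
have h1 : ln (x%:R : R) <= Hn R x.
  have /andP[h1 _] := Hn_diff R 1 x.-1 isT; move: h1; rewrite add1n prednK //.
  have /andP[_ l1] := ln_succ_bounds R x x0; have /andP[l2 l3] := ln_succ_bounds R 1 isT.
  have -> : Hn R 1 = 1 by rewrite /Hn big_ord_recl big_ord0 invr1 addr0.
  have /andP[l4 _] := ln_succ_bounds R x x0.
  have : 0 <= (x.+1%:R : R)^-1 by rewrite invr_ge0.
  have aux (a b c d e : R) : a - c <= d - 1 -> b <= a -> c - e <= 1 -> e = 0 -> b <= d by lra.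
  move=> _ h1; apply: aux h1 _ _ (ln1 _); first by rewrite -subr_ge0 (le_trans _ l4) ?invr_ge0.
  by move: l3; rewrite invr1.
apply: le_trans h1 _; apply: le_trans h _; rewrite ler_expR.
have : 0 <= (x%:R : R)^-1 by rewrite invr_ge0.
lra.
Qed.

Lemma flatten_index_iota (e : nat -> nat) m n : {homo e : x y / (x <= y)%N} ->
  flatten [seq index_iota (e i) (e i.+1) | i <- iota m n] = index_iota (e m) (e (m + n)%N).
Proof.
move=> he; elim: n m => [|n IH] m; first by rewrite addn0 /index_iota subnn.
rewrite [LHS]/= IH addSnnS /index_iota.
have h1 := he m m.+1 (leqnSn m); have h2 : (e m.+1 <= e (m + n.+1)%N)%N.
  by rewrite he // -addSnnS leq_addr.
by rewrite -{2}(subnKC h1) -iotaD; congr iota; lia.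
Qed.

Lemma Psum_iota x y : (x <= y)%N ->
  \sum_(p <- [seq p <- index_iota x.+1 y.+1 | prime p]) (p%:R)^-1 = Psum y - Psum x.
Proof.
move=> xy; rewrite big_filter /Psum.
rewrite -(big_mkord (fun p => prime p) (fun p => (p%:R : R)^-1)) -(big_mkord prime (fun p => (p%:R : R)^-1)).
by rewrite [X in _ = X - _](@big_cat_nat _ _ _ x.+1) //= addrAC subrr add0r.
Qed.

(** * The cutting of the primes into groups *)

Section Groups.
Variables (a V : nat).
Hypothesis aV : (a <= V)%N.

(* At level [v] the exponents in [16^v, 16^v.+1) are cut into blocks of length [4 ^ gw v]. *)
Definition gf v := minn (2 * v) (2 * a + V - v).
Definition gw v := (2 * v - gf v)%N.
Definition gend (v i : nat) := (2 ^ (i * 4 ^ gw v))%N.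
Definition gprimes (g : nat * nat) :=
  [seq p <- index_iota (gend g.1 g.2).+1 (gend g.1 g.2.+1).+1 | prime p].
Definition gtop (g : nat * nat) := gend g.1 g.2.+1.
(** Level v has [15 * 4 ^ gf v] groups, each with sigma^2 at most twice the square of this scale. In
    [gf], the bound 2 v corresponds to the finest cutting, blocks of length 1 in the exponent; 2 a +
    V - v limits the number of groups at high levels, where the primes are large. *)
Definition gsize (g : nat * nat) : R := (2 ^- (gf g.1)).
Definition glevel v := iota (4 ^ gf v) (15 * 4 ^ gf v).
Definition glist := [seq (v, i) | v <- iota a (V - a).+1, i <- glevel v].

Lemma gwf v : (gw v + gf v = 2 * v)%N.
Proof. by rewrite /gw subnK // geq_minl. Qed.

Lemma gend_lo v : gend v (4 ^ gf v) = (2 ^ 16 ^ v)%N.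
Proof. by rewrite /gend -expnD addnC gwf expnM. Qed.

Lemma gend_hi v : gend v (4 ^ gf v + 15 * 4 ^ gf v) = (2 ^ 16 ^ v.+1)%N.
Proof. by rewrite /gend -mulSn -mulnA -expnD [(gf v + _)%N]addnC gwf (expnM 4 2) -expnS. Qed.

Lemma gend_homo v : {homo gend v : x y / (x <= y)%N}.
Proof. by move=> x y xy; rewrite leq_exp2l // leq_mul2r xy orbT. Qed.

Lemma gprimes_level v :
  flatten [seq gprimes (v, i) | i <- glevel v] =
  [seq p <- index_iota (2 ^ 16 ^ v).+1 (2 ^ 16 ^ v.+1).+1 | prime p].
Proof.
rewrite -gend_lo -gend_hi -(@flatten_index_iota (fun i => (gend v i).+1)) => [|x y xy]; last first.
  by rewrite ltnS gend_homo.
by rewrite filter_flatten -map_comp.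
Qed.

Lemma gprimes_flatten :
  flatten [seq gprimes g | g <- glist] =
  [seq p <- index_iota (2 ^ 16 ^ a).+1 (2 ^ 16 ^ V.+1).+1 | prime p].
Proof.
have -> : V.+1 = (a + (V - a).+1)%N by rewrite addnS subnKC.
rewrite -(@flatten_index_iota (fun i => (2 ^ 16 ^ i).+1)) => [|x y xy]; last first.
  by rewrite ltnS !leq_exp2l.
rewrite filter_flatten -map_comp /glist.
elim: (iota a _) => //= v l IH; rewrite map_cat flatten_cat IH; congr (_ ++ _).
by rewrite -gprimes_level -map_comp.
Qed.

Lemma big_glist (F : nat * nat -> R) :
  \sum_(g <- glist) F g = \sum_(t < (V - a).+1) \sum_(i <- glevel (a + t)) F ((a + t)%N, i).
Proof.
rewrite big_allpairs_dep (_ : iota a _ = map (addn a) (iota 0 (V - a).+1)) ?big_map; last first.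
  by rewrite -iotaDl addn0.
by rewrite -(big_mkord xpredT (fun t => \sum_(i <- glevel (a + t)) F ((a + t)%N, i))) /index_iota subn0.
Qed.

Lemma mem_glist g : g \in glist -> (a <= g.1 <= V)%N && (4 ^ gf g.1 <= g.2 < 16 * 4 ^ gf g.1)%N.
Proof.
case/allpairsPdep => v [j] [h1 h2 ->] /=; move: h1 h2; rewrite !mem_iota -mulSn addnS subnKC //.
by rewrite ltnS => -> ->.
Qed.

Lemma gf_ge v : (a <= v <= V)%N -> (2 * a <= gf v)%N.
Proof. by rewrite /gf; lia. Qed.

Lemma gsize_le g : g \in glist -> gsize g <= 4 ^- a.
Proof.
move/mem_glist => /andP[/gf_ge h _]; rewrite /gsize.
by rewrite lef_pV2 ?posrE ?exprn_gt0 // -!natrX ler_nat -[4%N]/(2 ^ 2)%N -expnM leq_exp2l.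
Qed.

(** A group covers the exponents from b = i c to (i+1) c with c = 4 ^ gw, so [Psum_short] gives 2 c
    / b = 2 / i, and i is at least 4 ^ gf. *)
Lemma gprimes_sum g : g \in glist -> \sum_(p <- gprimes g) (p%:R)^-1 <= 2 * gsize g ^+ 2 :> R.
Proof.
move/mem_glist => /andP[_ /andP[h _]]; rewrite Psum_iota ?gend_homo //.
have i0 : (0 < g.2)%N by apply: leq_trans h; rewrite expn_gt0.
have b0 : (0 < g.2 * 4 ^ gw g.1)%N by rewrite muln_gt0 i0 expn_gt0.
rewrite /gend mulSn addnC; apply: le_trans (Psum_short _ b0) _.
rewrite -mulrA ler_pM2l // natrM invfM mulrCA mulfV ?mulr1; last by rewrite pnatr_eq0 -lt0n expn_gt0.
rewrite /gsize -exprVn exprAC expr2 -invfM -natrM exprVn lef_pV2 ?posrE ?exprn_gt0 ?ltr0n //.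
by rewrite -natrX ler_nat.
Qed.

Lemma sum_pow_le (c : R) d : 0 <= c -> c <= 2^-1 -> \sum_(t < d) c ^+ t <= (1 - c)^-1.
Proof.
move=> c0 c1; have p : 0 < 1 - c by lra.
rewrite -(ler_pM2l p) mulfV ?gt_eqF // -opprB mulNr -subrX1 opprB.
by rewrite lerBlDr lerDl exprn_ge0.
Qed.

Lemma sum_invpow_le (c : R) d : 2 <= c -> \sum_(t < d) c ^- t <= (1 - c^-1)^-1.
Proof.
move=> c2; have c0 : 0 < c by apply: lt_le_trans c2.
under eq_bigr => t _ do rewrite -exprVn.
by apply: sum_pow_le; rewrite ?invr_ge0 ?(ltW c0) // lef_pV2 ?posrE.
Qed.

Lemma sum_invpow_rev (c : R) d : 2 <= c -> \sum_(t < d.+1) c ^- (d - t) <= (1 - c^-1)^-1.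
Proof.
move=> c2; apply: le_trans (sum_invpow_le d.+1 c2).
rewrite (reindex_inj rev_ord_inj) /= le_eqVlt; apply/orP; left; apply/eqP.
by apply: eq_bigr => t _; rewrite subSS subKn // -ltnS.
Qed.

(** Level v contributes 15 * 2 ^- gf v. As [gf] is a minimum of two linear functions of v, this is
    at most a sum of two geometric progressions, one decaying upwards from level a and one downwards
    from level V; their total 15 (4/3 + 2) = 50 is rounded up to 60. *)
Lemma gsize_sum : \sum_(g <- glist) gsize g ^+ 3 <= 60 * 4 ^- a.
Proof.
rewrite big_glist.
apply: (@le_trans _ _ (\sum_(t < (V - a).+1) (15 * 4 ^- a) * (4 ^- t + 2 ^- (V - a - t)))).
  apply: ler_sum => t _; rewrite /gsize /= /glevel big_const_seq count_predT size_iota.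
  rewrite iter_addr_0 -[_ *+ (15 * _)]mulr_natr; set f := gf _.
  have -> : (2 ^- f) ^+ 3 * (15 * 4 ^ f)%:R = 15 * 2 ^- f :> R.
    have -> : (4 ^ f)%N = (2 ^ f * 2 ^ f)%N by rewrite -expnMn.
    rewrite !natrM !natrX; have : (2 : R) ^+ f != 0 by rewrite expf_neq0.
    by move: (_ ^+ f) => z z0; field.
  rewrite -mulrA ler_pM2l //.
  have e4 : 4 ^- a = 2 ^- (2 * a) :> R by rewrite exprM expr2 -natrM.
  have e4t : 4 ^- t = 2 ^- (2 * t) :> R by rewrite exprM expr2 -natrM.
  rewrite mulrDr e4 e4t -!invfM -!exprD.
  have tV : (t <= V - a)%N by rewrite -ltnS.
  rewrite /f /gf; case: leqP => h.
    by rewrite -mulnDr lerDl invr_ge0 exprn_ge0.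
  have -> : (2 * a + V - (a + t) = 2 * a + (V - a - t))%N by lia.
  by rewrite lerDr invr_ge0 exprn_ge0.
rewrite -mulr_sumr mulrAC ler_wpM2r ?invr_ge0 ?exprn_ge0 //.
rewrite big_split /=.
have h2 := @sum_invpow_rev 2 (V - a) (lexx _).
have h4 : \sum_(t < (V - a).+1) 4 ^- t <= (1 - 4^-1)^-1 :> R by apply: sum_invpow_le; rewrite ler_nat.
have e2 : (1 - 2^-1)^-1 = 2 :> R by field.
have e4 : (1 - 4^-1)^-1 = 4 / 3 :> R by field.
rewrite e2 in h2; rewrite e4 in h4; lra.
Qed.

(** In the exponent, level v contributes at most 16 * 16^v for each of its 15 * 4 ^ gf v groups. The
    bound 2 a + V - v in [gf] makes this decay like 4^(v - V) below the top level; 320 is 240 times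
    4/3. *)
Lemma gtop_prod : (\prod_(g <- glist) gtop g <= 2 ^ (320 * 16 ^ a * 16 ^ V))%N.
Proof.
pose F (g : nat * nat) := (g.2.+1 * 4 ^ gw g.1)%N.
have -> : (\prod_(g <- glist) gtop g = 2 ^ \sum_(g <- glist) F g)%N.
  by elim: glist => [|g l IH]; rewrite ?big_nil // !big_cons IH expnD.
rewrite leq_exp2l // -(ler_nat R) natr_sum big_glist.
apply: (@le_trans _ _ (\sum_(t < (V - a).+1) (240 * 16 ^ a * 16 ^ V)%:R * 4 ^- (V - a - t))).
  apply: ler_sum => t _; have tV : (t <= V - a)%N by rewrite -ltnS.
  set v := (a + t)%N.
  apply: (@le_trans _ _ (\sum_(i <- glevel v) (16 * 16 ^ v)%:R)).
    rewrite !big_seq; apply: ler_sum => i; rewrite mem_iota -mulSn => /andP[_ h].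
    rewrite ler_nat /F /=; apply: (@leq_trans (16 * 4 ^ gf v * 4 ^ gw v)).
      by rewrite leq_mul2r h orbT.
    by rewrite -mulnA -expnD addnC gwf expnM.
  rewrite big_const_seq count_predT size_iota iter_addr_0 -[_ *+ (15 * _)]mulr_natr -natrM.
  rewrite ler_pdivlMr ?exprn_gt0 // -natrX -natrM ler_nat.
  have h1 : (4 ^ gf v <= 4 ^ (2 * a) * 4 ^ (V - a - t))%N.
    by rewrite -expnD leq_exp2l // /gf /v; lia.
  have -> : (240 * 16 ^ a * 16 ^ V = 16 * 16 ^ v * (15 * (4 ^ (2 * a) * 4 ^ (V - a - t)) * 4 ^ (V - a - t)))%N.
    have -> : (16 ^ V = 16 ^ v * 16 ^ (V - a - t))%N by rewrite -expnD; congr (_ ^ _)%N; rewrite /v; lia.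
    have -> : (16 ^ (V - a - t) = 4 ^ (V - a - t) * 4 ^ (V - a - t))%N by rewrite -expnMn.
    rewrite (expnM 4 2) -[(4 ^ 2)%N]/16%N.
    by move: (4 ^ _)%N (16 ^ a)%N (16 ^ v)%N => x y z; ring.
  by rewrite !mulnA leq_mul2r -!mulnA !leq_mul2l h1 !orbT.
rewrite -mulr_sumr.
have -> : (320 * 16 ^ a * 16 ^ V)%:R = (240 * 16 ^ a * 16 ^ V)%:R * (1 - 4^-1)^-1 :> R.
  by rewrite !natrM; field.
by rewrite ler_wpM2l // sum_invpow_rev // ler_nat.
Qed.

End Groups.

(** V is the largest level for which [gtop_prod] keeps the power [kap] of the product within q. The
    groups then reach 2^(16^(V+1)), so ln q is at most a constant times the logarithm of that bound,
    which [Psum_lower] compares with the sum of the 1/p. *)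
Lemma prime_groups (a kap : nat) : (0 < kap)%N -> exists q0 : nat, forall q : nat, (q0 <= q)%N ->
  exists (gs : seq (nat * nat)) (s : nat * nat -> seq nat) (T : nat * nat -> nat) (y : nat * nat -> R),
  [/\ uniq gs, uniq (flatten [seq s g | g <- gs]),
    ((\prod_(g <- gs) T g) ^ kap <= q)%N,
    {in gs, forall g, [/\ {in s g, forall p, prime p && (p <= T g)%N}, (a <= T g)%N, 0 < y g <= 4 ^- a &
       \sum_(p <- s g) (p%:R)^-1 <= 2 * y g ^+ 2]} &
    \sum_(g <- gs) y g ^+ 3 <= 60 * 4 ^- a /\
    ln (q%:R : R) <= (320 * kap)%:R * expR 4 * 4096 ^+ a * expR (\sum_(g <- gs) \sum_(p <- s g) (p%:R)^-1)].
Proof.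
move=> k0; set c := (kap * (320 * 16 ^ a))%N.
have c0 : (0 < c)%N by rewrite !muln_gt0 k0 expn_gt0.
exists (2 ^ (c * 16 ^ a))%N => q hq.
set m := trunc_log 2 q; have q0 : (0 < q)%N by apply: leq_trans hq; rewrite expn_gt0.
have /andP[m1 m2] := trunc_log_bounds (isT : 1 < 2)%N q0.
have ma : (c * 16 ^ a <= m)%N by apply: trunc_log_max.
set V := trunc_log 16 (m %/ c).
have Va : (16 ^ a <= m %/ c)%N by rewrite leq_divRL // mulnC.
have aV : (a <= V)%N by apply: trunc_log_max.
have mc0 : (0 < m %/ c)%N by apply: leq_trans Va; rewrite expn_gt0.
have /andP[V1 V2] := trunc_log_bounds (isT : 1 < 16)%N mc0.
rewrite leq_divRL // in V1; rewrite ltn_divLR // in V2.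
exists (glist a V), (gprimes a V), (gtop a V), (gsize a V); split.
- by apply: allpairs_uniq_dep => [|v _|[v i] [v' i'] _ _ [-> ->]] //; apply: iota_uniq.
- by rewrite gprimes_flatten // filter_uniq // iota_uniq.
- apply: leq_trans m1; apply: (@leq_trans (2 ^ (320 * 16 ^ a * 16 ^ V * kap))).
    by rewrite expnM leq_exp2r // gtop_prod.
  rewrite leq_exp2l // -/m; apply: leq_trans V1; rewrite -/V /c.
  by rewrite mulnC [X in (_ <= X)%N]mulnC mulnA.
- move=> g gg; split; last exact: gprimes_sum.
  + by move=> p; rewrite mem_filter mem_index_iota => /andP[-> /andP[_]].
  + have /andP[/andP[av _] /andP[ig _]] := mem_glist aV gg.
    apply: leq_trans av _; apply: leq_trans (ltnW (ltn_expl g.1 (isT : 1 < 2)%N)) _.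
    rewrite leq_exp2l //; apply: (@leq_trans (4 ^ gf a V g.1 * 4 ^ gw a V g.1)); last first.
      by rewrite leq_mul2r (leqW ig) orbT.
    by rewrite -expnD addnC gwf; apply: leq_trans (ltnW (ltn_expl _ (isT : 1 < 4)%N)); lia.
  + by rewrite gsize_le // invr_gt0 exprn_gt0.
- split; first exact: gsize_sum.
  have -> (l : seq (nat * nat)) (s : nat * nat -> seq nat) (F : nat -> R) :
      \sum_(g <- l) \sum_(p <- s g) F p = \sum_(p <- flatten [seq s g | g <- l]) F p.
    by rewrite big_flatten big_map.
  rewrite gprimes_flatten // Psum_iota; last by rewrite !leq_exp2l // leqW.
  set S := Psum _; set S0 := Psum _.
  have x2 : (2 <= 2 ^ 16 ^ V.+1)%N by rewrite -{1}[2%N]expn1 leq_exp2l // expn_gt0.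
  have := Psum_lower x2; rewrite -/S natrX lnXn // => hS.
  have J0 : (0 < 16 ^ a)%N by rewrite expn_gt0.
  have h0 := expR_Psum_le J0; rewrite -/S0 in h0.
  have lq : ln (q%:R : R) <= ln 2 *+ (c * 16 ^ V.+1).
    rewrite -lnXn // ler_ln ?posrE ?ltr0n ?exprn_gt0 // -natrX ler_nat ltnW //.
    by apply: leq_trans m2 _; rewrite leq_exp2l // mulnC -/m.
  apply: le_trans lq _; rewrite mulnC mulrnA -[_ *+ c]mulr_natl.
  (* The omitted primes, up to 2^(16^a), cost exp(S0) <= e^3 256^a; with the 16^a in [c] this makes
     the 4096^a of the claim. *)
  have eS : expR (S + 1) <= expR 4 * 256 ^+ a * expR (S - S0).
    have -> : S + 1 = (S - S0) + 1 + S0 by ring.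
    have -> : expR 4 = expR 1 * expR 3 :> R by rewrite -expRD; congr expR; ring.
    have e256 : 256 ^+ a = (16 ^ a)%:R ^+ 2 :> R by rewrite natrX -exprM mulnC exprM; congr (_ ^+ a); ring.
    rewrite (expRD (S - S0 + 1)) (expRD (S - S0)) e256; have := ler_wpM2l (mulr_ge0 (expR_ge0 (S - S0)) (expR_ge0 1)) h0.
    by move: (expR S0) (expR (S - S0)) (expR 1) (expR 3) (_ ^+ 2) => *; lra.
  have cE : c%:R = (320 * kap)%:R * 16 ^+ a :> R by rewrite /c !natrM natrX; ring.
  have e4096 : 4096 ^+ a = 16 ^+ a * 256 ^+ a :> R by rewrite -exprMn -natrM.
  have := le_trans hS eS => hh.
  rewrite cE e4096; apply: le_trans (ler_wpM2l _ hh) _; first by apply: mulr_ge0; [exact: ler0n | exact: exprn_ge0].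
  by rewrite le_eqVlt; apply/orP; left; apply/eqP; ring.
Qed.

End Primes.

(** * Formal Dirichlet polynomials *)

Section Formal.
Variable R : realType.
Implicit Types (U V : seq (R * nat)) (K : nat -> nat -> R) (F : nat -> R).

(* A pair [(c, m)] in the list stands for the term [c * chi m]. *)
Definition lin U F := \sum_(u <- U) u.1 * F u.2.
Definition one : seq (R * nat) := [:: (1, 1%N)].
Definition sc (c : R) U := [seq (c * u.1, u.2) | u <- U].
Definition lmul U V := [seq (u.1 * v.1, (u.2 * v.2)%N) | u <- U, v <- V].
Definition absl U := [seq (`|u.1|, u.2) | u <- U].
Definition l1 U := \sum_(u <- U) `|u.1|.
(** If the mean of chi(m) conj(chi(n)) is [K m n], this is the mean of the value of U times the
    conjugate of that of V, see [ev_form]. *)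
Definition Q K U V := lin U (fun m => lin V (K m)).
Definition nneg U := {in U, forall u, 0 <= u.1}.

Lemma lin_one F : lin one F = F 1%N.
Proof. by rewrite /lin big_seq1 mul1r. Qed.

Lemma lin_cat U V F : lin (U ++ V) F = lin U F + lin V F.
Proof. exact: big_cat. Qed.

Lemma lin_sc c U F : lin (sc c U) F = c * lin U F.
Proof. by rewrite /lin big_map mulr_sumr; apply: eq_bigr => u _; rewrite mulrA. Qed.

Lemma lin_mul U V F : lin (lmul U V) F = lin U (fun m => lin V (fun n => F (m * n)%N)).
Proof.
rewrite /lin big_allpairs_dep; apply: eq_bigr => u _; rewrite mulr_sumr.
by apply: eq_bigr => v _ /=; rewrite mulrA.
Qed.

Lemma eq_lin U F G : {in U, forall u, F u.2 = G u.2} -> lin U F = lin U G.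
Proof. by move=> h; apply: eq_big_seq => u uU; rewrite h. Qed.

Lemma linD U F G : lin U (fun m => F m + G m) = lin U F + lin U G.
Proof. by rewrite /lin -big_split; apply: eq_bigr => u _; rewrite mulrDr. Qed.

Lemma linZ U c F : lin U (fun m => c * F m) = c * lin U F.
Proof. by rewrite /lin mulr_sumr; apply: eq_bigr => u _; rewrite mulrCA. Qed.

Lemma lin_exch U V K : lin U (fun m => lin V (fun n => K m n)) = lin V (fun n => lin U (fun m => K m n)).
Proof.
rewrite /lin; under eq_bigr => u _ do rewrite mulr_sumr.
rewrite exchange_big; apply: eq_bigr => v _; rewrite mulr_sumr.
by apply: eq_bigr => u _; rewrite mulrCA.
Qed.

Lemma lin_prod U V F G : lin U (fun m => lin V (fun n => F m * G n)) = lin U F * lin V G.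
Proof.
rewrite mulrC -linZ; apply: eq_lin => u _; rewrite linZ mulrC //.
Qed.

Lemma lin_le U F G : nneg U -> {in U, forall u, F u.2 <= G u.2} -> lin U F <= lin U G.
Proof.
move=> U0 FG; rewrite /lin !big_seq; apply: ler_sum => u uU.
by rewrite ler_wpM2l ?U0 ?FG.
Qed.

Lemma lin_ge0 U F : nneg U -> {in U, forall u, 0 <= F u.2} -> 0 <= lin U F.
Proof. by move=> U0 F0; rewrite /lin big_seq sumr_ge0 // => u uU; rewrite mulr_ge0 ?U0 ?F0. Qed.

Lemma norm_lin U F : `|lin U F| <= lin (absl U) (fun m => `|F m|).
Proof.
rewrite /lin big_map; apply: le_trans (ler_norm_sum _ _ _) _.
by apply: ler_sum => u _; rewrite normrM.
Qed.

Lemma norm_Q K U V : `|Q K U V| <= Q (fun m n => `|K m n|) (absl U) (absl V).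
Proof.
apply: le_trans (norm_lin _ _) _; by apply: lin_le => [u /mapP[v _ ->] //=|u _]; apply: norm_lin.
Qed.

Lemma Q_diff K K' U V (e : R) :
  {in U & V, forall u v, `|K u.2 v.2 - K' u.2 v.2| <= e} -> `|Q K U V - Q K' U V| <= e * (l1 U * l1 V).
Proof.
move=> h; rewrite /Q /lin -sumrB; apply: le_trans (ler_norm_sum _ _ _) _.
rewrite /l1 mulr_suml mulr_sumr !big_seq; apply: ler_sum => u uU.
rewrite -mulrBr normrM mulrCA ler_wpM2l // -sumrB; apply: le_trans (ler_norm_sum _ _ _) _.
rewrite mulr_sumr !big_seq; apply: ler_sum => v vV.
by rewrite -mulrBr normrM mulrC ler_wpM2r ?h.
Qed.

Lemma l1_cat U V : l1 (U ++ V) = l1 U + l1 V.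
Proof. exact: big_cat. Qed.

Lemma l1_sc c U : l1 (sc c U) = `|c| * l1 U.
Proof. by rewrite /l1 big_map mulr_sumr; apply: eq_bigr => u _; rewrite normrM. Qed.

Lemma l1_mul U V : l1 (lmul U V) = l1 U * l1 V.
Proof.
rewrite /l1 big_allpairs_dep mulr_suml; apply: eq_bigr => u _; rewrite mulr_sumr.
by apply: eq_bigr => v _; rewrite normrM.
Qed.

Lemma l1_one : l1 one = 1.
Proof. by rewrite /l1 big_seq1 normr1. Qed.

Definition primes_in (s : seq nat) : nat_pred := [pred p | p \in s].
Definition supp (s : seq nat) U := {in U, forall u, (primes_in s).-nat u.2}.

Lemma supp_one s : supp s one.
Proof. by move=> u; rewrite inE => /eqP ->. Qed.

Lemma supp_mul s U V : supp s U -> supp s V -> supp s (lmul U V).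
Proof. by move=> hU hV u /allpairsPdep[x [y [xU yV ->]]] /=; rewrite pnatM hU ?hV. Qed.

Lemma supp_cat s U V : supp s U -> supp s V -> supp s (U ++ V).
Proof. by move=> hU hV u; rewrite mem_cat => /orP[/hU|/hV]. Qed.

Lemma supp_sc s c U : supp s U -> supp s (sc c U).
Proof. by move=> hU u /mapP[v /hU h ->]. Qed.

Lemma supp_sub s s' U : {subset s <= s'} -> supp s U -> supp s' U.
Proof. by move=> ss hU u /hU; apply: sub_in_pnat => p _; apply: ss. Qed.

Lemma supp_gt0 s U u : supp s U -> u \in U -> (0 < u.2)%N.
Proof. by move=> h /h /andP[]. Qed.

(** What makes [Q] of a product over groups with disjoint sets of primes factor. *)
Definition mulker K := K 1%N 1%N = 1 /\ forall m n m' n' : nat,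
  (0 < m)%N -> (0 < n)%N -> (0 < m')%N -> (0 < n')%N ->
  coprime (m * n) (m' * n') -> K (m * m')%N (n * n')%N = K m n * K m' n'.
(** A Leibniz rule: the behaviour of a multiplicative kernel times an additive function such as a
    logarithm. *)
Definition derker K K' := K' 1%N 1%N = 0 /\ forall m n m' n' : nat,
  (0 < m)%N -> (0 < n)%N -> (0 < m')%N -> (0 < n')%N ->
  coprime (m * n) (m' * n') -> K' (m * m')%N (n * n')%N = K' m n * K m' n' + K m n * K' m' n'.

Lemma supp_coprime s s' m n m' n' : ~~ has [in s] s' ->
  (primes_in s).-nat m -> (primes_in s).-nat n -> (primes_in s').-nat m' -> (primes_in s').-nat n' ->
  coprime (m * n) (m' * n').
Proof.
move=> /hasPn ss hm hn hm' hn'; apply: (@pnat_coprime (primes_in s)); first by rewrite pnatM hm.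
have h : (primes_in s').-nat (m' * n') by rewrite pnatM hm'.
by apply: sub_in_pnat h => p _ ps'; rewrite inE /=; apply: ss.
Qed.

Lemma Q_mul K s s' U V U' V' : mulker K -> ~~ has [in s] s' ->
  supp s U -> supp s V -> supp s' U' -> supp s' V' ->
  Q K (lmul U U') (lmul V V') = Q K U V * Q K U' V'.
Proof.
move=> [_ mK] ss hU hV hU' hV'; rewrite /Q lin_mul -lin_prod; apply: eq_lin => u uU.
apply: eq_lin => u' uU'; rewrite lin_mul -lin_prod; apply: eq_lin => v vV; apply: eq_lin => v' vV'.
rewrite mK ?(supp_gt0 hU uU) ?(supp_gt0 hV vV) ?(supp_gt0 hU' uU') ?(supp_gt0 hV' vV') //.
exact: (supp_coprime ss (hU _ uU) (hV _ vV) (hU' _ uU') (hV' _ vV')).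
Qed.

Lemma Q_der K K' s s' U V U' V' : derker K K' -> ~~ has [in s] s' ->
  supp s U -> supp s V -> supp s' U' -> supp s' V' ->
  Q K' (lmul U U') (lmul V V') = Q K' U V * Q K U' V' + Q K U V * Q K' U' V'.
Proof.
move=> [_ mK] ss hU hV hU' hV'; rewrite /Q lin_mul -!lin_prod -linD; apply: eq_lin => u uU.
rewrite -linD; apply: eq_lin => u' uU'; rewrite lin_mul -!lin_prod -linD; apply: eq_lin => v vV.
rewrite -linD; apply: eq_lin => v' vV'.
rewrite mK ?(supp_gt0 hU uU) ?(supp_gt0 hV vV) ?(supp_gt0 hU' uU') ?(supp_gt0 hV' vV') //.
exact: (supp_coprime ss (hU _ uU) (hV _ vV) (hU' _ uU') (hV' _ vV')).
Qed.

Section Products.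
Variables (G : eqType) (s : G -> seq nat).
Implicit Types (X Y : G -> seq (R * nat)) (gs : seq G).

Definition pr X gs := foldr (fun g W => lmul (X g) W) one gs.

Lemma supp_pr X gs : {in gs, forall g, supp (s g) (X g)} -> supp (flatten [seq s g | g <- gs]) (pr X gs).
Proof.
elim: gs => [_|g gs IH h] /=; first exact: supp_one.
apply: supp_mul.
  by apply: supp_sub (h g (mem_head _ _)) => p; rewrite mem_cat => ->.
apply: supp_sub (IH _) => [p ps|g' g'gs]; first by rewrite mem_cat ps orbT.
by apply: h; rewrite inE g'gs orbT.
Qed.

Lemma Q_pr K X Y gs : mulker K -> uniq (flatten [seq s g | g <- gs]) ->
  {in gs, forall g, supp (s g) (X g)} -> {in gs, forall g, supp (s g) (Y g)} ->
  Q K (pr X gs) (pr Y gs) = \prod_(g <- gs) Q K (X g) (Y g).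
Proof.
move=> mK; elim: gs => [_ _ _|g gs IH] /=; first by rewrite big_nil /Q !lin_one mK.1.
rewrite cat_uniq => /and3P[_ dis un] hX hY.
have hX' : {in gs, forall g, supp (s g) (X g)} by move=> h hg; apply: hX; rewrite inE hg orbT.
have hY' : {in gs, forall g, supp (s g) (Y g)} by move=> h hg; apply: hY; rewrite inE hg orbT.
rewrite big_cons (Q_mul (s := s g) (s' := flatten [seq s g | g <- gs])) ?IH //.
- by apply: hX; rewrite mem_head.
- by apply: hY; rewrite mem_head.
- exact: supp_pr.
- exact: supp_pr.
Qed.

(** By the Leibniz rule, a sum over the group on which the derivative falls, with the bounds [M] for
    all other groups; [L] plays the part of a logarithmic derivative. *)
Lemma Q_pr_der K K' X Y gs (L M : G -> R) : mulker K -> derker K K' ->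
  uniq (flatten [seq s g | g <- gs]) ->
  {in gs, forall g, supp (s g) (X g)} -> {in gs, forall g, supp (s g) (Y g)} ->
  {in gs, forall g, [/\ `|Q K (X g) (Y g)| <= M g, `|Q K' (X g) (Y g)| <= L g * M g & 0 <= L g]} ->
  `|Q K' (pr X gs) (pr Y gs)| <= (\sum_(g <- gs) L g) * \prod_(g <- gs) M g.
Proof.
move=> mK dK; elim: gs => [_ _ _ _|g gs IH] /=.
  by rewrite !big_nil /Q !lin_one dK.1 normr0 mul0r.
rewrite cat_uniq => /and3P[_ dis un] hX hY hb.
have hX' : {in gs, forall g, supp (s g) (X g)} by move=> h hg; apply: hX; rewrite inE hg orbT.
have hY' : {in gs, forall g, supp (s g) (Y g)} by move=> h hg; apply: hY; rewrite inE hg orbT.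
have hb' : {in gs, forall g, [/\ `|Q K (X g) (Y g)| <= M g, `|Q K' (X g) (Y g)| <= L g * M g & 0 <= L g]}.
  by move=> h hg; apply: hb; rewrite inE hg orbT.
have [b1 b2 b3] := hb g (mem_head _ _).
rewrite !big_cons (Q_der (K := K) (s := s g) (s' := flatten [seq s g | g <- gs])) //; last first.
- exact: supp_pr.
- exact: supp_pr.
- by apply: hY; rewrite mem_head.
- by apply: hX; rewrite mem_head.
rewrite Q_pr // mulrDl; apply: le_trans (ler_normD _ _) _; rewrite !normrM.
apply: lerD; last first.
  by rewrite mulrCA; apply: ler_pM => //; apply: IH.
rewrite mulrA; apply: ler_pM => //; rewrite normr_prod !big_seq.
by apply: ler_prod => h hg; rewrite normr_ge0; case: (hb' h hg).
Qed.

Lemma l1_pr X gs : l1 (pr X gs) = \prod_(g <- gs) l1 (X g).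
Proof. by elim: gs => [|g gs IH]; rewrite ?big_nil ?l1_one //= big_cons l1_mul IH. Qed.

Lemma pr_le X gs (T : G -> nat) : {in gs, forall g, {in X g, forall u, (u.2 <= T g)%N}} ->
  {in pr X gs, forall u, (u.2 <= \prod_(g <- gs) T g)%N}.
Proof.
elim: gs => [_ u|g gs IH h u] /=; first by rewrite inE => /eqP ->; rewrite big_nil.
case/allpairsPdep => x [y [xX yX ->]]; rewrite big_cons /= leq_mul //; first exact: h (mem_head _ _) _ xX.
by apply: IH yX => g' hg'; apply: h; rewrite inE hg' orbT.
Qed.

End Products.

Section Powers.
Variable s : seq nat.
Hypotheses (us : uniq s) (ps : {in s, forall p, prime p}).

(** [Pl] is the P_g and [sg] the sigma_g^2 of a group. In [ppow] a product of distinct primes occurs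
    once for each order of its factors. *)
Definition Pl := [seq ((Num.sqrt p%:R)^-1 : R, p) | p <- s].
Definition ppow a := iter a (lmul Pl) one.
Definition sg : R := \sum_(p <- s) (p%:R)^-1.

Lemma lin_Pl F : lin Pl F = \sum_(p <- s) (Num.sqrt p%:R)^-1 * F p.
Proof. by rewrite /lin big_map. Qed.

Lemma lin_pwS a F : lin (ppow a.+1) F = lin Pl (fun p => lin (ppow a) (fun M => F (p * M)%N)).
Proof. exact: lin_mul. Qed.

Lemma lin_pwD a b F : lin (lmul (ppow a) (ppow b)) F = lin (ppow (a + b)) F.
Proof.
elim: a F => [|a IH] F; first by rewrite lin_mul lin_one; apply: eq_lin => u _; rewrite mul1n.
rewrite addSn lin_pwS lin_mul lin_pwS; apply: eq_lin => u _; rewrite -IH lin_mul.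
by apply: eq_lin => v _; apply: eq_lin => w _; rewrite mulnA.
Qed.

Lemma supp_Pl : supp s Pl.
Proof. by move=> u /mapP[p pI ->] /=; rewrite pnatE ?ps. Qed.

Lemma supp_pw a : supp s (ppow a).
Proof. elim: a => [|a IH]; [exact: supp_one | exact: supp_mul supp_Pl IH]. Qed.

Lemma pw_gt0 a u : u \in ppow a -> (0 < u.2)%N.
Proof. by move/(supp_gt0 (supp_pw (a := a))). Qed.

Lemma nneg_Pl : nneg Pl.
Proof. by move=> u /mapP[p _ ->] /=; rewrite invr_ge0 sqrtr_ge0. Qed.

Lemma nneg_pw a : nneg (ppow a).
Proof.
elim: a => [u|a IH u]; first by rewrite inE => /eqP ->.
by case/allpairsPdep => x [y [xX yX ->]]; rewrite mulr_ge0 ?(nneg_Pl xX) ?(IH _ yX).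
Qed.

Lemma sg_ge0 : 0 <= sg.
Proof. by apply: sumr_ge0 => p _; rewrite invr_ge0. Qed.

Lemma sqr_isqrt (p : nat) : (Num.sqrt p%:R)^-1 * (Num.sqrt p%:R)^-1 = (p%:R)^-1 :> R.
Proof. by rewrite -invfM -expr2 sqr_sqrtr. Qed.

(* Summing the multiplicity of [r] over ordered products of [a] primes removes one of the [a] factors:
   this replaces counting the prime tuples with a given product. *)
Lemma lin_pw_logn r a h : r \in s ->
  lin (ppow a) (fun M => (logn r M)%:R * h (M %/ r)%N) = a%:R * ((Num.sqrt r%:R)^-1 * lin (ppow a.-1) h).
Proof.
move=> rs; have pr := ps rs; have r0 := prime_gt0 pr.
elim: a h => [|a IH] h; first by rewrite lin_one logn1 !mul0r.
rewrite lin_pwS /=.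
transitivity (lin Pl (fun p => (p == r)%:R * lin (ppow a) h +
    a%:R * ((Num.sqrt r%:R)^-1 * lin (ppow a.-1) (fun M => h (p * M)%N)))).
  apply: eq_lin => u /mapP[p pI ->] /=; rewrite -IH -linZ -linD.
  apply: eq_lin => v va; rewrite lognM ?(pw_gt0 va) ?prime_gt0 ?ps // logn_prime ?ps //.
  rewrite eq_sym natrD mulrDl; congr (_ + _).
    by case: eqP => [->|_]; rewrite ?mul0r // mulKn.
  case: (boolP (r %| v.2)%N) => rv; first by rewrite muln_divA.
  by rewrite lognE (negPf rv) !andbF !mul0r.
rewrite linD [X in X + _](_ : _ = (Num.sqrt r%:R)^-1 * lin (ppow a) h); last first.
  rewrite lin_Pl (bigD1_seq r) //= eqxx mul1r big1 ?addr0 // => p /negPf ->.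
  by rewrite mul0r mulr0.
rewrite linZ linZ; case: a IH => [|a] IH; first by rewrite mul0r addr0 mul1r.
by rewrite -lin_pwS -[a.+2%:R]natr1 /=; ring.
Qed.

(** One prime r is split off the right-hand power. The hypothesis either absorbs it, at the cost
    r^(-1/2), or cancels it against a factor r on the left, and [lin_pw_logn] evaluates the sum over
    the ways to do so. *)
Lemma Q_pw_rec K (e : R) a b :
  (forall M N r : nat, (0 < M)%N -> (0 < N)%N -> prime r ->
     K M (r * N)%N <= e * (Num.sqrt r%:R)^-1 * K M N + (logn r M)%:R * K (M %/ r)%N N) ->
  Q K (ppow a) (ppow b.+1) <= sg * (e * Q K (ppow a) (ppow b) + a%:R * Q K (ppow a.-1) (ppow b)).
Proof.
move=> hK; have -> : Q K (ppow a) (ppow b.+1) =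
    lin Pl (fun r => lin (ppow a) (fun M => lin (ppow b) (fun N => K M (r * N)%N))).
  rewrite [RHS]lin_exch; apply: eq_lin => u _; exact: lin_mul.
rewrite lin_Pl /sg mulr_suml !big_seq; apply: ler_sum => r rs; have pr := ps rs.
rewrite -sqr_isqrt -mulrA ler_wpM2l ?invr_ge0 ?sqrtr_ge0 //.
have -> : (Num.sqrt r%:R)^-1 * (e * Q K (ppow a) (ppow b) + a%:R * Q K (ppow a.-1) (ppow b)) =
    lin (ppow a) (fun M => lin (ppow b) (fun N => e * (Num.sqrt r%:R)^-1 * K M N + (logn r M)%:R * K (M %/ r)%N N)).
  rewrite mulrDr mulrCA mulrA [X in _ + X]mulrCA -(lin_pw_logn _ (fun M => lin (ppow b) (K M)) rs) -linZ -linD.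
  by apply: eq_lin => u _; rewrite linD !linZ.
apply: lin_le => [|u ua]; first exact: nneg_pw.
apply: lin_le => [|v vb]; first exact: nneg_pw.
by apply: hK; rewrite ?(pw_gt0 ua) ?(pw_gt0 vb).
Qed.

Lemma lin_pw1 F : lin (ppow 1) F = lin Pl F.
Proof. by rewrite lin_pwS; apply: eq_lin => u _; rewrite lin_one muln1. Qed.

Definition quad (b c : R) := one ++ (sc b (ppow 1) ++ sc c (ppow 2)).

Lemma lin_quad b c F : lin (quad b c) F = F 1%N + (b * lin (ppow 1) F + c * lin (ppow 2) F).
Proof. by rewrite !lin_cat !lin_sc lin_one. Qed.

Lemma supp_quad b c : supp s (quad b c).
Proof. by apply: supp_cat; [exact: supp_one | apply: supp_cat; apply: supp_sc; apply: supp_pw]. Qed.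

Lemma Q_quad K b c b' c' (q := fun i j => Q K (ppow i) (ppow j)) :
  Q K (quad b c) (quad b' c') = q 0%N 0%N + b' * q 0%N 1%N + c' * q 0%N 2%N +
    b * (q 1%N 0%N + b' * q 1%N 1%N + c' * q 1%N 2%N) + c * (q 2%N 0%N + b' * q 2%N 1%N + c' * q 2%N 2%N).
Proof.
rewrite {}/q.
have h i : lin (ppow i) (fun m => lin (quad b' c') (K m)) =
    Q K (ppow i) (ppow 0) + b' * Q K (ppow i) (ppow 1) + c' * Q K (ppow i) (ppow 2).
  rewrite /Q -!linZ -!linD; apply: eq_lin => u _.
  by rewrite lin_quad lin_one addrA.
have h0 := h 0%N; rewrite [LHS]lin_one in h0.
by rewrite {1}/Q lin_quad !h h0; ring.
Qed.

Lemma lin_eq0 U F : {in U, forall u, F u.2 = 0} -> lin U F = 0.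
Proof. by move=> h; rewrite /lin big_seq big1 // => u uU; rewrite h ?mulr0. Qed.

Definition eqk (m n : nat) : R := (m == n)%:R.

Lemma mulker_ortho : mulker eqk.
Proof.
split=> // m n m' n' m0 n0 m'0 n'0; rewrite coprimeMl !coprimeMr => /andP[/andP[c1 c2] /andP[c3 c4]].
rewrite /eqk -natrM mulnb; congr (nat_of_bool _)%:R.
apply/eqP/andP => [e|[/eqP -> /eqP ->]//].
have mn : m = n.
  apply/eqP; rewrite eqn_dvd -(Gauss_dvdl _ c2) -e dvdn_mulr //= -(Gauss_dvdl _ (m := n) (p := m')) ?e ?dvdn_mulr //.
by split; [rewrite mn | move/eqP: e; rewrite mn eqn_pmul2l].
Qed.

Lemma ortho_rec (M N r : nat) : (0 < M)%N -> (0 < N)%N -> prime r ->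
  eqk M (r * N)%N <= 0 * (Num.sqrt r%:R)^-1 * eqk M N + (logn r M)%:R * eqk (M %/ r)%N N.
Proof.
move=> M0 N0 pr; rewrite !mul0r add0r /eqk; case: eqP => [->|_]; last by rewrite mulr_ge0.
have l0 : (0 < logn r (r * N))%N.
  by rewrite logn_gt0 mem_primes pr muln_gt0 N0 prime_gt0 //= dvdn_mulr.
by rewrite mulKn ?prime_gt0 // eqxx mulr1 ler1n.
Qed.

(** Each prime on the right must cancel one of those on the left: the recursion with [e] = 0, which
    yields a! sigma^(2a). *)
Lemma ortho_pw a b : Q eqk (ppow a) (ppow b) <= (a == b)%:R * (a`!)%:R * sg ^+ a.
Proof.
elim: b a => [|b IH] [|a].
- by rewrite /Q !lin_one /eqk /= !mul1r expr0.
- rewrite /Q lin_pwS /= !mul0r le_eqVlt; apply/orP; left; apply/eqP.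
  apply: lin_eq0 => u /mapP[p pI ->] /=; apply: lin_eq0 => v va; rewrite lin_one /eqk; case: eqP => // e; have := prime_gt1 (ps pI).
  by have : (p %| 1)%N by [rewrite -e dvdn_mulr]; rewrite dvdn1 => /eqP ->.
- apply: le_trans (Q_pw_rec _ _ ortho_rec) _.
  by rewrite !mul0r add0r mulr0.
- apply: le_trans (Q_pw_rec _ _ ortho_rec) _.
  rewrite mul0r add0r /= eqSS factS natrM exprS.
  apply: le_trans (ler_wpM2l sg_ge0 (ler_wpM2l (ler0n _ _) (IH a))) _.
  by rewrite le_eqVlt; apply/orP; left; apply/eqP; ring.
Qed.

Lemma ortho_pw_ge0 a b : 0 <= Q eqk (ppow a) (ppow b).
Proof.
apply: lin_ge0 => [|u _]; first exact: nneg_pw.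
by apply: lin_ge0 => // ; exact: nneg_pw.
Qed.

Lemma ortho_pw_ne a b : a != b -> Q eqk (ppow a) (ppow b) = 0.
Proof.
move=> ab; apply/le_anti; rewrite ortho_pw_ge0 andbT.
by apply: le_trans (ortho_pw _ _) _; rewrite (negPf ab) !mul0r.
Qed.

Lemma lin_Pl_eq p (h : R) : p \in s -> lin Pl (fun r => (p == r)%:R * h) = (Num.sqrt p%:R)^-1 * h.
Proof.
move=> pI; rewrite lin_Pl (bigD1_seq p) //= eqxx mul1r big1 ?addr0 // => r /negPf rp.
by rewrite eq_sym rp mul0r mulr0.
Qed.

Lemma lin_Pl_diag K : {in s &, forall p r, K p r = (p == r)%:R} -> Q K (ppow 1) (ppow 1) = sg.
Proof.
move=> hK; rewrite /Q lin_pw1 lin_Pl; apply: eq_big_seq => p pI.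
rewrite lin_pw1 -sqr_isqrt; congr (_ * _); rewrite -[RHS]mulr1 -(lin_Pl_eq _ pI).
by apply: eq_lin => u /mapP[r rI ->] /=; rewrite hK // mulr1.
Qed.

Lemma ortho_quad k : Q eqk (quad k 0) (quad k 0) = 1 + k ^+ 2 * sg.
Proof.
rewrite Q_quad (_ : Q eqk (ppow 0) (ppow 0) = 1); last by rewrite /Q !lin_one.
by rewrite (@lin_Pl_diag eqk) // !mul0r !addr0 !ortho_pw_ne //; ring.
Qed.

(** Powers of different degree are orthogonal, so only 6! from P^6 and 7! from k P^7 remain, and 7!
    = 7 * 720. *)
Lemma ortho_quad6 k :
  Q eqk (lmul (ppow 6) (quad k 0)) (lmul (ppow 6) (quad k 0)) <= 720 * sg ^+ 6 * (1 + 7 * k ^+ 2 * sg).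
Proof.
have h F : lin (lmul (ppow 6) (quad k 0)) F = lin (ppow 6) F + k * lin (ppow 7) F.
  rewrite lin_mul (@eq_lin _ _ (fun m => F m + k * lin (ppow 1) (fun n => F (m * n)%N))) => [|u _]; last first.
    by rewrite lin_quad mul0r addr0 muln1.
  by rewrite linD linZ -(lin_mul (ppow 6) (ppow 1)) lin_pwD.
have -> : Q eqk (lmul (ppow 6) (quad k 0)) (lmul (ppow 6) (quad k 0)) =
   Q eqk (ppow 6) (ppow 6) + k * Q eqk (ppow 6) (ppow 7) + k * (Q eqk (ppow 7) (ppow 6) + k * Q eqk (ppow 7) (ppow 7)).
  have h' i : lin (ppow i) (fun m => lin (lmul (ppow 6) (quad k 0)) (eqk m)) =
      Q eqk (ppow i) (ppow 6) + k * Q eqk (ppow i) (ppow 7).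
    by rewrite /Q -linZ -linD; apply: eq_lin => u _; rewrite h.
  by rewrite {1}/Q h !h'.
rewrite [Q _ _ (ppow 7)]ortho_pw_ne // [Q _ (ppow 7) (ppow 6)]ortho_pw_ne // mulr0 addr0 add0r mulrA -expr2.
have := ortho_pw 6 6; have := ler_wpM2l (sqr_ge0 k) (ortho_pw 7 7); rewrite !eqxx !mul1r.
have -> : 7`!%:R = 5040 :> R by []. have -> : 6`!%:R = 720 :> R by [].
move: (Q _ _ _) (Q _ _ _) => x y hx hy; apply: le_trans (lerD hy hx) _.
by rewrite le_eqVlt; apply/orP; left; apply/eqP; ring.
Qed.

Lemma mulker_dk : mulker (dk R).
Proof.
split=> [|m n m' n' m0 n0 m'0 n'0]; first by rewrite /dk dvdnn divff ?mulr1 // sqrtr_eq0 -ltNge.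
rewrite coprimeMl !coprimeMr => /andP[/andP[c1 c2] /andP[c3 c4]].
rewrite /dk !natrM !sqrtrM // invfM.
have -> : (m * m' %| n * n')%N = (m %| n)%N && (m' %| n')%N.
  by rewrite Gauss_dvd // Gauss_dvdl // Gauss_dvdr // coprime_sym.
by rewrite -mulnb natrM; ring.
Qed.

Lemma sqrt_nat_neq0 (n : nat) : (0 < n)%N -> Num.sqrt (n%:R : R) != 0.
Proof. by move=> n0; rewrite sqrtr_eq0 -ltNge ltr0n. Qed.

(** [dk] requires the left index to divide the right one, which is 1 or a prime, and a product of
    two primes never does. With b = k - 1 the result is 1 + k^2 sigma^2, the same as for |B|^2. *)
Lemma dk_quad b c k : Q (dk R) (quad b c) (quad k 0) = 1 + k * (1 + b) * sg.
Proof.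
have e0 i j : {in ppow i & ppow j, forall u v, ~~ (u.2 %| v.2)%N} -> Q (dk R) (ppow i) (ppow j) = 0.
  move=> h; apply: lin_eq0 => u ui; apply: lin_eq0 => v vj; by rewrite /dk (negPf (h _ _ ui vj)) !mul0r.
have p1 u : u \in ppow 1 -> prime u.2.
  by case/allpairsPdep => x [y [/mapP[p pI ->]]]; rewrite inE => /eqP -> -> /=; rewrite muln1 ps.
have p2 u : u \in ppow 2 -> exists p r : nat, [/\ prime p, prime r & u.2 = (p * r)%N].
  by case/allpairsPdep => x [y [/mapP[p pI ->] /p1 py ->]]; exists p, y.2; rewrite ps.
have p0 u : u \in ppow 0 -> u.2 = 1%N by rewrite inE => /eqP ->.
have e10 : Q (dk R) (ppow 1) (ppow 0) = 0.
  by apply: e0 => u v /p1 pu /p0 ->; rewrite dvdn1 neq_ltn prime_gt1 ?orbT.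
have e20 : Q (dk R) (ppow 2) (ppow 0) = 0.
  apply: e0 => u v /p2[p [r [pp pr ->]]] /p0 ->; rewrite dvdn1 muln_eq1 negb_and.
  by rewrite neq_ltn prime_gt1 ?orbT.
have e21 : Q (dk R) (ppow 2) (ppow 1) = 0.
  apply: e0 => u v /p2[p [r [pp pr ->]]] /p1 pv; apply/negP => d.
  have pv1 : p = v.2 by apply/eqP; rewrite -dvdn_prime2 //; apply: dvdn_trans d; apply: dvdn_mulr.
  move: d; rewrite pv1 -{2}[v.2]muln1 dvdn_pmul2l ?prime_gt0 // dvdn1 => /eqP r1.
  by move: pr; rewrite r1.
have e00 : Q (dk R) (ppow 0) (ppow 0) = 1 by rewrite /Q !lin_one mulker_dk.1.
have e01 : Q (dk R) (ppow 0) (ppow 1) = sg.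
  rewrite /Q lin_one lin_pw1 lin_Pl; apply: eq_big_seq => p pI.
  by rewrite /dk dvd1n mul1r sqrtr1 mul1r sqr_isqrt.
have e11 : Q (dk R) (ppow 1) (ppow 1) = sg.
  apply: lin_Pl_diag => p r pI rI; rewrite /dk dvdn_prime2 ?ps //; case: eqP => [->|_]; rewrite ?mul0r //.
  by rewrite divff ?mulr1 // sqrt_nat_neq0 // prime_gt0 // ps.
by rewrite Q_quad e00 e01 e10 e20 e21 e11; ring.
Qed.

Lemma gcdn_coprimeM m n m' n' : (0 < m)%N -> (0 < m')%N -> coprime (m * n) (m' * n') ->
  gcdn (m * m') (n * n') = (gcdn m n * gcdn m' n')%N.
Proof.
move=> m0 m'0; rewrite coprimeMl !coprimeMr => /andP[/andP[c1 c2] /andP[c3 c4]].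
have [g0 g'0] : (0 < gcdn m n)%N /\ (0 < gcdn m' n')%N by rewrite !gcdn_gt0 m0 m'0.
have cop x y : (0 < gcdn x y)%N -> coprime (x %/ gcdn x y) (y %/ gcdn x y).
  by move=> h; rewrite /coprime -(eqn_pmul2r h) muln_gcdl !divnK ?dvdn_gcdl ?dvdn_gcdr ?mul1n.
have dl x y : (x %/ gcdn x y %| x)%N by apply/dvdnP; exists (gcdn x y); rewrite mulnC divnK ?dvdn_gcdl.
have dr x y : (y %/ gcdn x y %| y)%N by apply/dvdnP; exists (gcdn x y); rewrite mulnC divnK ?dvdn_gcdr.
have c : coprime (m %/ gcdn m n * (m' %/ gcdn m' n')) (n %/ gcdn m n * (n' %/ gcdn m' n')).
  rewrite coprimeMl !coprimeMr !cop //= andbT; apply/andP; split.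
    by apply: coprime_dvdl (dl _ _) _; apply: coprime_dvdr (dr _ _) _.
  by apply: coprime_dvdl (dl _ _) _; apply: coprime_dvdr (dr _ _) _; rewrite coprime_sym.
rewrite -{1}(divnK (dvdn_gcdl m n)) -{1}(divnK (dvdn_gcdl m' n')) -{3}(divnK (dvdn_gcdr m n)) -{3}(divnK (dvdn_gcdr m' n')).
by rewrite mulnACA [X in gcdn _ X]mulnACA -muln_gcdl (eqP c) mul1n.
Qed.

Lemma mulker_gk : mulker (gk R).
Proof.
split=> [|m n m' n' m0 n0 m'0 n'0 c]; first by rewrite /gk gcdn1 muln1 sqrtr1 divr1.
by rewrite /gk gcdn_coprimeM // mulnACA !natrM sqrtrM ?mulr_ge0 // invfM; ring.
Qed.

Lemma divn_gcd_gt0 m n : (0 < m)%N -> (0 < n)%N -> (0 < m %/ gcdn m n * (n %/ gcdn m n))%N.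
Proof.
move=> m0 n0; have g0 : (0 < gcdn m n)%N by rewrite gcdn_gt0 m0.
by rewrite muln_gt0 (divn_gt0 _ g0) (divn_gt0 _ g0) (dvdn_leq m0 (dvdn_gcdl _ _)) (dvdn_leq n0 (dvdn_gcdr _ _)).
Qed.

Lemma lgk_coprimeM m n m' n' : (0 < m)%N -> (0 < n)%N -> (0 < m')%N -> (0 < n')%N ->
  coprime (m * n) (m' * n') -> lgk R (m * m') (n * n') = lgk R m n + lgk R m' n'.
Proof.
move=> m0 n0 m'0 n'0 c; rewrite /lgk gcdn_coprimeM //.
have [g0 g'0] : (0 < gcdn m n)%N /\ (0 < gcdn m' n')%N by rewrite !gcdn_gt0 m0 m'0.
have d x y g g' : (0 < g)%N -> (0 < g')%N -> (g %| x)%N -> (g' %| y)%N ->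
    ((x * y) %/ (g * g') = x %/ g * (y %/ g'))%N.
  by move=> h h' gx gy; rewrite -{1}(divnK gx) -{1}(divnK gy) mulnACA mulnK // muln_gt0 h.
rewrite (d m m') ?dvdn_gcdl // (d n n') ?dvdn_gcdr // mulnACA natrM lnM // posrE ltr0n; exact: divn_gcd_gt0.
Qed.

Definition gkl m n : R := gk R m n * lgk R m n.

Lemma derker_gkl : derker (gk R) gkl.
Proof.
split=> [|m n m' n' m0 n0 m'0 n'0 c]; first by rewrite /gkl /lgk gcdn1 divn1 muln1 ln1 mulr0.
by rewrite /gkl mulker_gk.2 // lgk_coprimeM //; ring.
Qed.

(** If r does not divide M, the gcd is unchanged and r^(-1/2) comes out; if it does, r cancels from
    both arguments and the value is that at M/r. Allowing both terms at once gives one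
    inequality. *)
Lemma gk_rec (M N r : nat) : (0 < M)%N -> (0 < N)%N -> prime r ->
  gk R M (r * N)%N <= 1 * (Num.sqrt r%:R)^-1 * gk R M N + (logn r M)%:R * gk R (M %/ r)%N N.
Proof.
move=> M0 N0 pr; have r0 := prime_gt0 pr; have gk0 m n : 0 <= gk R m n by rewrite divr_ge0 ?sqrtr_ge0.
rewrite mul1r; case: (boolP (r %| M)%N) => [rM|rM].
  rewrite -[leLHS]add0r; apply: lerD; first by rewrite mulr_ge0 ?invr_ge0 ?sqrtr_ge0.
  have l1 : 1 <= (logn r M)%:R :> R by rewrite ler1n -pfactor_dvdn ?expn1.
  apply: le_trans (ler_peMl (gk0 _ _) l1).
  rewrite -{1}(divnK rM) /gk [(_ * r)%N in X in X <= _]mulnC -muln_gcdr mulnACA !natrM sqrtrM ?mulr_ge0 //.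
  by rewrite -expr2 sqrtr_sqr normr_nat -mulf_div divff ?mul1r ?natrM // pnatr_eq0 -lt0n.
rewrite lognE (negPf rM) !andbF mul0r addr0 /gk mulnC Gauss_gcdl; last first.
  by rewrite coprime_sym prime_coprime.
have -> : Num.sqrt (M * (N * r))%:R = Num.sqrt r%:R * Num.sqrt (M * N)%:R :> R.
  by rewrite mulnA mulnC natrM sqrtrM.
by rewrite invfM mulrCA.
Qed.

Lemma gk_pw0 a : Q (gk R) (ppow a) (ppow 0) = sg ^+ a.
Proof.
elim: a => [|a IH]; first by rewrite /Q !lin_one mulker_gk.1.
rewrite /Q lin_pwS exprS /sg mulr_suml lin_Pl; apply: eq_bigr => p _.
rewrite -sqr_isqrt -mulrA -IH /Q -linZ; congr (_ * _); apply: eq_lin => u _.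
rewrite !lin_one /gk !gcdn1 !muln1 natrM sqrtrM // invfM; ring.
Qed.

Lemma gk_sym U V : Q (gk R) U V = Q (gk R) V U.
Proof.
rewrite /Q lin_exch; apply: eq_lin => u _; apply: eq_lin => v _.
by rewrite /gk gcdnC mulnC.
Qed.

Lemma gk_pw_bounds : sg <= 1 -> [/\ sg <= Q (gk R) (ppow 1) (ppow 1) <= sg + sg ^+ 2,
  0 <= Q (gk R) (ppow 2) (ppow 1) <= 3 * sg ^+ 2 & 0 <= Q (gk R) (ppow 2) (ppow 2) <= 7 * sg ^+ 2].
Proof.
move=> s1; have s0 := sg_ge0.
have ge0 a b : 0 <= Q (gk R) (ppow a) (ppow b).
  apply: lin_ge0 => [|u _]; first exact: nneg_pw.
  by apply: lin_ge0 => [|v _]; [exact: nneg_pw | rewrite divr_ge0 ?sqrtr_ge0].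
have h11 : Q (gk R) (ppow 1) (ppow 1) <= sg + sg ^+ 2.
  by apply: le_trans (Q_pw_rec _ _ gk_rec) _; rewrite !gk_pw0 /= expr1 expr0; lra.
have h21 : Q (gk R) (ppow 2) (ppow 1) <= 3 * sg ^+ 2.
  apply: le_trans (Q_pw_rec _ _ gk_rec) _; rewrite !gk_pw0 /= expr1.
  have := mulr_ge0 (sqr_ge0 sg) (_ : 0 <= 1 - sg); rewrite subr_ge0 => /(_ s1); rewrite expr2; nra.
have h22 : Q (gk R) (ppow 2) (ppow 2) <= 7 * sg ^+ 2.
  apply: le_trans (Q_pw_rec _ _ gk_rec) _ => /=.
  have := ler_wpM2l s0 h11; have := ler_wpM2l s0 h21.
  have : sg ^+ 3 <= sg ^+ 2 by rewrite exprSr ler_piMr // sqr_ge0.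
  rewrite !expr2 !exprS expr0; lra.
split; rewrite ?ge0 ?h11 ?h21 ?h22 // andbT.
rewrite -[leLHS](@lin_Pl_diag eqk) //; apply: lin_le => [|u u1]; first exact: nneg_pw.
apply: lin_le => [|v _]; first exact: nneg_pw.
rewrite /eqk; case: eqP => [<-|_]; last by rewrite divr_ge0 ?sqrtr_ge0.
rewrite /gk gcdnn natrM -expr2 sqrtr_sqr normr_nat divff // pnatr_eq0 -lt0n.
exact: pw_gt0 u1.
Qed.

(** The coefficient of sigma^4 in the error of [gk_quad]: b^2 from P against P, 2|c| from 1 against
    P^2, and 6|b c|, 7 c^2 from the bounds 3 and 7 in [gk_pw_bounds]. *)
Definition qerr (b c : R) := b ^+ 2 + 2 * `|c| + 6 * `|b * c| + 7 * c ^+ 2.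

Lemma gk_quad b c : sg <= 1 ->
  `|Q (gk R) (quad b c) (quad b c) - (1 + (2 * b + b ^+ 2) * sg)| <= qerr b c * sg ^+ 2.
Proof.
move=> s1; have [h11 h21 h22] := gk_pw_bounds s1.
rewrite Q_quad [Q _ (ppow 0) (ppow 1)]gk_sym [Q _ (ppow 0) (ppow 2)]gk_sym [Q _ (ppow 1) (ppow 2)]gk_sym !gk_pw0.
rewrite expr0 expr1; move: h11 h21 h22.
move: (Q _ (ppow 1) (ppow 1)) (Q _ (ppow 2) (ppow 1)) (Q _ (ppow 2) (ppow 2)) => x y z hx hy hz.
have -> : 1 + b * sg + c * sg ^+ 2 + b * (sg + b * x + c * y) + c * (sg ^+ 2 + b * y + c * z) -
   (1 + (2 * b + b ^+ 2) * sg) = b ^+ 2 * (x - sg) + c * (2 * sg ^+ 2) + (b * c) * (2 * y) + c ^+ 2 * z by ring.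
have aux (u v w : R) : 0 <= v -> v <= w -> `|u * v| <= `|u| * w.
  by move=> v0 vw; rewrite normrM (ger0_norm v0) ler_wpM2l.
have := aux (b ^+ 2) (x - sg) (sg ^+ 2); have := aux c (2 * sg ^+ 2) (2 * sg ^+ 2).
have := aux (b * c) (2 * y) (6 * sg ^+ 2); have := aux (c ^+ 2) z (7 * sg ^+ 2).
have b2 : `|b ^+ 2| = b ^+ 2 by rewrite ger0_norm ?sqr_ge0.
have c2 : `|c ^+ 2| = c ^+ 2 by rewrite ger0_norm ?sqr_ge0.
have s2 := sqr_ge0 sg.
rewrite b2 c2 /qerr => a1 a2 a3 a4.
apply: le_trans (ler_normD _ _) _; apply: le_trans (lerD (ler_normD _ _) (lexx _)) _.
apply: le_trans (lerD (lerD (ler_normD _ _) (lexx _)) (lexx _)) _.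
have {}a1 : `|c ^+ 2 * z| <= c ^+ 2 * (7 * sg ^+ 2) by case/andP: hz; apply: a1.
have {}a2 : `|b * c * (2 * y)| <= `|b * c| * (6 * sg ^+ 2) by apply: a2; lra.
have {}a3 : `|c * (2 * sg ^+ 2)| <= `|c| * (2 * sg ^+ 2) by apply: a3 => //; rewrite mulr_ge0.
have {}a4 : `|b ^+ 2 * (x - sg)| <= b ^+ 2 * sg ^+ 2 by apply: a4; lra.
apply: le_trans (lerD (lerD (lerD a4 a3) a2) a1) _.
by rewrite le_eqVlt; apply/orP; left; apply/eqP; ring.
Qed.

Variable T : nat.
Hypothesis sT : {in s, forall p, (p <= T)%N}.

Lemma size_sT : (size s <= T)%N.
Proof.
have h : {subset s <= iota 1 T} by move=> p pI; rewrite mem_iota add1n ltnS (sT pI) prime_gt0 // ps.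
by have := uniq_leq_size us h; rewrite size_iota.
Qed.

Lemma pw_le a u : u \in ppow a -> (u.2 <= T ^ a)%N.
Proof.
elim: a u => [|a IH] u; first by rewrite inE => /eqP ->.
by case/allpairsPdep => x [y [/mapP[p pI ->] ya ->]]; rewrite /= expnS leq_mul ?sT ?IH.
Qed.

Lemma quad_le b c u : (0 < T)%N -> u \in quad b c -> (u.2 <= T ^ 2)%N.
Proof.
move=> T0; rewrite !mem_cat inE => /orP[/eqP -> /=|/orP[/mapP[v vw ->]|/mapP[v vw ->]]] /=.
- by rewrite expn_gt0 T0.
- by apply: leq_trans (pw_le vw) _; rewrite leq_pexp2l.
- exact: pw_le vw.
Qed.

(** The weights p^(-1/2) are at most 1 and there are at most T primes; the coefficients cost one
    more factor T. *)
Lemma l1_quad b c : 1 + `|b| + `|c| <= T%:R -> l1 (quad b c) <= T%:R ^+ 3.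
Proof.
move=> hT; have lw a : l1 (ppow a) = l1 Pl ^+ a.
  by elim: a => [|a IH]; rewrite ?l1_one ?expr0 // exprS -IH -l1_mul.
have lP : l1 Pl <= T%:R.
  rewrite /l1 big_map; apply: (@le_trans _ _ (size s)%:R); last by rewrite ler_nat size_sT.
  rewrite -sum1_size natr_sum !big_seq; apply: ler_sum => p pI /=.
  have p1 : 1 <= Num.sqrt (p%:R : R) by rewrite -[leLHS]sqrtr1 ler_wsqrtr // ler1n prime_gt0 // ps.
  by rewrite ger0_norm ?invr_ge0 ?sqrtr_ge0 // invf_le1 // (lt_le_trans ltr01).
have P0 : 0 <= l1 Pl by rewrite /l1 sumr_ge0.
have T1 : 1 <= T%:R :> R by apply: le_trans hT; rewrite -addrA lerDl addr_ge0.
have P2 : l1 Pl ^+ 2 <= T%:R ^+ 2 by rewrite lerXn2r ?nnegrE.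
have T2 : T%:R <= T%:R ^+ 2 :> R by rewrite expr2 ler_peMl.
rewrite !l1_cat !l1_sc l1_one !lw expr1 exprS.
apply: le_trans (_ : (1 + `|b| + `|c|) * T%:R ^+ 2 <= _); last by rewrite ler_wpM2r ?sqr_ge0.
rewrite -addrA !mulrDl !mul1r; apply: lerD; first by rewrite exprn_ege1.
by apply: lerD; rewrite ler_wpM2l // (le_trans lP).
Qed.

Lemma absl_quad b c : absl (quad b c) = quad `|b| `|c|.
Proof.
have aw a : absl (ppow a) = ppow a.
  rewrite /absl -[RHS]map_id; apply/eq_in_map => -[x n] /nneg_pw /= x0.
  by rewrite ger0_norm.
have asc d U : absl (sc d U) = sc `|d| (absl U).
  by rewrite /absl /sc -!map_comp; apply: eq_map => u /=; rewrite normrM.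
rewrite /quad /absl !map_cat -!/(absl _) !asc !aw /absl /= normr1 //.
Qed.

Lemma lgk_le (m n : nat) : (0 < m)%N -> (0 < n)%N -> 0 <= lgk R m n <= ln (m * n)%:R.
Proof.
move=> m0 n0; have p := divn_gcd_gt0 m0 n0.
apply/andP; split; first by rewrite ln_ge0 // ler1n.
by rewrite ler_ln ?posrE ?ltr0n // ?muln_gt0 ?m0 // ler_nat leq_mul // leq_div.
Qed.

(** All indices are at most T^2, so the logarithm in the kernel is at most 4 ln T; what remains is
    the gcd form with the absolute values of the coefficients. *)
Lemma gkl_quad b c : (0 < T)%N -> sg <= 1 ->
  `|Q gkl (quad b c) (quad b c)| <=
    4 * ln T%:R * (1 + (2 * `|b| + b ^+ 2) * sg + qerr b c * sg ^+ 2).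
Proof.
move=> T0 s1; apply: le_trans (norm_Q _ _ _) _; rewrite absl_quad.
have lT : 0 <= ln (T%:R : R) by rewrite ln_ge0 // ler1n.
have nq : nneg (quad `|b| `|c|).
  move=> u; rewrite !mem_cat inE => /orP[/eqP -> //=|/orP[/mapP[v vw ->]|/mapP[v vw ->]]] /=;
    by rewrite mulr_ge0 // (nneg_pw vw).
have q0 u : u \in quad `|b| `|c| -> (0 < u.2)%N by apply: supp_gt0; apply: supp_quad.
apply: (@le_trans _ _ (4 * ln T%:R * Q (gk R) (quad `|b| `|c|) (quad `|b| `|c|))).
  rewrite /Q -linZ; apply: lin_le => // u uq; rewrite -linZ; apply: lin_le => // v vq.
  have [u0 v0] := (q0 _ uq, q0 _ vq); have /andP[l0 l1] := lgk_le u0 v0.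
  have g0 : 0 <= gk R u.2 v.2 by rewrite divr_ge0 ?sqrtr_ge0.
  rewrite /gkl normrM !ger0_norm // mulrC ler_wpM2r //; apply: le_trans l1 _.
  have -> : 4 * ln T%:R = ln (T ^ 4)%:R :> R by rewrite natrX lnXn ?ltr0n // -[RHS]mulr_natl.
  rewrite ler_ln ?posrE ?ltr0n ?muln_gt0 ?u0 ?expn_gt0 ?T0 // ler_nat.
  by rewrite (expnD T 2 2) leq_mul // (quad_le T0 uq, quad_le T0 vq).
rewrite ler_wpM2l ?mulr_ge0 //; have := gk_quad `|b| `|c| s1.
have e (x : R) : `|x| ^+ 2 = x ^+ 2 by rewrite real_normK ?num_real.
rewrite ler_norml => /andP[_]; rewrite /qerr (normrM `|b|) (normrM b) !normr_id !e; lra.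
Qed.

End Powers.

Section Evaluation.
Variable chi : nat -> R[i].
Hypotheses (chi1 : chi 1%N = 1) (chiM : forall m n, chi (m * n)%N = chi m * chi n).

Definition ev U : R[i] := \sum_(u <- U) (u.1)%:C * chi u.2.

Lemma ev_one : ev one = 1.
Proof. by rewrite /ev big_seq1 chi1 mulr1. Qed.

Lemma ev_cat U V : ev (U ++ V) = ev U + ev V.
Proof. exact: big_cat. Qed.

Lemma ev_sc c U : ev (sc c U) = c%:C * ev U.
Proof.
by rewrite /ev big_map mulr_sumr; apply: eq_bigr => u _; rewrite rmorphM mulrA.
Qed.

Lemma ev_mul U V : ev (lmul U V) = ev U * ev V.
Proof.
rewrite /ev big_allpairs_dep mulr_suml; apply: eq_bigr => u _; rewrite mulr_sumr.
by apply: eq_bigr => v _ /=; rewrite rmorphM chiM mulrACA.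
Qed.

Lemma ev_pw s a : ev (ppow s a) = ev (Pl s) ^+ a.
Proof. by elim: a => [|a IH]; rewrite ?ev_one // ev_mul IH exprS. Qed.

Lemma ev_quad s b c : ev (quad s b c) = 1 + (b%:C * ev (Pl s) + c%:C * ev (Pl s) ^+ 2).
Proof. by rewrite !ev_cat !ev_sc ev_one !ev_pw expr1. Qed.

Lemma ev_pr (G : eqType) (X : G -> seq (R * nat)) gs : ev (pr X gs) = \prod_(g <- gs) ev (X g).
Proof. by elim: gs => [|g gs IH]; rewrite ?big_nil ?ev_one //= big_cons ev_mul IH. Qed.

End Evaluation.

Lemma ev_form n (w : nat -> R[i]) (chi : nat -> nat -> R[i]) (T : nat -> nat -> R) U V :
  {in U & V, forall u v, \sum_(j < n) w j * (chi j u.2 * conjc (chi j v.2)) = (T u.2 v.2)%:C} ->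
  \sum_(j < n) w j * (ev (chi j) U * conjc (ev (chi j) V)) = (Q T U V)%:C.
Proof.
move=> h; rewrite /Q /lin rmorph_sum /=.
under [RHS]eq_big_seq => u uU.
  rewrite rmorphM rmorph_sum /= mulr_sumr.
  under eq_big_seq => v vV do rewrite rmorphM /= -(h _ _ uU vV) !mulr_sumr.
  over.
under eq_bigr => j _.
  rewrite /ev mulr_suml mulr_sumr; under eq_bigr => u _ do rewrite rmorph_sum /= !mulr_sumr.
  over.
rewrite exchange_big; apply: eq_bigr => u _; rewrite exchange_big; apply: eq_bigr => v _.
apply: eq_bigr => j _; rewrite conjcM conjc_real; ring.
Qed.

End Formal.

(** * Moments twisted by the models *)

Section Moments.
Variables (R : realType) (q : nat).
Hypothesis pq : prime q.
Local Notation n := q.-1.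
Local Notation normc := (@Normc.normc R).
Local Notation cn j := (fun m : nat => chi R q j (Posz m)).
Local Notation Lam := (Lam R q).

Let q0 : (0 < q)%N. Proof. exact: prime_gt0. Qed.
Let qR : 0 < q%:R :> R. Proof. by rewrite ltr0n. Qed.
Let sq0 : 0 < Num.sqrt q%:R :> R. Proof. by rewrite sqrtr_gt0. Qed.
Let n0 : 0 <= n%:R :> R. Proof. by []. Qed.
Let sqq : Num.sqrt q%:R <= q%:R :> R.
Proof.
have e : q%:R = Num.sqrt q%:R * Num.sqrt q%:R :> R by rewrite -expr2 sqr_sqrtr ?ltW.
by rewrite [leRHS]e ler_peMl ?(ltW sq0) // -[leLHS]sqrtr1 ler_wsqrtr // ler1n.
Qed.

Lemma coprime_lt m : (0 < m)%N -> (m < q)%N -> coprime m q.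
Proof. by move=> m0 mq; rewrite coprime_sym prime_coprime // gtnNdvd. Qed.

Lemma mean_ortho m k : (0 < m)%N -> (m < q)%N -> (k < q)%N ->
  \sum_(j < n) 1 * (cn j m * conjc (cn j k)) = (n%:R * eqk R m k)%:C.
Proof.
move=> m0 mq kq; under eq_bigr do rewrite mul1r.
by rewrite chi_orth // gtnNdvd // !modn_small // mulrC.
Qed.

Lemma mod_solve m k : (0 < m)%N -> coprime m q -> exists b, b * m = k %[mod q].
Proof.
move=> m0 /(coprimeP _ m0)[[u v] /= e]; exists (u * k)%N.
have e' : (u * m = 1 + v * q)%N by lia.
by rewrite mulnAC e' mulnDl mul1n mulnAC addnC modnMDl.
Qed.

(** For the arguments in [mean1P] the sum is real by [mean_Lam]; [complex.Re] only gives the kernel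
    the real type that [Q] demands. *)
Definition mean1 m k := complex.Re (\sum_(j < n) Lam j * (cn j m * conjc (cn j k))).

Lemma mean1P m k : (0 < m)%N -> (m < q)%N -> (0 < k)%N -> (k < q)%N ->
  \sum_(j < n) Lam j * (cn j m * conjc (cn j k)) = (mean1 m k)%:C /\
  `|mean1 m k - n%:R * dk R m k| <= n%:R * (4 * m%:R / Num.sqrt q%:R).
Proof.
move=> m0 mq k0 kq; have cm := coprime_lt m0 mq; have ck := coprime_lt k0 kq.
have [b e] := mod_solve k m0 cm; have h := mean_Lam R pq cm ck e.
rewrite /mean1 h; split=> //=; rewrite -mulrBr normrM ger0_norm // ler_wpM2l //.
exact: first_moment_term.
Qed.

Definition mean2 m k := n%:R * (SS R q m k - q%:R^-1 * hF R q 0 ^+ 2).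

Lemma mean2P m k : (0 < m)%N -> (m < q)%N -> (0 < k)%N -> (k < q)%N ->
  \sum_(j < n) (Lam j * conjc (Lam j)) * (cn j m * conjc (cn j k)) = (mean2 m k)%:C /\
  `|mean2 m k - n%:R * (SS R q 1 1 * gk R m k - gkl R m k)| <=
    n%:R * ((125 * (m * k)%:R ^+ 2 + 4) / Num.sqrt q%:R).
Proof.
move=> m0 mq k0 kq; have cm := coprime_lt m0 mq; have ck := coprime_lt k0 kq.
split; first exact: mean_Lam2.
rewrite /mean2 -mulrBr normrM ger0_norm // ler_wpM2l //.
have h := SS_second R m k q m0 k0 q0 cm ck.
have hF0 : 0 <= q%:R^-1 * hF R q 0 ^+ 2 <= 4 / Num.sqrt q%:R.
  rewrite mulr_ge0 ?invr_ge0 ?sqr_ge0 // mulrC; apply: ler_pM; rewrite ?invr_ge0 ?sqr_ge0 //.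
    have -> : hF R q 0 = hz R 1.
      by rewrite /hF (rep_unique q 0 q) ?modnn ?mod0n // divff // pnatr_eq0 -lt0n.
    by have /andP[] := hz1_1 R; nra.
  by rewrite lef_pV2 ?posrE.
have -> : SS R q m k - q%:R^-1 * hF R q 0 ^+ 2 - (SS R q 1 1 * gk R m k - gkl R m k) =
  (SS R q m k - gk R m k * (SS R q 1 1 - lgk R m k)) - q%:R^-1 * hF R q 0 ^+ 2 by rewrite /gkl; ring.
apply: le_trans (ler_normB _ _) _; rewrite mulrDl; apply: lerD => //.
by case/andP: hF0 => a b; rewrite ger0_norm.
Qed.

Lemma SS11_ge0 : 0 <= SS R q 1 1.
Proof. by rewrite mulr_ge0 ?invr_ge0 // sumr_ge0 // => t _; rewrite -expr2 sqr_ge0. Qed.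

Variables (G : eqType) (gs : seq G) (s : G -> seq nat) (T : G -> nat) (k : R).
Hypotheses (ugs : uniq gs) (us : uniq (flatten [seq s g | g <- gs])).
Hypothesis sP : {in gs, forall g, {in s g, forall p, prime p && (p <= T g)%N}}.
Local Notation be := (k - 1).
Local Notation sg g := (sg R (s g)).
Hypothesis T1 : {in gs, forall g, 1 + `|be| + `|- (be / 2)| <= (T g)%:R /\ 1 + `|k| <= (T g)%:R}.
Hypothesis sg1 : {in gs, forall g, sg g <= 1 /\
  (2 * `|be| + be ^+ 2) * sg g + qerr be (- (be / 2)) * sg g ^+ 2 <= 2^-1}.
Variable Pi : nat.
Hypothesis PiE : Pi = (\prod_(g <- gs) T g)%N.
Hypothesis hPi : 129 * Pi%:R ^+ 14 <= Num.sqrt (q%:R : R).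

Definition Ag g := quad (s g) be (- (be / 2)).
Definition Bg g := quad (s g) k 0.
Definition Aj j := ev (cn j) (pr Ag gs).
Definition Bj j := ev (cn j) (pr Bg gs).
Definition Pj g j := ev (cn j) (Pl R (s g)).
Definition WW := \prod_(g <- gs) (1 + k ^+ 2 * sg g).
(** A bound for the gcd form of A: k^2 - 1 is 2 b + b^2 for b = k - 1, see [gk_quad]. *)
Definition MM := \prod_(g <- gs) (1 + (k ^+ 2 - 1) * sg g + qerr be (- (be / 2)) * sg g ^+ 2).

Lemma sub_uniq_flatten (l : seq G) : uniq (flatten [seq s g | g <- l]) -> {in l, forall g, uniq (s g)}.
Proof.
elim: l => // g l IH /=; rewrite cat_uniq => /and3P[h1 _ h2] g'; rewrite inE => /predU1P[->//|].
exact: IH.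
Qed.

Let usg g : g \in gs -> uniq (s g).
Proof. exact: sub_uniq_flatten us g. Qed.

Let psg g : g \in gs -> {in s g, forall p, prime p}.
Proof. by move=> gg p ps; have /andP[] := sP gg ps. Qed.

Let sT g : g \in gs -> {in s g, forall p, (p <= T g)%N}.
Proof. by move=> gg p ps; have /andP[] := sP gg ps. Qed.

Let T0 g : g \in gs -> (0 < T g)%N.
Proof. by move=> gg; rewrite -(ltr0n R); have [_] := T1 gg; apply: lt_le_trans; rewrite ltr_pwDl. Qed.

Let Pi0 : (0 < Pi)%N.
Proof. by rewrite PiE big_seq; elim/big_ind: _ => // x y; rewrite muln_gt0 => ->. Qed.

Let Pi1 : 1 <= Pi%:R :> R. Proof. by rewrite ler1n. Qed.

Let Pi_lt a : (a <= 14)%N -> (Pi ^ a < q)%N.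
Proof.
move=> a14; rewrite -(ltr_nat R).
have h : Pi%:R ^+ a <= Pi%:R ^+ 14 :> R by rewrite ler_weXn2l.
have P0 : 0 < Pi%:R ^+ 14 :> R by rewrite exprn_gt0 // ltr0n.
rewrite natrX; apply: le_lt_trans h _; apply: lt_le_trans sqq; apply: lt_le_trans hPi.
by rewrite ltr_pMl // ltr1n.
Qed.

Lemma prod_T a : (\prod_(g <- gs) T g ^ a = Pi ^ a)%N.
Proof. by rewrite PiE; elim/big_rec2: _ => [|g x y _ ->]; rewrite ?exp1n // expnMn. Qed.

Lemma pr_bound X a : (0 < a)%N -> {in gs, forall g, supp (s g) (X g)} ->
  {in gs, forall g, {in X g, forall u, (u.2 <= T g ^ a)%N}} ->
  {in pr X gs, forall u : R * nat, (0 < u.2)%N /\ (u.2 <= Pi ^ a)%N}.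
Proof.
move=> a0 hs h u uX; rewrite -prod_T; split; first exact: supp_gt0 (supp_pr hs) uX.
exact: (@pr_le R G X gs (fun g => (T g ^ a)%N) h u uX).
Qed.

Let sA : {in gs, forall g, supp (s g) (Ag g)}.
Proof. by move=> g gg; apply: supp_quad; apply: psg. Qed.
Let sB : {in gs, forall g, supp (s g) (Bg g)}.
Proof. by move=> g gg; apply: supp_quad; apply: psg. Qed.

Let boundA : {in pr Ag gs, forall u : R * nat, (0 < u.2)%N /\ (u.2 <= Pi ^ 2)%N}.
Proof. by apply: pr_bound => // g gg u; apply: quad_le; [apply: sT | apply: T0]. Qed.
Let boundB : {in pr Bg gs, forall u : R * nat, (0 < u.2)%N /\ (u.2 <= Pi ^ 2)%N}.
Proof. by apply: pr_bound => // g gg u; apply: quad_le; [apply: sT | apply: T0]. Qed.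

Let prod_T3 X : {in gs, forall g, l1 (X g) <= (T g)%:R ^+ 3} -> l1 (pr X gs) <= Pi%:R ^+ 3 :> R.
Proof.
move=> h; rewrite l1_pr -natrX -prod_T natr_prod !big_seq; apply: ler_prod => g gg.
by rewrite natrX h // andbT /l1 sumr_ge0.
Qed.

Let l1A : l1 (pr Ag gs) <= Pi%:R ^+ 3 :> R.
Proof.
apply: prod_T3 => g gg; apply: l1_quad; [exact: usg|exact: psg|exact: sT|]; exact: (T1 gg).1.
Qed.
Let l1B : l1 (pr Bg gs) <= Pi%:R ^+ 3 :> R.
Proof.
apply: prod_T3 => g gg; apply: l1_quad; [exact: usg|exact: psg|exact: sT|].
by rewrite normr0 addr0; exact: (T1 gg).2.
Qed.

Let l1_ge0 U : 0 <= @l1 R U. Proof. by rewrite /l1 sumr_ge0. Qed.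

Let sg0 g : 0 <= sg g. Proof. exact: sg_ge0. Qed.

Lemma WW_ge1 : 1 <= WW.
Proof.
rewrite /WW; elim: gs => [|g l IH]; first by rewrite big_nil.
by rewrite big_cons -[leLHS]mul1r ler_pM // lerDl mulr_ge0 ?sqr_ge0.
Qed.

Lemma normc_sqr_ev (w : nat -> R[i]) (t : nat -> R) U (K : nat -> nat -> R) :
  (forall j, w j = (t j)%:C) ->
  {in U & U, forall u v, \sum_(j < n) w j * (cn j u.2 * conjc (cn j v.2)) = (K u.2 v.2)%:C} ->
  \sum_(j < n) t j * normc (ev (cn j) U) ^+ 2 = Q K U U.
Proof.
move=> wt h; have := ev_form (chi := fun j => cn j) h.
under eq_bigr do rewrite mul_conjc wt -rmorphM /=.
by rewrite -rmorph_sum /= => -[].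
Qed.

Lemma QZ c K U V : Q (fun m n => c * K m n) U V = c * Q K U V :> R.
Proof. by rewrite /Q -linZ; apply: eq_lin => u _; rewrite linZ. Qed.

Lemma QB c K K' U V : Q (fun m n => c * K m n - K' m n) U V = c * Q K U V - Q K' U V :> R.
Proof.
have e X F F' : lin X (fun n => c * F n - F' n) = c * lin X F - lin X F' :> R.
  by rewrite /lin mulr_sumr -sumrB; apply: eq_bigr => v _; ring.
by rewrite /Q -e; apply: eq_lin => u _; apply: e.
Qed.

Lemma qerr_ge0 (b c : R) : 0 <= qerr b c.
Proof.
have h (x y : R) : 0 <= x -> 0 <= y -> 0 <= x * y by apply: mulr_ge0.
by rewrite /qerr; apply: addr_ge0; [apply: addr_ge0; [apply: addr_ge0; [exact: sqr_ge0 | exact: h]|exact: h]|apply: h => //; exact: sqr_ge0].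
Qed.

Lemma moment_B : \sum_(j < n) normc (Bj j) ^+ 2 = n%:R * WW.
Proof.
have h := @normc_sqr_ev (fun=> 1) (fun=> 1) (pr Bg gs) (fun m k => n%:R * eqk R m k).
have -> : \sum_(j < n) normc (Bj j) ^+ 2 = \sum_(j < n) 1 * normc (ev (cn j) (pr Bg gs)) ^+ 2.
  by apply: eq_bigr => j _; rewrite mul1r.
rewrite h // => [|u v uB vB]; last first.
  have [u1 u2] := boundB uB; have [v1 v2] := boundB vB.
  by apply: mean_ortho; rewrite // (leq_ltn_trans _ (@Pi_lt 2 isT)).
rewrite QZ (Q_pr (s := s)) //; last exact: mulker_ortho.
congr (_ * _); apply: eq_big_seq => g gg; apply: ortho_quad; [exact: usg|exact: psg].
Qed.

Lemma moment_AB : 3 / 4 * (n%:R * WW) <= \sum_(j < n) normc (Lam j * Aj j) * normc (Bj j).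
Proof.
have lt2 u : (u <= Pi ^ 2 -> u < q)%N by move=> h; rewrite (leq_ltn_trans h (@Pi_lt 2 isT)).
have h := @ev_form R n (fun j => Lam j) (fun j => cn j) mean1 (pr Ag gs) (pr Bg gs).
have {}h : \sum_(j < n) Lam j * (Aj j * conjc (Bj j)) = (Q mean1 (pr Ag gs) (pr Bg gs))%:C.
  apply: h => u v uA vB; have [u1 u2] := boundA uA; have [v1 v2] := boundB vB.
  by apply: (mean1P _ _ _ _).1; rewrite ?lt2.
have e : Q (fun m k => n%:R * dk R m k) (pr Ag gs) (pr Bg gs) = n%:R * WW.
  rewrite QZ (Q_pr (s := s)) //; last exact: mulker_dk.
  congr (_ * _); apply: eq_big_seq => g gg; rewrite dk_quad; [|exact: usg|exact: psg].
  by have -> : 1 + be = k by [ring]; rewrite expr2.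
(* Error budget: 4 Pi^2/sqrt q for each pair, times two l1 norms of at most Pi^3, is at most 1/4 by
   [hPi]. This leaves 3/4 of the main term. *)
have := @Q_diff R mean1 (fun m k => n%:R * dk R m k) (pr Ag gs) (pr Bg gs) (n%:R * (4 * (Pi ^ 2)%:R / Num.sqrt q%:R)).
rewrite e => /(_ _); have a : n%:R * (4 * (Pi ^ 2)%:R / Num.sqrt q%:R) * (l1 (pr Ag gs) * l1 (pr Bg gs)) <= 4^-1 * (n%:R * WW).
  apply: (@le_trans _ _ (n%:R * (4 * Pi%:R ^+ 8 / Num.sqrt q%:R))).
    rewrite -mulrA ler_wpM2l // (_ : 4 * Pi%:R ^+ 8 / Num.sqrt q%:R =
      4 * (Pi ^ 2)%:R / Num.sqrt q%:R * (Pi%:R ^+ 3 * Pi%:R ^+ 3)); last by rewrite natrX; ring.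
    by rewrite ler_wpM2l ?divr_ge0 ?mulr_ge0 ?sqrtr_ge0 // ler_pM.
  rewrite [leRHS]mulrCA ler_wpM2l //; apply: (@le_trans _ _ 4^-1); last by rewrite ler_peMr // WW_ge1.
  have P0 : 0 <= Pi%:R ^+ 14 :> R by rewrite exprn_ge0.
  rewrite ler_pdivrMr //; apply: (@le_trans _ _ (4 * Pi%:R ^+ 14)); last first.
    have -> : 4 * Pi%:R ^+ 14 = 4^-1 * (16 * Pi%:R ^+ 14) :> R by field.
    rewrite ler_wpM2l //; apply: le_trans hPi; apply: ler_wpM2r => //.
    exact: (ler_nat R 16 129).
  by rewrite ler_wpM2l // ler_weXn2l.
move=> /(_ _)/le_trans/(_ a) {}a.
have : `|Q mean1 (pr Ag gs) (pr Bg gs) - n%:R * WW| <= 4^-1 * (n%:R * WW).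
  apply: a => u v uA vB; have [u1 u2] := boundA uA; have [v1 v2] := boundB vB.
  apply: le_trans (mean1P _ _ _ _).2 _; rewrite ?lt2 // ler_wpM2l // ler_wpM2r ?invr_ge0 ?sqrtr_ge0 //.
  by rewrite ler_wpM2l // ler_nat.
rewrite ler_norml => /andP[b _].
apply: (@le_trans _ _ (normc (\sum_(j < n) Lam j * (Aj j * conjc (Bj j))))); last first.
  apply: le_trans (ler_normc_sum _ _ _) _; apply: ler_sum => j _.
  by rewrite mulrA Normc.normcM normc_conj.
rewrite h normc_real; apply: le_trans (ler_norm _); lra.
Qed.

(** [SS R q 1 1] is at most ln q + 5 and multiplies the gcd form; the logarithmic kernel adds 12
    sum_g ln T_g <= 12 ln q; the errors of all pairs together contribute at most 1. *)
Lemma moment_LA : \sum_(j < n) normc (Lam j * Aj j) ^+ 2 <= n%:R * ((13 * ln q%:R + 5) * MM + 1).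
Proof.
have lt2 u : (u <= Pi ^ 2 -> u < q)%N by move=> h; rewrite (leq_ltn_trans h (@Pi_lt 2 isT)).
set K := fun m k => n%:R * (SS R q 1 1 * gk R m k - gkl R m k).
have h : \sum_(j < n) normc (Lam j) ^+ 2 * normc (Aj j) ^+ 2 = Q mean2 (pr Ag gs) (pr Ag gs).
  apply: (@normc_sqr_ev (fun j => Lam j * conjc (Lam j)) (fun j => normc (Lam j) ^+ 2)) => [j|u v uA vA]; first exact: mul_conjc.
  have [u1 u2] := boundA uA; have [v1 v2] := boundA vA.
  by apply: (mean2P _ _ _ _).1; rewrite ?lt2.
under eq_bigr do rewrite Normc.normcM exprMn.
rewrite {}h.
have d : `|Q mean2 (pr Ag gs) (pr Ag gs) - Q K (pr Ag gs) (pr Ag gs)| <= n%:R.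
  (* 129 = 125 + 4 and (m n)^2 <= Pi^8; the two l1 norms supply Pi^6, whence the exponent 14 in
     [hPi]. *)
  apply: le_trans (@Q_diff R mean2 K _ _ (n%:R * (129 * Pi%:R ^+ 8 / Num.sqrt q%:R)) _) _.
    move=> u v uA vA; have [u1 u2] := boundA uA; have [v1 v2] := boundA vA.
    apply: le_trans (mean2P _ _ _ _).2 _; rewrite ?lt2 // ler_wpM2l // ler_wpM2r ?invr_ge0 ?sqrtr_ge0 //.
    have : (u.2 * v.2)%:R ^+ 2 <= Pi%:R ^+ 8 :> R.
      by rewrite -!natrX ler_nat (expnM _ 4 2) leq_exp2r // (expnD _ 2 2) leq_mul.
    have : 1 <= Pi%:R ^+ 8 :> R by rewrite exprn_ege1.
    lra.
  rewrite -[leLHS]mulrA ler_piMr // mulrAC ler_pdivrMr // mul1r.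
  apply: le_trans hPi; rewrite -mulrA ler_wpM2l // (_ : Pi%:R ^+ 14 = Pi%:R ^+ 8 * (Pi%:R ^+ 3 * Pi%:R ^+ 3)); last by ring.
  by rewrite ler_wpM2l ?exprn_ge0 // ler_pM.
have K_E : Q K (pr Ag gs) (pr Ag gs) = n%:R * (SS R q 1 1 * Q (gk R) (pr Ag gs) (pr Ag gs) - Q (gkl R) (pr Ag gs) (pr Ag gs)).
  by rewrite QZ QB.
have Mb g : g \in gs -> [/\ `|Q (gk R) (Ag g) (Ag g)| <= 1 + (k ^+ 2 - 1) * sg g + qerr be (- (be / 2)) * sg g ^+ 2,
   `|Q (gkl R) (Ag g) (Ag g)| <= 12 * ln (T g)%:R * (1 + (k ^+ 2 - 1) * sg g + qerr be (- (be / 2)) * sg g ^+ 2) &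
   0 <= 12 * ln (T g)%:R :> R].
  move=> gg; have [g1 g2] := sg1 gg.
  have lT : 0 <= ln ((T g)%:R : R) by rewrite ln_ge0 // ler1n T0.
  have k1 : k ^+ 2 - 1 = 2 * be + be ^+ 2 by ring.
  have b1 := gk_quad (usg gg) (psg gg) be (- (be / 2)) g1; rewrite -k1 in b1.
  have b2 := gkl_quad (usg gg) (psg gg) (sT gg) be (- (be / 2)) (T0 gg) g1.
  have e0 : 0 <= qerr be (- (be / 2)) * sg g ^+ 2.
    by apply: mulr_ge0; [exact: qerr_ge0 | exact: sqr_ge0].
  have be0 : - (2 * `|be| + be ^+ 2) * sg g <= (k ^+ 2 - 1) * sg g.
    by rewrite ler_wpM2r // k1; have := ler_norm (- be); have := sqr_ge0 be; rewrite normrN; lra.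
  (* The absolute form in [gkl_quad] is at most 3/2 and [M] at least 1/2 by [sg1]; the ratio 3 turns
     4 ln T into 12 ln T. *)
  set M := 1 + _ + _; have M2 : 2^-1 <= M by rewrite /M; lra.
  split.
  - move: b1; rewrite !ler_norml => /andP[c1 c2]; rewrite /M; apply/andP; split; lra.
  - apply: le_trans b2 _; rewrite -mulrA -[leRHS]mulrA; move: (ln _) lT => l l0; nra.
  - by rewrite mulr_ge0.
have MM_ge : `|Q (gk R) (pr Ag gs) (pr Ag gs)| <= MM.
  rewrite (Q_pr (s := s)) //; last exact: mulker_gk.
  by rewrite normr_prod /MM !big_seq; apply: ler_prod => g gg; rewrite normr_ge0; case: (Mb g gg).
have MM0 : 0 <= MM by apply: le_trans MM_ge.
have L := Q_pr_der (mulker_gk R) (derker_gkl R) us sA sA Mb.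
have sL : \sum_(g <- gs) 12 * ln (T g)%:R <= 12 * ln q%:R :> R.
  rewrite -mulr_sumr ler_wpM2l //.
  have -> : \sum_(g <- gs) ln (T g)%:R = ln Pi%:R :> R.
    rewrite PiE; have : {in gs, forall g, (0 < T g)%N} by exact: T0.
    elim: gs => [|g l IH] h; first by rewrite !big_nil ln1.
    have hl : {in l, forall g, (0 < T g)%N} by move=> g' hg'; apply: h; rewrite inE hg' orbT.
    rewrite !big_cons natrM lnM ?posrE ?ltr0n ?IH ?h ?mem_head // big_seq.
    by elim/big_ind: _ => // x y; rewrite muln_gt0 => ->.
  rewrite ler_ln ?posrE ?ltr0n // ler_nat ltnW //; have := @Pi_lt 1 isT; by rewrite expn1.
have := SS11_le R q q0; have := SS11_ge0; rewrite K_E in d.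
move: d L MM_ge; move: (Q mean2 _ _) (Q (gk R) _ _) (Q (gkl R) _ _) (SS _ _ _ _) => x y z l d L My l0 l1.
apply: (@le_trans _ _ (n%:R * (l * y - z) + n%:R)).
  by move: d; rewrite ler_norml => /andP[_]; lra.
rewrite -{2}[n%:R]mulr1 -mulrDr ler_wpM2l // lerD2r mulrDl.
have a1 : l * y <= (ln q%:R + 5) * MM.
  by apply: le_trans (ler_wpM2l l0 (le_trans (ler_norm _) My)) _; rewrite ler_wpM2r.
have a2 : - z <= 12 * ln q%:R * MM.
  apply: le_trans (ler_norm _) _; rewrite normrN; apply: le_trans L _.
  by rewrite ler_wpM2r.
lra.
Qed.

(** P^6 is merged into the factor of its own group, so the other groups contribute as in [moment_B];
    5040 = 7 * 720 restores the factor 1 + k^2 sigma^2 of W. *)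
Lemma moment_PB g0 : g0 \in gs ->
  \sum_(j < n) normc (Pj g0 j) ^+ 12 * normc (Bj j) ^+ 2 <= n%:R * (5040 * sg g0 ^+ 6 * WW).
Proof.
move=> gg; pose X g := if g == g0 then lmul (ppow R (s g) 6) (Bg g) else Bg g.
have sX : {in gs, forall g, supp (s g) (X g)}.
  move=> g hg; rewrite /X; case: ifP => _; last exact: sB.
  by apply: supp_mul (sB hg); apply: supp_pw; apply: psg.
have bX : {in pr X gs, forall u : R * nat, (0 < u.2)%N /\ (u.2 <= Pi ^ 8)%N}.
  apply: pr_bound => // g hg u; rewrite /X; have bB v : v \in Bg g -> (v.2 <= T g ^ 2)%N.
    by apply: quad_le; [apply: sT | apply: T0].
  case: ifP => _ h; last by apply: leq_trans (bB _ h) _; rewrite leq_pexp2l ?T0.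
  case/allpairsPdep: h => x [y [xX yX ->]]; rewrite (expnD _ 6 2) leq_mul ?bB //.
  by apply: pw_le xX; apply: sT.
have -> : \sum_(j < n) normc (Pj g0 j) ^+ 12 * normc (Bj j) ^+ 2 =
    \sum_(j < n) 1 * normc (ev (cn j) (pr X gs)) ^+ 2.
  apply: eq_bigr => j _; rewrite mul1r.
  have c1 : cn j 1%N = 1 by apply: chi_nat1.
  have cM a b : cn j (a * b)%N = cn j a * cn j b by apply: chi_natM.
  have -> : ev (cn j) (pr X gs) = Pj g0 j ^+ 6 * Bj j.
    rewrite /Bj !ev_pr // (bigD1_seq g0) //= [in RHS](bigD1_seq g0) //= mulrA; congr (_ * _).
      by rewrite /X eqxx ev_mul // ev_pw.
    by apply: eq_bigr => g /negPf h; rewrite /X h.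
  by rewrite Normc.normcM normcX exprMn -exprM.
rewrite (@normc_sqr_ev (fun=> 1) (fun=> 1) (pr X gs) (fun m k => n%:R * eqk R m k)) // => [|u v uB vB]; last first.
  have [u1 u2] := bX _ uB; have [v1 v2] := bX _ vB.
  by apply: mean_ortho; rewrite // (leq_ltn_trans _ (@Pi_lt 8 isT)).
rewrite QZ ler_wpM2l // (Q_pr (s := s)) //; last exact: mulker_ortho.
rewrite /WW (bigD1_seq g0) //= [in leRHS](bigD1_seq g0) //= mulrA.
have -> : \prod_(g <- gs | g != g0) Q (eqk R) (X g) (X g) = \prod_(g <- gs | g != g0) (1 + k ^+ 2 * sg g).
  rewrite big_seq_cond [RHS]big_seq_cond; apply: eq_bigr => g /andP[hg /negPf h].
  by rewrite /X h; apply: ortho_quad; [exact: usg|exact: psg].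
apply: ler_wpM2r; first by apply: prodr_ge0 => g _; rewrite addr_ge0 // mulr_ge0 ?sqr_ge0.
rewrite /X eqxx; apply: le_trans (ortho_quad6 (usg gg) (psg gg) k) _.
have s6 : 0 <= sg g0 ^+ 6 by rewrite exprn_ge0.
have -> : 5040 * sg g0 ^+ 6 * (1 + k ^+ 2 * sg g0) = 720 * sg g0 ^+ 6 * (7 + 7 * k ^+ 2 * sg g0) by ring.
have c0 : 0 <= 720 * sg g0 ^+ 6 := mulr_ge0 (ler0n R 720) s6.
by move: (720 * _) c0 => c c0; apply: ler_wpM2l => //; lra.
Qed.

End Moments.

(** * Pointwise comparison of the models *)

Section LogBounds.
Variable R : realType.
Local Notation normc := (@Normc.normc R).

(** The difference vanishes at 1 and has derivative (y-1)^3/y, which changes sign there, so the mean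
    value theorem gives nonnegativity on both sides. *)
Lemma ln_ub3 (x : R) : 0 < x -> ln x <= (x - 1) - (x - 1) ^+ 2 / 2 + (x - 1) ^+ 3 / 3.
Proof.
move=> x0.
pose p : R -> R := fun y => y - 1.
pose f : R -> R := fun y => p y - p y ^+ 2 / 2 + p y ^+ 3 / 3 - ln y.
pose df (y : R) := 1 - p y + p y ^+ 2 - y^-1.
have D (y : R) : 0 < y -> is_derive y 1 f (df y).
  move=> y0; have dl := is_derive1_ln y0.
  have -> : f = (id - cst 1) - 2^-1 \*: (id - cst 1) ^+ 2 + 3^-1 \*: (id - cst 1) ^+ 3 - (@ln R).
        apply/funext => z; change (f z = (z - 1) - 2^-1 * (z - 1) ^+ 2 + 3^-1 * (z - 1) ^+ 3 - ln z).
    by rewrite /f /p; field.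
  have d1 : is_derive y 1 (id - cst 1 : R -> R) 1 by apply: is_derive_eq; rewrite subr0.
  have d2 := is_deriveX 2 d1; have d3 := is_deriveX 3 d1.
  have h := is_deriveB (is_deriveD (is_deriveB d1 (is_deriveZ 2^-1 d2)) (is_deriveZ 3^-1 d3)) dl.
  apply: is_derive_eq h _; rewrite /df /p !fctE /GRing.scale /=.
  by field; rewrite lt0r_neq0.
have dfE (y : R) : 0 < y -> df y = (y - 1) ^+ 3 / y.
  by move=> y0; rewrite /df /p; field; rewrite lt0r_neq0.
have cf (a b : R) : 0 < a -> {within `[a, b], continuous f}.
  move=> a0; apply: derivable_within_continuous => y; rewrite in_itv /= => /andP[ay _].
  by have [] := D y (lt_le_trans a0 ay).
have f1 : f 1 = 0 by rewrite /f /p subrr ln1 !expr0n /= !mul0r !subr0 addr0.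
suff : 0 <= f x by rewrite /f /p subr_ge0.
have [x1|x1|->] := ltgtP x 1; last by rewrite f1.
- have Di : forall y, y \in `]x, 1[ -> is_derive y 1 f (df y).
    by move=> y; rewrite in_itv /= => /andP[xy _]; apply: D; apply: lt_trans xy.
  have [c] := MVT x1 Di (cf _ _ x0); rewrite in_itv /= => /andP[xc c1].
  rewrite f1 sub0r dfE ?(lt_trans x0) // => e; rewrite -oppr_le0 e.
  apply: mulr_le0_ge0; last by rewrite subr_ge0 ltW.
  by rewrite pmulr_lle0 ?invr_gt0 ?(lt_trans x0) // exprn_odd_le0 // subr_le0 ltW.
- have Di : forall y, y \in `]1, x[ -> is_derive y 1 f (df y).
    by move=> y; rewrite in_itv /= => /andP[xy _]; apply: D; apply: lt_trans xy.
  have [c] := MVT x1 Di (cf _ _ ltr01); rewrite in_itv /= => /andP[c1 cx].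
  rewrite f1 subr0 dfE ?(lt_trans ltr01) // => ->.
  apply: mulr_ge0; last by rewrite subr_ge0 ltW.
  apply: divr_ge0; first by apply: exprn_ge0; rewrite subr_ge0 ltW.
  by rewrite ltW // (lt_trans ltr01).
Qed.

(** The upper bound is [ln_ub3] at 1 + t, the lower one [ln_ub3] at 1/(1 + t). *)
Lemma ln1D_approx (t : R) : `|t| <= 2^-1 -> `|ln (1 + t) - (t - t ^+ 2 / 2)| <= 3 * `|t| ^+ 3.
Proof.
move=> ht; have := ht; rewrite ler_norml => /andP[t1 t2].
have p : 0 < 1 + t by lra.
have e1 : 1 + t - 1 = t by ring.
have up := ln_ub3 p; rewrite e1 in up.
have pi : 0 < (1 + t)^-1 by rewrite invr_gt0.
have lo := ln_ub3 pi; rewrite lnV ?posrE // in lo.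
set d := (1 + t)^-1 in lo pi.
have de : d = 1 - t * d by rewrite /d; field; rewrite lt0r_neq0.
have d2 : d <= 2 by rewrite /d -[leRHS]invrK lef_pV2 ?posrE //; lra.
have e : d - 1 - (d - 1) ^+ 2 / 2 + (d - 1) ^+ 3 / 3 = - (t - t ^+ 2 / 2 + t ^+ 4 * d ^+ 2 / 2 + (t * d) ^+ 3 / 3).
  have -> : d - 1 = - (t * d) by rewrite {1}de; ring.
  have ed : t * d = t - t ^+ 2 * d by rewrite {1}de; ring.
  have ed2 : t ^+ 2 * d = t ^+ 2 - t ^+ 3 * d by rewrite {1}de; ring.
  have e2 : (t * d) ^+ 2 = t ^+ 2 - 2 * t ^+ 3 * d + t ^+ 4 * d ^+ 2 by rewrite exprMn {1}de; ring.
  by rewrite sqrrN e2 exprNn; lra.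
rewrite e in lo.
have n3 : `|t ^+ 3| = `|t| ^+ 3 by rewrite normrX.
have t3 := ler_norm (t ^+ 3); rewrite n3 in t3.
have td : `|(t * d) ^+ 3| <= 8 * `|t| ^+ 3.
  rewrite normrX normrM exprMn mulrC ler_wpM2r ?exprn_ge0 // (ger0_norm (ltW pi)).
  by rewrite (_ : 8 = 2 ^+ 3 :> R) ?lerXn2r ?nnegrE ?(ltW pi) //; ring.
have t4 : 0 <= t ^+ 4 * d ^+ 2 by rewrite mulr_ge0 ?sqr_ge0 // (exprM t 2 2) sqr_ge0.
have := ler_norm (- (t * d) ^+ 3); rewrite normrN => td'.
have n30 : 0 <= `|t| ^+ 3 by rewrite exprn_ge0.
rewrite ler_norml; apply/andP; split; lra.
Qed.

Lemma normc_sqr (w : R[i]) : normc w ^+ 2 = complex.Re w ^+ 2 + complex.Im w ^+ 2.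
Proof. by case: w => x y /=; rewrite sqr_sqrtr // addr_ge0 ?sqr_ge0. Qed.

(** With x = Re w and r = |w|, twice the logarithm is ln(1 + 2x + r^2), and Re(w - w^2/2) = x - x^2
    + r^2/2 collects half of its terms up to second order. *)
Lemma ln_normc_approx (w : R[i]) : normc w <= 8^-1 ->
  0 < normc (1 + w) /\ `|ln (normc (1 + w)) - complex.Re (w - w ^+ 2 / 2)| <= 17 * normc w ^+ 3.
Proof.
move=> w8; have r0 := normc_ge0 w; have xr := Re_le_normc w; have wE := normc_sqr w.
set x := complex.Re w in xr wE; set y := complex.Im w in wE; set r := normc w in w8 r0 xr wE *.
have N2 : normc (1 + w) ^+ 2 = 1 + (2 * x + r ^+ 2).
  by rewrite wE normc_sqr /x /y; case: (w) => a b /=; rewrite add0r; ring.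
have r2 : 0 <= r ^+ 2 <= r / 8 by rewrite sqr_ge0 expr2 ler_wpM2l.
have t2 : `|2 * x + r ^+ 2| <= 17 / 8 * r.
  by move: xr; rewrite !ler_norml => /andP[a b]; apply/andP; split; lra.
have N0 : 0 < normc (1 + w).
  rewrite lt0r normc_ge0 andbT; apply/eqP => e; move: N2; rewrite e expr0n /=.
  by move: t2; rewrite ler_norml => /andP[a b]; lra.
split=> //.
have lE : ln (normc (1 + w)) = ln (1 + (2 * x + r ^+ 2)) / 2 by rewrite -N2 lnXn // -[ln _ *+ 2]mulr_natr mulfK.
have h := @ln1D_approx (2 * x + r ^+ 2) (le_trans t2 (_ : _ <= 2^-1)).
have {}h := h ltac:(lra).
have Re2 : complex.Re (w - w ^+ 2 / 2) = x - (2 * x ^+ 2 - r ^+ 2) / 2.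
  rewrite wE /x /y; have -> : (2 : R[i])^-1 = (2^-1 : R)%:C by rewrite fmorphV rmorph_nat.
  by case: (w) => a b; rewrite /= !mulr0 !subr0 ?oppr0; field.
rewrite lE Re2; set t := 2 * x + r ^+ 2 in h t2 *.
have t3 : `|t| ^+ 3 <= 10 * r ^+ 3.
  apply: (@le_trans _ _ ((17 / 8 * r) ^+ 3)); first by rewrite lerXn2r ?nnegrE // mulr_ge0.
  by rewrite exprMn ler_wpM2r ?exprn_ge0 //; lra.
have e : (t - t ^+ 2 / 2) / 2 = x - (2 * x ^+ 2 - r ^+ 2) / 2 - x * r ^+ 2 - r ^+ 4 / 4 by rewrite /t; field.
have x3 : `|x * r ^+ 2| <= r ^+ 3 by rewrite normrM (ger0_norm (sqr_ge0 r)) (exprS r 2) ler_wpM2r ?sqr_ge0.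
have r4 : 0 <= r ^+ 4 <= r ^+ 3 by rewrite exprn_ge0 // (exprS r 3) ler_piMl ?exprn_ge0 //; lra.
move: h x3; move: e; move: (t - t ^+ 2 / 2) => u e; rewrite !ler_norml => /andP[h1 h2] /andP[x1 x2].
apply/andP; split; lra.
Qed.

(** Both models differ from 1 by at most [qradius k] times |z|; the condition |z| <= 1/(8 qradius k)
    brings this to at most 1/8, as [ln_normc_approx] requires. *)
Definition qradius (k : R) := 2 + 2 * `|k|.
Definition qconst (k : R) := (`|k| + `|k - 1|) * (17 * qradius k ^+ 3) + `|k| * (k - 1) ^+ 2.

(** The second-order terms cancel since 1 + (k-1) = k, and the difference of the two expansions is k
    (k-1)^2 (z^3/2 - z^4/8). This and the cubic errors of the two logarithms make up [qconst]. *)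
Lemma ln_twist (k : R) (z : R[i]) (a := 1 + ((k - 1)%:C * z + (- ((k - 1) / 2))%:C * z ^+ 2)) (b := 1 + k%:C * z) :
  normc z <= (8 * qradius k)^-1 ->
  [/\ 0 < normc a, 0 < normc b & k * ln (normc a) <= (k - 1) * ln (normc b) + qconst k * normc z ^+ 3].
Proof.
move=> hz; have r0 := normc_ge0 z; set r := normc z in hz r0 *.
have K2 : 2 <= qradius k by rewrite /qradius lerDl mulr_ge0.
have hr : qradius k * r <= 8^-1.
  by rewrite -ler_pdivlMl ?(lt_le_trans _ K2) // -invfM mulrC.
have r1 : r <= 1 by nra.
have bk : `|k - 1| <= 1 + `|k| by rewrite (le_trans (ler_normB _ _)) // normr1 addrC.
set be := k - 1 in a bk *.
set wa := be%:C * z + (- (be / 2))%:C * z ^+ 2; set wb := k%:C * z.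
have na : normc wa <= qradius k * r.
  apply: le_trans (le_normcD _ _) _; rewrite ![normc (_%:C * _)]Normc.normcM !normc_real normcX normrN normrM -/r.
  rewrite (ger0_norm (_ : 0 <= 2^-1)) ?invr_ge0 // /qradius.
  have : r ^+ 2 <= r by rewrite expr2 ler_piMl.
  by have := normr_ge0 be; nra.
have nb : normc wb <= qradius k * r.
  rewrite Normc.normcM normc_real -/r ler_wpM2r // /qradius; have := normr_ge0 k; lra.
have [a0 ha] := ln_normc_approx (le_trans na hr).
have [b0 hb] := ln_normc_approx (le_trans nb hr).
split=> //; rewrite -/wa -/wb.
have c3 w : normc w <= qradius k * r -> 17 * normc w ^+ 3 <= 17 * qradius k ^+ 3 * r ^+ 3.
  by move=> h; rewrite -mulrA -exprMn ler_wpM2l // lerXn2r ?nnegrE ?normc_ge0 // (le_trans (normc_ge0 w)).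
have {}ha := le_trans ha (c3 _ na); have {}hb := le_trans hb (c3 _ nb).
have key : k * complex.Re (wa - wa ^+ 2 / 2) - be * complex.Re (wb - wb ^+ 2 / 2) =
    complex.Re ((k * be ^+ 2)%:C * (2^-1%:C * z ^+ 3 - 8^-1%:C * z ^+ 4)).
  have ReM (c : R) (w : R[i]) : c * complex.Re w = complex.Re (c%:C * w).
    by case: w => u v /=; rewrite mul0r subr0.
  have ReB (u v : R[i]) : complex.Re u - complex.Re v = complex.Re (u - v) by case: u v => ? ? [].
  rewrite !ReM ReB; congr (complex.Re _); rewrite /wa /wb /be.
  rewrite !(rmorphM, rmorphN, rmorphB, rmorphXn, fmorphV, rmorph_nat, rmorph1) /=.
  by move: (k%:C) => K; field.
have r3 : 0 <= r ^+ 3 by rewrite exprn_ge0.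
have err : complex.Re ((k * be ^+ 2)%:C * (2^-1%:C * z ^+ 3 - 8^-1%:C * z ^+ 4)) <= `|k| * be ^+ 2 * r ^+ 3.
  apply: le_trans (ler_norm _) _; apply: le_trans (Re_le_normc _) _.
  rewrite Normc.normcM normc_real normrM (ger0_norm (sqr_ge0 be)).
  apply: ler_wpM2l; first by apply: mulr_ge0 => //; apply: sqr_ge0.
  apply: le_trans (le_normcD _ _) _; rewrite normcN ![normc (_%:C * _)]Normc.normcM !normc_real !normcX -/r.
  rewrite !ger0_norm ?invr_ge0 //.
  have : r ^+ 4 <= r ^+ 3 by rewrite (exprS r 3) ler_piMl.
  lra.
have mulb (c u v w : R) : `|u - v| <= w -> `|c * u - c * v| <= `|c| * w.
  by move=> h; rewrite -mulrBr normrM ler_wpM2l.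
have := mulb k _ _ _ ha; have := mulb be _ _ _ hb.
rewrite /qconst -/be !ler_norml => /andP[h1 h2] /andP[h3 h4]; lra.
Qed.

Lemma expR_sub_sqr (x : R) : 0 <= x -> expR (x - x ^+ 2) <= 1 + x.
Proof.
move=> x0; have p : 0 < 1 + x by lra.
have h : -1 < (1 + x)^-1 - 1 by rewrite ltrBrDr addNr invr_gt0.
have := le_ln1Dx h; rewrite addrC subrK lnV ?posrE // => l.
rewrite -[leRHS]lnK ?posrE // ler_expR.
have : (1 + x)^-1 = 1 - x + x ^+ 2 * (1 + x)^-1 by field; rewrite lt0r_neq0.
have : x ^+ 2 * (1 + x)^-1 <= x ^+ 2 by rewrite ler_piMr ?sqr_ge0 // invf_le1 // lerDl.
lra.
Qed.

(** Splits off exp(-sigma^2) relative to the factor of W; over all groups this produces a multiple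
    of 1/log q, which cancels the log q of the second moment. *)
Lemma second_moment_factor (k e s : R) : 0 <= s -> 0 <= e ->
  1 + (k ^+ 2 - 1) * s + e * s ^+ 2 <= (1 + k ^+ 2 * s) * expR (- s + (e + k ^+ 2) * s ^+ 2).
Proof.
move=> s0 e0; have k2 := sqr_ge0 k.
apply: (@le_trans _ _ ((1 + k ^+ 2 * s) * (1 + (- s + (e + k ^+ 2) * s ^+ 2)))); last first.
  by apply: ler_wpM2l; [rewrite addr_ge0 // mulr_ge0 | exact: expR_ge1Dx].
have : 0 <= k ^+ 2 * s * ((e + k ^+ 2) * s ^+ 2).
  apply: mulr_ge0; first exact: mulr_ge0.
  by apply: mulr_ge0; [exact: addr_ge0 | exact: sqr_ge0].
by move: (k ^+ 2) k2 => K K0; rewrite expr2; nra.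
Qed.

(** In general X Y <= X^2/(8C) + 2C Y^2; where X is small, X Y <= Y^2/8; where H > 1, Y^2 <= H Y^2.
    All terms but the good 2C Y^2 sum to at most 3N/8, so 2C times the good mass is at least
    3N/8. *)
Lemma good_mass n (X Y H : nat -> R) (N C e : R) : 0 <= N -> 0 < C -> 16 * C * e <= 1 ->
  (forall j, [/\ 0 <= X j, 0 <= Y j & 0 <= H j]) ->
  3 / 4 * N <= \sum_(j < n) X j * Y j -> \sum_(j < n) X j ^+ 2 <= C * N ->
  \sum_(j < n) Y j ^+ 2 = N -> \sum_(j < n) H j * Y j ^+ 2 <= e * N ->
  N / (8 * C) <= \sum_(j < n | (H j <= 1) && (8^-1 * Y j < X j)) Y j ^+ 2.
Proof.
move=> N0 C0 Ce pos h1 h2 h3 h4; set S := \sum_(j < n | _) _.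
have pt j : X j * Y j <= (8 * C)^-1 * X j ^+ 2 + 2 * C * (H j * Y j ^+ 2) + 8^-1 * Y j ^+ 2 +
    2 * C * (((H j <= 1) && (8^-1 * Y j < X j))%:R * Y j ^+ 2).
  have [x0 y0 H0] := pos j; have y2 := sqr_ge0 (Y j).
  have cx : 0 <= (8 * C)^-1 * X j ^+ 2 by rewrite mulr_ge0 ?invr_ge0 ?sqr_ge0 // mulr_ge0 // ltW.
  have amgm : X j * Y j <= (8 * C)^-1 * X j ^+ 2 + 2 * C * Y j ^+ 2.
    have := sqr_ge0 (X j - 4 * C * Y j) => sq.
    have -> : (8 * C)^-1 * X j ^+ 2 + 2 * C * Y j ^+ 2 = X j * Y j + (8 * C)^-1 * (X j - 4 * C * Y j) ^+ 2.
      by field; rewrite lt0r_neq0.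
    by rewrite lerDl mulr_ge0 // invr_ge0 mulr_ge0 // ltW.
  have C2 : 0 <= 2 * C * Y j ^+ 2 by rewrite !mulr_ge0 // ltW.
  have HC : 0 <= 2 * C * (H j * Y j ^+ 2) by rewrite !mulr_ge0 // ltW.
  case: (leP (H j) 1) => Hj; case: (ltP (8^-1 * Y j) (X j)) => xy; rewrite /= ?mul1r ?mul0r ?mulr0.
  - lra.
  - have : X j * Y j <= 8^-1 * Y j ^+ 2 by rewrite expr2 mulrA ler_wpM2r.
    lra.
  - have : 2 * C * Y j ^+ 2 <= 2 * C * (H j * Y j ^+ 2).
      by apply: ler_wpM2l; [rewrite mulr_ge0 // ltW | rewrite ler_peMl // ltW].
    lra.
  - have : X j * Y j <= 8^-1 * Y j ^+ 2 by rewrite expr2 mulrA ler_wpM2r.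
    lra.
have SE : S = \sum_(j < n) ((H j <= 1) && (8^-1 * Y j < X j))%:R * Y j ^+ 2.
  by rewrite /S big_mkcond; apply: eq_bigr => j _; case: ifP; rewrite ?mul1r ?mul0r.
have : \sum_(j < n) X j * Y j <= (8 * C)^-1 * (C * N) + 2 * C * (e * N) + 8^-1 * N + 2 * C * S.
  have hs : \sum_(j < n) X j * Y j <= \sum_(j < n) ((8 * C)^-1 * X j ^+ 2 + 2 * C * (H j * Y j ^+ 2) + 8^-1 * Y j ^+ 2 +
    2 * C * (((H j <= 1) && (8^-1 * Y j < X j))%:R * Y j ^+ 2)) by apply: ler_sum => j _; apply: pt.
  apply: le_trans hs _; rewrite !big_split -!mulr_sumr -SE /= h3.
  rewrite lerD2r lerD2r; apply: lerD; first by rewrite ler_wpM2l // invr_ge0 mulr_ge0 // ltW.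
  by rewrite ler_wpM2l // mulr_ge0 // ltW.
have -> : (8 * C)^-1 * (C * N) = 8^-1 * N by field; rewrite lt0r_neq0.
have : 2 * C * (e * N) <= 8^-1 * N.
  have -> : 2 * C * (e * N) = 8^-1 * (16 * C * e * N) by field.
  by rewrite ler_wpM2l // -[leRHS]mul1r ler_wpM2r.
move=> a1 a2; rewrite ler_pdivrMr ?mulr_gt0 //; lra.
Qed.

Lemma qconst_ge0 k : 0 <= qconst k.
Proof.
rewrite /qconst; apply: addr_ge0; apply: mulr_ge0; rewrite ?addr_ge0 ?sqr_ge0 //.
by apply: mulr_ge0 => //; apply: exprn_ge0; rewrite addr_ge0 // mulr_ge0.
Qed.

Lemma ln_normc_prod (G : eqType) (gs : seq G) (f : G -> R[i]) : {in gs, forall g, 0 < normc (f g)} ->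
  0 < normc (\prod_(g <- gs) f g) /\ ln (normc (\prod_(g <- gs) f g)) = \sum_(g <- gs) ln (normc (f g)).
Proof.
elim: gs => [_|g gs IH h]; first by rewrite !big_nil Normc.normc1 ln1.
have [|i1 i2] := IH; first by move=> g' hg; apply: h; rewrite inE hg orbT.
have g0 := h g (mem_head _ _).
by rewrite !big_cons Normc.normcM mulr_gt0 // lnM ?posrE // i2.
Qed.

(** In logarithms, k times the inequality for |lam A| less the comparison of A with B leaves k
    ln|lam| >= ln|B| - k ln 8 - qconst M, whatever the sign of k - 1. *)
Lemma twist_lower (G : eqType) (gs : seq G) (z : G -> R[i]) (lam : R[i]) (k M : R)
    (A := \prod_(g <- gs) (1 + ((k - 1)%:C * z g + (- ((k - 1) / 2))%:C * z g ^+ 2)))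
    (B := \prod_(g <- gs) (1 + k%:C * z g)) : 0 < k ->
  {in gs, forall g, normc (z g) <= (8 * qradius k)^-1} -> \sum_(g <- gs) normc (z g) ^+ 3 <= M ->
  8^-1 * normc B < normc (lam * A) ->
  expR (- (2 * k * ln 8 + 2 * qconst k * M)) * normc B ^+ 2 <= normc lam `^ (2 * k).
Proof.
move=> k0 hz hM hX.
have tw g (hg : g \in gs) := ln_twist (hz g hg).
have [A0 lA] := @ln_normc_prod G gs (fun g => 1 + ((k - 1)%:C * z g + (- ((k - 1) / 2))%:C * z g ^+ 2))
  (fun g hg => let: And3 h _ _ := tw g hg in h).
have [B0 lB] := @ln_normc_prod G gs (fun g => 1 + k%:C * z g) (fun g hg => let: And3 _ h _ := tw g hg in h).
rewrite -/A in A0 lA; rewrite -/B in B0 lB.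
have key : k * ln (normc A) <= (k - 1) * ln (normc B) + qconst k * M.
  apply: (@le_trans _ _ ((k - 1) * ln (normc B) + qconst k * \sum_(g <- gs) normc (z g) ^+ 3)).
    rewrite lA lB !mulr_sumr -big_split !big_seq; apply: ler_sum => g hg.
    by have [_ _] := tw g hg.
  by rewrite lerD2l ler_wpM2l // qconst_ge0.
rewrite Normc.normcM in hX.
have l0 : 0 < normc lam.
  rewrite -(pmulr_lgt0 _ A0); apply: le_lt_trans hX; rewrite mulr_ge0 // ltW //.
have lX : ln (normc B) - ln 8 < ln (normc lam) + ln (normc A).
  rewrite -lnM ?posrE // addrC -lnV ?posrE // -lnM ?posrE // ltr_ln ?posrE //; exact: mulr_gt0.
have -> : normc B ^+ 2 = expR (2 * ln (normc B)).
  by rewrite expRM_natl lnK ?posrE.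
rewrite /powR (gt_eqF l0) -expRD ler_expR.
have := ler_wpM2l (ltW k0) (ltW lX); lra.
Qed.

Lemma prod_upper (G : eqType) (gs : seq G) (s : G -> R) (k e : R) : 0 <= e ->
  {in gs, forall g, 0 <= s g <= 1} ->
  (e + k ^+ 2) * \sum_(g <- gs) s g ^+ 2 <= 1 ->
  \prod_(g <- gs) (1 + (k ^+ 2 - 1) * s g + e * s g ^+ 2) <=
  (\prod_(g <- gs) (1 + k ^+ 2 * s g)) * (expR 1 * expR (- \sum_(g <- gs) s g)).
Proof.
move=> e0 hs h.
apply: (@le_trans _ _ (\prod_(g <- gs) ((1 + k ^+ 2 * s g) * expR (- s g + (e + k ^+ 2) * s g ^+ 2)))).
  rewrite !big_seq; apply: ler_prod => g hg; have /andP[s0 s1] := hs g hg.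
  rewrite second_moment_factor // andbT.
  have a1 : 0 <= k ^+ 2 * s g by apply: mulr_ge0 => //; apply: sqr_ge0.
  have a2 : 0 <= e * s g ^+ 2 by apply: mulr_ge0 => //; apply: sqr_ge0.
  lra.
rewrite big_split /= -expR_sum ler_wpM2l //.
  rewrite big_seq; apply: prodr_ge0 => g hg; have /andP[s0 s1] := hs g hg.
  by apply: addr_ge0 => //; apply: mulr_ge0 => //; apply: sqr_ge0.
rewrite -expRD ler_expR big_split /= -mulr_sumr sumrN; lra.
Qed.

Lemma prod_lower (G : eqType) (gs : seq G) (s : G -> R) (k : R) :
  {in gs, forall g, 0 <= s g} -> k ^+ 4 * \sum_(g <- gs) s g ^+ 2 <= 1 ->
  expR (k ^+ 2 * \sum_(g <- gs) s g) * expR (- 1) <= \prod_(g <- gs) (1 + k ^+ 2 * s g).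
Proof.
move=> hs h; apply: (@le_trans _ _ (\prod_(g <- gs) expR (k ^+ 2 * s g - (k ^+ 2 * s g) ^+ 2))).
  rewrite -expR_sum -expRD ler_expR big_split /= -mulr_sumr lerD2l sumrN lerN2.
  by under eq_bigr do rewrite exprMn -exprM; rewrite -mulr_sumr.
rewrite !big_seq; apply: ler_prod => g hg; rewrite expR_ge0 /=; apply: expR_sub_sqr.
by apply: mulr_ge0; [exact: sqr_ge0 | exact: hs].
Qed.

(** One term or the other suffices according as x <= y or x > y. This converts twelfth moments into
    control of the sum of the |P_g|^3. *)
Lemma cube_le (x y : R) : 0 <= x -> 0 < y -> x ^+ 3 <= y ^+ 3 + (y ^+ 9)^-1 * x ^+ 12.
Proof.
move=> x0 y0; have y9 : 0 < y ^+ 9 by rewrite exprn_gt0.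
have [xy|yx] := leP x y.
  apply: (@le_trans _ _ (y ^+ 3)); first by rewrite lerXn2r ?nnegrE // ltW.
  by rewrite lerDl mulr_ge0 ?invr_ge0 ?exprn_ge0 // ltW.
apply: (@le_trans _ _ ((y ^+ 9)^-1 * x ^+ 12)); last by rewrite lerDr exprn_ge0 // ltW.
rewrite mulrC ler_pdivlMr // (exprD x 3 9) ler_wpM2l ?exprn_ge0 //.
by rewrite lerXn2r ?nnegrE // ltW.
Qed.

End LogBounds.

(** * The lower bound *)

Section LowerBound.
Variable R : realType.
Local Notation normc := (@Normc.normc R).
Variable k : R.
Hypothesis k0 : 0 < k.
Local Notation be := (k - 1).
Local Notation qe := (qerr be (- (be / 2))).
Local Notation d0 := ((8 * qradius k)^-1).
(** 320 * 56 and e^4 are those of [prime_groups] with [kap] = 56. In [Ee], 5040 comes from the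
    twelfth moment, 64 from (2 y^2)^6 and 60 from the sum of the y^3. *)
Definition Ke : R := (320 * 56)%:R * expR 4.
Definition De : R := 18 * Ke * expR 1 + 1.
Definition Ee : R := 5040 * 64 * 60.

(** The starting level has to exceed each summand: the first for the coefficients to be below T, the
    second for the hypothesis [sg1] of the moments, the third for the sums of sigma^4, the last for
    the characters with a large P_g. *)
Definition level_bound := 4 + 3 * `|k| + 4 * (2 * `|be| + be ^+ 2 + qe) + 240 * (qe + k ^+ 2 + k ^+ 4) +
  32 * Ee * De * (d0 ^+ 12)^-1.

Variable a : nat.
Hypothesis ha : level_bound <= a%:R.

Let qe0 : 0 <= qe. Proof. exact: qerr_ge0. Qed.
Let Ke0 : 0 <= Ke. Proof. exact: mulr_ge0 (ler0n _ _) (expR_ge0 _). Qed.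
Let De1 : 1 <= De.
Proof. by rewrite lerDr; apply: mulr_ge0; [exact: mulr_ge0 (ler0n _ _) Ke0 | exact: expR_ge0]. Qed.
Let Ee0 : 0 < Ee. Proof. by rewrite /Ee; lra. Qed.
Let qr0 : 0 < qradius k. Proof. by rewrite /qradius ltr_pwDl // mulr_ge0. Qed.
Let d00 : 0 < d0. Proof. by rewrite invr_gt0 mulr_gt0. Qed.
Let k2 : 0 <= k ^+ 2. Proof. exact: sqr_ge0. Qed.
Let k4 : 0 <= k ^+ 4. Proof. by apply: exprn_ge0; apply: ltW. Qed.
Let b2 : 0 <= be ^+ 2. Proof. exact: sqr_ge0. Qed.
Let dd : 0 <= 32 * Ee * De * (d0 ^+ 12)^-1.
Proof.
apply: mulr_ge0; last by rewrite invr_ge0 exprn_ge0 // ltW.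
by apply: mulr_ge0; [have := Ee0; lra | apply: le_trans De1].
Qed.

Let ha_parts : [/\ 4 + 3 * `|k| <= a%:R, 4 * (2 * `|be| + be ^+ 2 + qe) <= a%:R,
  240 * (qe + k ^+ 2 + k ^+ 4) <= a%:R & 32 * Ee * De * (d0 ^+ 12)^-1 <= a%:R].
Proof.
move: ha dd; rewrite /level_bound; have := normr_ge0 be; have := normr_ge0 k.
by move: (32 * _ * _ * _) => X; move: qe0 k2 k4 b2 => *; split; lra.
Qed.

Let pow_ge (b : nat) : (1 < b)%N -> a%:R <= b%:R ^+ a :> R.
Proof. by move=> b1; rewrite -natrX ler_nat ltnW // ltn_expl. Qed.

(* Starting the groups at the primes above 2^(16^a) costs a factor [4096 ^+ a] in the second moment, and
   gains [4 ^- (10 * a)] in the contribution of the characters with a large [P_g]. *)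
Definition cut1 : R := 32 * Ee * De * 4096 ^+ a.
Definition csec : R := De * 4096 ^+ a.
Definition eps : R := Ee * (cut1^-1 + (4 ^+ a)^-1 ^+ 9 * (4 ^+ a)^-1 * (d0 ^+ 12)^-1).
Definition cgood : R := expR (- (2 * k * ln 8 + 2 * qconst k * (60 + cut1))).

Let a0 : 0 < a%:R :> R.
Proof. by have [h _ _ _] := ha_parts; apply: lt_le_trans h; rewrite ltr_pwDl // mulr_ge0. Qed.

Let p4096 : 1 <= 4096 ^+ a :> R.
Proof. by apply: exprn_ege1; exact: (ler_nat R 1 4096). Qed.

Let cut1_gt0 : 0 < cut1.
Proof.
apply: mulr_gt0; last exact: lt_le_trans p4096.
by apply: mulr_gt0; [have := Ee0; lra | apply: lt_le_trans De1].
Qed.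

Let csec_ge1 : 1 <= csec.
Proof. by rewrite /csec -[leLHS]mul1r; apply: ler_pM. Qed.

(** [cut1] makes its own term exactly 1/2. In the other, 4^(-10 a) = 4096^(-a) 256^(-a): the first
    factor cancels the one in [csec], and 256^a is at least the last summand of [level_bound]. *)
Let eps_small : 16 * csec * eps <= 1.
Proof.
have [_ _ _ h] := ha_parts.
have De0 : 0 < De by apply: lt_le_trans De1.
have P0 : 0 < 4096 ^+ a :> R by apply: lt_le_trans p4096.
have e1 : 16 * csec * Ee * cut1^-1 = 2^-1.
  rewrite /csec /cut1; move: De De0 Ee Ee0 (4096 ^+ a) P0 => D D0 E E0 P P0.
  by field; rewrite !lt0r_neq0.
have e2 : 16 * csec * Ee * ((4 ^+ a)^-1 ^+ 9 * (4 ^+ a)^-1 * (d0 ^+ 12)^-1) <= 2^-1.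
  have q4 : (4 ^+ a)^-1 ^+ 9 * (4 ^+ a)^-1 = (4096 ^+ a)^-1 * (256 ^+ a)^-1 :> R.
    rewrite -exprSr exprVn -exprM mulnC exprM -invfM -exprMn; congr (_ ^+ a)^-1.
    by ring.
  rewrite q4 /csec; have p256 := pow_ge (isT : 1 < 256)%N.
  have Q0 : 0 < 256 ^+ a :> R by apply: lt_le_trans p256.
  have h' := le_trans h p256.
  move: De De0 Ee Ee0 (4096 ^+ a) P0 (256 ^+ a) Q0 ((d0 ^+ 12)^-1) h' => D D0 E E0 P P0 Q Q0 d h'.
  have -> : 16 * (D * P) * E * (P^-1 * Q^-1 * d) = (32 * E * D * d) / Q / 2.
    by field; rewrite !lt0r_neq0.
  by rewrite ler_pdivrMr // mulVf // ler_pdivrMr // mul1r.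
rewrite /eps mulrA mulrDr e1; lra.
Qed.

Section Fixed.
Variable q : nat.
Hypotheses (pq : prime q) (q129 : (129 ^ 4 <= q)%N) (lq : 1 <= ln (q%:R : R)).
Variables (gs : seq (nat * nat)) (s : nat * nat -> seq nat) (T : nat * nat -> nat) (y : nat * nat -> R).
Hypotheses (ugs : uniq gs) (us : uniq (flatten [seq s g | g <- gs])).
Hypothesis powT : ((\prod_(g <- gs) T g) ^ 56 <= q)%N.
Hypothesis hg : {in gs, forall g, [/\ {in s g, forall p, prime p && (p <= T g)%N}, (a <= T g)%N,
  0 < y g <= 4 ^- a & \sum_(p <- s g) (p%:R)^-1 <= 2 * y g ^+ 2]}.
Hypothesis hy : \sum_(g <- gs) y g ^+ 3 <= 60 * 4 ^- a.
Local Notation sgg g := (sg R (s g)).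
Local Notation S := (\sum_(g <- gs) sgg g).
Hypothesis hS : ln (q%:R : R) <= (320 * 56)%:R * expR 4 * 4096 ^+ a * expR S.
Local Notation n := q.-1.

Let y_le g : g \in gs -> [/\ 0 < y g, y g <= (a%:R)^-1 & y g <= (4 ^+ a)^-1].
Proof.
move=> gg; have [_ _ /andP[y0 y4] _] := hg gg; split=> //; apply: le_trans y4 _.
by rewrite lef_pV2 ?posrE // ?exprn_gt0 //; exact: (pow_ge (isT : 1 < 4)%N).
Qed.

Let y_le1 g : g \in gs -> y g <= 1.
Proof.
move=> /y_le[_ _ h]; apply: le_trans h _; rewrite invf_le1 ?exprn_gt0 //.
by apply: exprn_ege1; exact: (ler_nat R 1 4).
Qed.

Let sgP g : g \in gs -> [/\ 0 <= sgg g, sgg g <= 2 * y g ^+ 2 & sgg g <= 2 / a%:R].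
Proof.
move=> gg; have [_ _ _ h] := hg gg; have [y0 ya _] := y_le gg; have y1 := y_le1 gg.
split; [exact: sg_ge0 | exact: h | apply: le_trans h _].
by rewrite ler_wpM2l // expr2 (le_trans _ ya) // ler_piMr // ltW.
Qed.

Let sg1' : {in gs, forall g, sgg g <= 1 /\ (2 * `|be| + be ^+ 2) * sgg g + qe * sgg g ^+ 2 <= 2^-1}.
Proof.
move=> g gg; have [s0 _ sa] := sgP gg; have [p1 p2 _ _] := ha_parts.
have s1 : sgg g <= 1.
  apply: le_trans sa _; rewrite ler_pdivrMr // mul1r; have := normr_ge0 k; lra.
split=> //; have s2 : sgg g ^+ 2 <= sgg g by rewrite expr2 ler_piMr.
have c0 : 0 <= 2 * `|be| + be ^+ 2 + qe   by apply: addr_ge0 => //; apply: addr_ge0 => //; exact: mulr_ge0 (ler0n _ 2) (normr_ge0 be).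
apply: (@le_trans _ _ ((2 * `|be| + be ^+ 2 + qe) * (2 / a%:R))); last first.
  by rewrite mulrA ler_pdivrMr //; lra.
apply: (@le_trans _ _ ((2 * `|be| + be ^+ 2 + qe) * sgg g)); last by rewrite ler_wpM2l.
by rewrite [leRHS]mulrDl lerD2l ler_wpM2l.
Qed.

Let T1' : {in gs, forall g, 1 + `|be| + `|- (be / 2)| <= (T g)%:R /\ 1 + `|k| <= (T g)%:R}.
Proof.
move=> g gg; have [_ aT _ _] := hg gg; have [p1 _ _ _] := ha_parts.
have aT' : a%:R <= (T g)%:R :> R by rewrite ler_nat.
have bk : `|be| <= `|k| + 1 by rewrite (le_trans (ler_normB _ _)) // normr1.
rewrite normrN normrM (ger0_norm (_ : 0 <= 2^-1)) ?invr_ge0 //; have := normr_ge0 k; split; lra.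
Qed.

Local Notation Pi := (\prod_(g <- gs) T g)%N.
(** The origin of the exponent 56 = 4 * 14: Pi^56 <= q and 129^4 <= q give (129 Pi^14)^4 <= q^2. *)
Let hPi' : 129 * Pi%:R ^+ 14 <= Num.sqrt (q%:R : R).
Proof.
have h : ((129 * Pi ^ 14) ^ 2 <= q)%N.
  rewrite -leq_sqr -expnM expnMn -expnM [(q ^ 2)%N]expnS expn1; exact: leq_mul.
rewrite -natrX -natrM -[leLHS]ger0_norm // -sqrtr_sqr ler_sqrt //.
by rewrite -natrX ler_nat.
Qed.

Let sP' : {in gs, forall g, {in s g, forall p, prime p && (p <= T g)%N}}.
Proof. by move=> g /hg[]. Qed.

Local Notation W := (WW gs s k).
Local Notation X j := (normc (Lam R q j * Aj q gs s k j)).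
Local Notation Y j := (normc (Bj q gs s k j)).

Let W1 : 1 <= W. Proof. exact: WW_ge1. Qed.

Let sum_sq : \sum_(g <- gs) sgg g ^+ 2 <= 240 / a%:R.
Proof.
apply: (@le_trans _ _ (4 * \sum_(g <- gs) y g ^+ 3)).
  rewrite mulr_sumr !big_seq; apply: ler_sum => g gg; have [s0 s2 _] := sgP gg.
  have [y0 _ _] := y_le gg; have y1 := y_le1 gg.
  apply: (@le_trans _ _ ((2 * y g ^+ 2) ^+ 2)).
    by rewrite lerXn2r ?nnegrE //; apply: mulr_ge0 => //; apply: sqr_ge0.
  have -> : (2 * y g ^+ 2) ^+ 2 = 4 * (y g ^+ 3 * y g) by ring.
  by rewrite ler_wpM2l // ler_piMr // exprn_ge0 // ltW.
have -> : 240 / a%:R = 4 * (60 * a%:R^-1) :> R by field; rewrite lt0r_neq0.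
rewrite ler_wpM2l //; apply: le_trans hy _; rewrite ler_wpM2l // lef_pV2 ?posrE ?exprn_gt0 //.
exact: (pow_ge (isT : 1 < 4)%N).
Qed.

Let sum_sq_small c : 0 <= c -> 240 * c <= a%:R -> c * \sum_(g <- gs) sgg g ^+ 2 <= 1.
Proof.
move=> c0 hc; apply: le_trans (ler_wpM2l c0 sum_sq) _.
by rewrite mulrA ler_pdivrMr // mul1r mulrC.
Qed.

(** [prod_upper] leaves ln q exp(- S), bounded through [hS]: here the mean of |L A|^2 comes down to
    the order of W. As ln q >= 1, the factor 13 ln q + 5 is at most 18 ln q. *)
Let second : \sum_(j < n) X j ^+ 2 <= csec * (n%:R * W).
Proof.
apply: le_trans (moment_LA pq us sP' T1' sg1' (erefl Pi) hPi') _.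
have [_ _ p3 _] := ha_parts.
have hM : MM gs s k <= W * (expR 1 * expR (- S)).
  apply: prod_upper => //; first by move=> g gg; have [s0 _ _] := sgP gg; rewrite s0 (sg1' gg).1.
  apply: sum_sq_small; first exact: addr_ge0.
  by have := k4; lra.
rewrite [leRHS]mulrCA ler_wpM2l //.
have h1 : ln (q%:R : R) * expR (- S) <= Ke * 4096 ^+ a.
  by have := ler_wpM2r (expR_ge0 (- S)) hS; rewrite -[leRHS]mulrA -expRD subrr expR0 mulr1.
have L0 : 0 <= 13 * ln (q%:R : R) + 5.
  by apply: addr_ge0 => //; exact: mulr_ge0 (ler0n _ 13) (le_trans ler01 lq).
have L18 : 13 * ln (q%:R : R) + 5 <= 18 * ln (q%:R : R) by move: (ln _) lq => l l1; lra.
apply: (@le_trans _ _ ((18 * ln q%:R) * (W * (expR 1 * expR (- S))) + W)).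
  apply: lerD => //; apply: le_trans (ler_wpM2l L0 hM) _; rewrite ler_wpM2r //.
  by apply: mulr_ge0; [exact: le_trans W1 | apply: mulr_ge0; exact: expR_ge0].
have -> : 18 * ln q%:R * (W * (expR 1 * expR (- S))) + W = (18 * expR 1 * (ln q%:R * expR (- S)) + 1) * W by ring.
apply: ler_wpM2r; first exact: le_trans W1.
have e0 : 0 <= 18 * expR 1 :> R by apply: mulr_ge0 => //; exact: expR_ge0.
have := ler_wpM2l e0 h1; rewrite /csec => h2.
apply: le_trans (lerD h2 p4096) _; rewrite /De le_eqVlt; apply/orP; left; apply/eqP; ring.
Qed.

(** One quantity for both requirements: [Hj j <= 1] bounds every |P_g| by 1/(8 qradius k) through
    the second weight, and the sum of the |P_g|^3 through the first one and [cube_le]. *)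
Definition Hj j := \sum_(g <- gs) ((cut1 * y g ^+ 9)^-1 + (d0 ^+ 12)^-1) * normc (Pj R q s g j) ^+ 12.

Let Hweight g : g \in gs -> 0 <= (cut1 * y g ^+ 9)^-1 + (d0 ^+ 12)^-1.
Proof.
move=> /y_le[y0 _ _]; apply: addr_ge0; rewrite invr_ge0; last by rewrite exprn_ge0 // ltW.
by apply: mulr_ge0; [exact: ltW | rewrite exprn_ge0 // ltW].
Qed.

(** With sigma^12 <= 64 y^12 = 64 y^9 y^3, the first weight cancels y^9 and the second leaves y^9 <=
    4^(-9 a); the sum of the y^3 supplies one more 4^(-a). *)
Let HY : \sum_(j < n) Hj j * Y j ^+ 2 <= eps * (n%:R * W).
Proof.
have -> : \sum_(j < n) Hj j * Y j ^+ 2 =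
  \sum_(g <- gs) ((cut1 * y g ^+ 9)^-1 + (d0 ^+ 12)^-1) * \sum_(j < n) normc (Pj R q s g j) ^+ 12 * Y j ^+ 2.
  under eq_bigr do rewrite /Hj mulr_suml.
  rewrite exchange_big; apply: eq_bigr => g _; rewrite mulr_sumr.
  by apply: eq_bigr => j _; rewrite -[LHS]mulrA.
have nW0 : 0 <= n%:R * W by apply: mulr_ge0 => //; exact: le_trans W1.
apply: (@le_trans _ _ (\sum_(g <- gs) (5040 * 64 * (cut1^-1 + (4 ^+ a)^-1 ^+ 9 * (d0 ^+ 12)^-1) * y g ^+ 3) * (n%:R * W))).
  rewrite !big_seq; apply: ler_sum => g gg; have [s0 s2 _] := sgP gg; have [y0 _ y4] := y_le gg.
  apply: le_trans (ler_wpM2l (Hweight gg) (moment_PB pq ugs us sP' T1' (erefl Pi) hPi' gg)) _.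
  have s6 : sgg g ^+ 6 <= 64 * y g ^+ 12.
    have -> : 64 * y g ^+ 12 = (2 * y g ^+ 2) ^+ 6 by ring.
    by rewrite lerXn2r ?nnegrE //; apply: mulr_ge0 => //; apply: sqr_ge0.
  rewrite (_ : n%:R * (5040 * sgg g ^+ 6 * W) = 5040 * sgg g ^+ 6 * (n%:R * W)); last by rewrite mulrCA mulrA.
  rewrite [leLHS]mulrA; apply: ler_wpM2r => //.
  apply: (@le_trans _ _ (((cut1 * y g ^+ 9)^-1 + (d0 ^+ 12)^-1) * (5040 * (64 * y g ^+ 12)))).
    by apply: ler_wpM2l; [exact: Hweight gg | exact: (ler_wpM2l (ler0n R 5040) s6)].
  have y9 : y g ^+ 9 <= (4 ^+ a)^-1 ^+ 9 by rewrite lerXn2r ?nnegrE ?invr_ge0 ?exprn_ge0 // ltW.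
  have D0 : 0 <= (d0 ^+ 12)^-1 by rewrite invr_ge0 exprn_ge0 // ltW.
  have y3 : 0 <= y g ^+ 3 by rewrite exprn_ge0 // ltW.
  have -> : ((cut1 * y g ^+ 9)^-1 + (d0 ^+ 12)^-1) * (5040 * (64 * y g ^+ 12)) =
      5040 * 64 * (cut1^-1 + y g ^+ 9 * (d0 ^+ 12)^-1) * y g ^+ 3.
    by move: ((d0 ^+ 12)^-1) (y g) y0 cut1 cut1_gt0 => D z z0 c c0; rewrite invfM; field; rewrite !lt0r_neq0.
  apply: ler_wpM2r => //; apply: ler_wpM2l; first by lra.
  by rewrite lerD2l ler_wpM2r.
rewrite -mulr_suml; apply: ler_wpM2r => //; rewrite -mulr_sumr.
set B := cut1^-1 + _.
have B0 : 0 <= B.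
  apply: addr_ge0; first by rewrite invr_ge0 ltW.
  by apply: mulr_ge0; [rewrite exprn_ge0 // invr_ge0 exprn_ge0 | rewrite invr_ge0 exprn_ge0 // ltW].
have B1 : 0 <= 5040 * 64 * B := mulr_ge0 (mulr_ge0 (ler0n R 5040) (ler0n R 64)) B0.
apply: le_trans (ler_wpM2l B1 hy) _.
have c1 : cut1^-1 * (4 ^+ a)^-1 <= cut1^-1.
  rewrite ler_piMr ?invr_ge0 ?(ltW cut1_gt0) // invf_le1 ?exprn_gt0 //.
  by apply: exprn_ege1; exact: (ler_nat R 1 4).
have -> : 5040 * 64 * B * (60 * 4 ^- a) = Ee * (B * (4 ^+ a)^-1) by rewrite /Ee; ring.
rewrite /eps; apply: ler_wpM2l; first exact: ltW.
by rewrite /B mulrDl; apply: lerD => //; rewrite mulrAC.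
Qed.

Lemma moment_lower : cgood / (8 * csec) * (n%:R * W) <= \sum_(j < n) normc (Lam R q j) `^ (2 * k).
Proof.
have nW0 : 0 <= n%:R * W by apply: mulr_ge0 => //; exact: le_trans W1.
have pos j : [/\ 0 <= X j, 0 <= Y j & 0 <= Hj j].
  split; rewrite ?normc_ge0 // /Hj big_seq; apply: sumr_ge0 => g gg.
  by apply: mulr_ge0; [exact: Hweight | rewrite exprn_ge0 // normc_ge0].
have h := good_mass nW0 (lt_le_trans ltr01 csec_ge1) eps_small pos
  (moment_AB pq us sP' T1' (erefl Pi) hPi') second (moment_B pq us sP' T1' (erefl Pi) hPi') HY.
apply: (@le_trans _ _ (cgood * (n%:R * W / (8 * csec)))); first by rewrite mulrAC -mulrA.
have cg0 : 0 <= cgood by exact: expR_ge0.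
(* Characters outside the good set are dropped; for those inside it [twist_lower] applies. *)
apply: le_trans (ler_wpM2l cg0 h) _; rewrite mulr_sumr [leRHS](bigID (fun j : 'I_n => (Hj j <= 1) && (8^-1 * Y j < X j))) /=.
rewrite ler_wpDr //; first by apply: sumr_ge0 => j _; exact: powR_ge0.
apply: ler_sum => j /andP[H1 XY].
have Hg g : g \in gs -> ((cut1 * y g ^+ 9)^-1 + (d0 ^+ 12)^-1) * normc (Pj R q s g j) ^+ 12 <= 1.
  move=> gg; apply: le_trans H1; rewrite /Hj (bigD1_seq g) //= lerDl big_seq_cond.
  by apply: sumr_ge0 => g' /andP[gg' _]; apply: mulr_ge0; [exact: Hweight | rewrite exprn_ge0 // normc_ge0].
have P12 g : 0 <= normc (Pj R q s g j) ^+ 12 by rewrite exprn_ge0 // normc_ge0.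
have eA : Aj q gs s k j = \prod_(g <- gs) (1 + ((k - 1)%:C * Pj R q s g j + (- ((k - 1) / 2))%:C * Pj R q s g j ^+ 2)).
  rewrite /Aj ev_pr; [|exact: chi_nat1|exact: chi_natM].
  by apply: eq_bigr => g _; rewrite ev_quad; [|exact: chi_nat1|exact: chi_natM].
have eB : Bj q gs s k j = \prod_(g <- gs) (1 + k%:C * Pj R q s g j).
  rewrite /Bj ev_pr; [|exact: chi_nat1|exact: chi_natM].
  by apply: eq_bigr => g _; rewrite ev_quad ?mul0r ?addr0; [|exact: chi_nat1|exact: chi_natM].
rewrite eA eB in XY *; apply: twist_lower XY => //.
- move=> g gg; rewrite -(@ler_pXn2r _ 12) ?nnegrE ?normc_ge0 ?(ltW d00) //.
  have := Hg g gg; rewrite mulrDl => hh.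
  have y0 : 0 <= (cut1 * y g ^+ 9)^-1 * normc (Pj R q s g j) ^+ 12.
    have [y0 _ _] := y_le gg; apply: mulr_ge0 => //; rewrite invr_ge0.
    by apply: mulr_ge0; [exact: ltW | rewrite exprn_ge0 // ltW].
  have : (d0 ^+ 12)^-1 * normc (Pj R q s g j) ^+ 12 <= 1 by lra.
  by rewrite mulrC ler_pdivrMr ?exprn_gt0 // mul1r.
(* The cubes total at most 60 + cut1, as provided for in [cgood]: the y^3 by [hy], the rest by
   [cut1] times [Hj j]. *)
- apply: (@le_trans _ _ (\sum_(g <- gs) (y g ^+ 3 + cut1 * (((cut1 * y g ^+ 9)^-1 + (d0 ^+ 12)^-1) * normc (Pj R q s g j) ^+ 12)))).
    rewrite !big_seq; apply: ler_sum => g gg; have [y0 _ _] := y_le gg.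
    apply: le_trans (cube_le (normc_ge0 _) y0) _; rewrite lerD2l [leRHS]mulrA; apply: ler_wpM2r => //.
    have e9 : cut1 * (cut1 * y g ^+ 9)^-1 = (y g ^+ 9)^-1 by rewrite invfM mulVKf // lt0r_neq0.
    rewrite mulrDr e9 lerDl.
    by apply: mulr_ge0; [exact: ltW | rewrite invr_ge0 exprn_ge0 // ltW].
  rewrite big_split /= -mulr_sumr; apply: lerD; last by rewrite -[leRHS]mulr1; apply: ler_wpM2l; [exact: ltW | exact: H1].
  apply: le_trans hy _; rewrite ler_piMr // invf_le1 ?exprn_gt0 //.
  by apply: exprn_ege1; exact: (ler_nat R 1 4).
Qed.

(** W is at least exp(k^2 S - 1) by [prod_lower], and exp S at least ln q/(Ke 4096^a) by [hS]; the
    exponent k^2 of the logarithm arises here. *)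
Lemma moment_lower_log :
  cgood / (8 * csec) * (expR (- 1) * (Ke * 4096 ^+ a)^-1 `^ (k ^+ 2)) * (n%:R * ln (q%:R : R) `^ (k ^+ 2)) <=
  \sum_(j < n) normc (Lam R q j) `^ (2 * k).
Proof.
apply: le_trans moment_lower; rewrite -mulrA; apply: ler_wpM2l.
  by apply: divr_ge0; [exact: expR_ge0 | apply: mulr_ge0 => //; apply: le_trans csec_ge1].
rewrite mulrCA ler_wpM2l //; have [_ _ p3 _] := ha_parts.
have KP : 0 < Ke * 4096 ^+ a.
  apply: mulr_gt0; last exact: lt_le_trans p4096.
  by apply: mulr_gt0; [rewrite ltr0n muln_gt0 | exact: expR_gt0].
apply: le_trans (prod_lower (k := k) (fun g gg => let: And3 h _ _ := sgP gg in h) _); last first.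
  by apply: sum_sq_small => //; have := k2; have := qe0; lra.
rewrite -mulrA [leRHS]mulrC; apply: ler_wpM2l; first exact: expR_ge0.
rewrite -powRM ?invr_ge0 ?(ltW KP) ?(le_trans ler01 lq) //.
have -> : expR (k ^+ 2 * S) = expR S `^ (k ^+ 2).
  by rewrite /powR gt_eqF ?expR_gt0 // expRK.
apply: (ge0_ler_powR k2); rewrite ?nnegrE.
- by apply: mulr_ge0; [rewrite invr_ge0 ltW | apply: le_trans lq].
- exact: expR_ge0.
- by rewrite mulrC ler_pdivrMr // mulrC.
Qed.

End Fixed.
End LowerBound.

Lemma moment_lower_all (R : realType) (k : R) : 0 < k ->
  exists2 c : R, 0 < c & exists q0 : nat, forall q : nat, prime q -> (q0 <= q)%N ->
    1 <= ln (q%:R : R) /\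
    c * (q.-1%:R * ln (q%:R : R) `^ (k ^+ 2)) <= \sum_(j < q.-1) Normc.normc (Lam R q j) `^ (2 * k).
Proof.
move=> k0.
have lb0 : 0 <= level_bound k.
  rewrite /level_bound; have h1 := normr_ge0 k; have h2 := normr_ge0 (k - 1); have h3 := sqr_ge0 (k - 1).
  have h4 := qerr_ge0 (k - 1) (- ((k - 1) / 2)); have h5 := sqr_ge0 k.
  have h6 : 0 <= k ^+ 4 by rewrite exprn_ge0 // ltW.
  have h7 : 0 <= 32 * Ee R * De R * ((8 * qradius k)^-1 ^+ 12)^-1.
    have e1 : 0 <= Ee R by rewrite /Ee; lra.
    have e2 : 0 <= De R.
      by apply: addr_ge0 => //; apply: mulr_ge0 (expR_ge0 _); apply: mulr_ge0 (mulr_ge0 (ler0n _ _) (expR_ge0 _)).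
    have e3 : 0 <= ((8 * qradius k)^-1 ^+ 12)^-1.
      by rewrite invr_ge0 exprn_ge0 // invr_ge0 mulr_ge0 // addr_ge0 // mulr_ge0.
    by apply: mulr_ge0 e3; apply: mulr_ge0 e2; apply: mulr_ge0 e1.
  by move: (32 * _ * _ * _) h7 (qerr _ _) h4 => X X0 Z Z0; lra.
(* The starting level depends on k alone, hence so does the constant [c]. *)
set a := Num.bound (level_bound k).
have ha : level_bound k <= a%:R by apply: ltW; apply: archi_boundP.
have [q1 hq1] := @prime_groups R a 56 isT.
set c := cgood k a / (8 * csec R a) * (expR (- 1) * (Ke R * 4096 ^+ a)^-1 `^ (k ^+ 2)).
have De0 : 0 < De R.
  by apply: ltr_wpDl => //; apply: mulr_ge0 (expR_ge0 _); apply: mulr_ge0 (mulr_ge0 (ler0n _ _) (expR_ge0 _)).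
have P0 : 0 < 4096 ^+ a :> R by apply: exprn_gt0; rewrite ltr0n.
have Ke0 : 0 < Ke R by apply: mulr_gt0 (expR_gt0 _); rewrite ltr0n muln_gt0.
exists c.
  apply: mulr_gt0.
    by apply: divr_gt0; [exact: expR_gt0 | apply: mulr_gt0; [rewrite ltr0n | exact: mulr_gt0]].
  by apply: mulr_gt0; [exact: expR_gt0 | apply: powR_gt0; rewrite invr_gt0; exact: mulr_gt0].
exists (maxn q1 (maxn (129 ^ 4) (Num.bound (expR 1 : R)))) => q pq.
rewrite !geq_max => /and3P[h1 h2 h3].
have lq : 1 <= ln (q%:R : R).
  rewrite -[leLHS]expRK ler_ln ?posrE ?expR_gt0 ?ltr0n ?prime_gt0 //.
  by apply: le_trans (ltW (archi_boundP (expR_ge0 _))) _; rewrite ler_nat.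
have [gs [s [T [y [ugs us powT hg [hy hS]]]]]] := hq1 q h1.
split=> //; exact: (@moment_lower_log R k k0 a ha q pq h2 lq gs s T y ugs us powT hg hy hS).
Qed.

Theorem theorem1p1 (R : realType) (k : R) (hk : 0 <= k) :
  exists c : R, 0 < c /\
    exists q0 : nat, forall q : nat, prime q -> (q0 <= q)%N ->
      c * (phi_star R q)%:R * ln (q%:R : R) `^ (k ^+ 2) <=
      \sum_(chi \in primitive_characters R q)
         Normc.normc (dirichlet_L chi (2^-1)) `^ (2 * k).
Proof.
(* For k = 0 every term of the sum is 1, by the convention 0^0 = 1 also where the L-value
   vanishes. *)
have [k0|k0] := leP k 0.
  have -> : k = 0 by apply/le_anti; rewrite k0.
  exists 1; split=> //; exists 3%N => q pq q3.
  rewrite sum_primitiveE // phi_starE // expr0n /= powRr0 mulr1 mul1r mulr0.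
  under eq_bigr do rewrite powRr0.
  by rewrite sumr_const_nat subn1 -[leRHS]/(_%:R).
have [c c0 [q1 h1]] := moment_lower_all k0.
(* The bound just obtained is for the sum over all characters. The principal one, j = 0, accounts
   for at most [F], and c (q-1) >= 2 F for large q, so that half of [c] survives. *)
set F : R := 4 `^ (2 * k).
have F0 : 0 <= F by exact: powR_ge0.
exists (c / 2); split; first by rewrite divr_gt0.
exists (maxn q1 (Num.bound (2 * F / c)).+2) => q pq; rewrite geq_max => /andP[q1q q2].
have [lq h] := h1 q pq q1q.
rewrite sum_primitiveE // phi_starE //.
have n0 : (0 < q.-1)%N by have := prime_gt1 pq; case: (q) => [|[]].
have eL : \sum_(1 <= j < q.-1) Normc.normc (dirichlet_L (chi R q j) 2^-1) `^ (2 * k) =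
    \sum_(1 <= j < q.-1) Normc.normc (Lam R q j) `^ (2 * k).
  rewrite !big_nat; apply: eq_bigr => j /andP[j1 j2]; rewrite dirichlet_L_half //.
  by rewrite -lt0n.
rewrite eL; move: h; rewrite -(big_mkord xpredT (fun j => Normc.normc (Lam R q j) `^ (2 * k))) big_ltn //.
have L0 : Normc.normc (Lam R q 0) `^ (2 * k) <= F.
  apply: ge0_ler_powR; rewrite ?nnegrE ?normc_ge0 //; first by rewrite mulr_ge0.
  exact: Lam0_bound.
have l1 : 1 <= ln (q%:R : R) `^ (k ^+ 2).
  by rewrite -[leLHS](powRr0 (ln (q%:R : R))); apply: ler_powR lq _ _ _; apply: sqr_ge0.
have nF : 2 * F <= c * q.-1%:R.
  rewrite [leRHS]mulrC -ler_pdivrMr //; apply: le_trans (ltW (archi_boundP _)) _.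
    by rewrite divr_ge0 ?mulr_ge0 // ltW.
  by rewrite ler_nat; move: q2; case: (q) => // m; rewrite ltnS => /ltnW.
have nn : (q.-1.-1%:R : R) <= q.-1%:R by rewrite ler_nat leq_pred.
move: (ln _ `^ _) l1 => l l1; move: (\sum_(1 <= j < _) _) => Z h.
have a1 : c * q.-1%:R <= c * (q.-1%:R * l).
  by rewrite ler_wpM2l ?(ltW c0) // ler_peMr.
have a2 : c / 2 * q.-1.-1%:R * l <= c / 2 * (q.-1%:R * l).
  by rewrite -mulrA ler_wpM2l ?divr_ge0 ?(ltW c0) // ler_wpM2r // (le_trans ler01).
have a3 : c / 2 * (q.-1%:R * l) = c * (q.-1%:R * l) / 2 by rewrite mulrAC.
lra.
Qed.
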